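(* Let $\lambda$ be a Salem number such that $\log(\lambda)$ is the topological entropy of some automorphism of some two-dimensional complex torus. Then either: \begin{itemize} \item[1)] one of $\lambda+\lambda^{-1}+2$ or $\lambda+\lambda^{-1}-2$ is the square of an integer; or \item[2)] the set of isomorphism classes of two-dimensional complex tori that admit automorphisms whose entropies are $\log(\lambda)$ is finite. \end{itemize}
   Context: A two-dimensional complex torus is a quotient $\mathbb{C}^2/\Lambda$ with $\Lambda\subseteq\mathbb{C}^2$ a lattice (a discrete subgroup of rank four). An automorphism is a biholomorphic self-map (not required to fix the origin). Entropy means topological entropy. A Salem polynomial is a monic, reciprocal polynomial in $\mathbb{Z}[t]$, irreducible over $\mathbb{Q}$, having exactly two roots with magnitude not equal to one; a Salem number is a real number $\lambda>1$ that is the largest real root of a Salem polynomial. In particular, Salem numbers of degree two are allowed. *)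

(* Defs.v *)
From HB Require Import structures.
From mathcomp Require Import all_boot all_order all_algebra.
From mathcomp Require Import generic_quotient.
From mathcomp Require Import all_classical all_reals all_analysis.
From mathcomp.real_closed Require Import complex.

Set Implicit Arguments.
Unset Strict Implicit.
Unset Printing Implicit Defensive.

Import Order.TTheory GRing.Theory Num.Theory.
Import numFieldNormedType.Exports.

Local Open Scope classical_set_scope.
Local Open Scope ring_scope.
Local Open Scope complex_scope.
Local Open Scope quotient_scope.

(* As a numFieldType, R[i] carries the complex norm, its topology, and the
   notion of (complex) differentiability. *)
Definition Cplx (R : realType) : numFieldType := R[i].

Notation C2 R := 'rV[Cplx R]_2.

Section TopologicalEntropy.
Context (R : realType) (T : topologicalType).

Definition open_cover (U : set (set T)) : Prop :=
  (forall A, U A -> open A) /\ \bigcup_(A in U) A = setT.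

(* N(U): the least cardinality of a finite subcover, +oo if there is none. *)
Definition cover_number (U : set (set T)) : \bar R :=
  ereal_inf [set n%:R%:E | n in [set n : nat |
    exists V : set (set T),
      [/\ V `<=` U, (V #= `I_n)%card & \bigcup_(A in V) A = setT]]].

Definition cover_join (U V : set (set T)) : set (set T) :=
  [set A `&` B | A in U & B in V].

(* U \/ f^-1 U \/ ... \/ f^-(n-1) U *)
Definition iterated_cover (f : T -> T) (U : set (set T)) (n : nat) :
    set (set T) :=
  \big[cover_join/[set setT]]_(i < n) [set iter i f @^-1` A | A in U].

(* The sequence converges (by subadditivity) for T compact and f continuous,
   so that the upper limit is then the limit. *)
Definition cover_entropy (f : T -> T) (U : set (set T)) : \bar R :=
  limn_esup (fun n => lne (cover_number (iterated_cover f U n)) *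
                      (n%:R^-1)%:E)%E.

(* Adler-Konheim-McAndrew *)
Definition topological_entropy (f : T -> T) : \bar R :=
  ereal_sup [set cover_entropy f U | U in open_cover].

End TopologicalEntropy.

Definition Z_basis (V : zmodType) (n : nat) (b : 'I_n -> V) (L : set V) : Prop :=
  (forall c : 'I_n -> int, \sum_(i < n) b i *~ c i = 0 -> forall i, c i = 0) /\
  L = [set \sum_(i < n) b i *~ c i | c in [set: 'I_n -> int]].

Record is_lattice (R : realType) (L : set (C2 R)) : Prop := IsLattice {
  lattice0 : L 0;
  latticeB : forall x y, L x -> L y -> L (x - y);
  lattice_discrete : L `<=` isolated L;
  lattice_rank4 : exists b : 'I_4 -> C2 R, Z_basis b L
}.

Record torus2 (R : realType) := Torus2 {
  lattice : set (C2 R);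
  latticeP : is_lattice lattice
}.

Section Torus.
Context (R : realType).

Definition lattice_rel (X : torus2 R) : rel (C2 R) :=
  fun x y => `[< lattice X (x - y) >].

Fact lattice_rel_equiv (X : torus2 R) : equiv_class_of (lattice_rel X).
Proof.
case: X => L [L0 LB Ld Lr]; rewrite /lattice_rel /=.
have LN x y : L (x - y) -> L (y - x).
  by move=> Lxy; rewrite -opprB -sub0r; exact: LB.
split=> [x|x y|y x z].
- by rewrite subrr; exact/asboolP.
- by apply/idP/idP => /asboolP Lxy; apply/asboolP; exact: LN Lxy.
- move=> /asboolP Lxy /asboolP Lyz; apply/asboolP.
  have -> : x - z = (x - y) - (z - y) by rewrite opprB addrA subrK.
  by apply: LB => //; exact: LN Lyz.
Qed.

Canonical lattice_equiv (X : torus2 R) : equiv_rel (C2 R) :=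
  EquivRelPack (lattice_rel_equiv X).

Definition torus_points (X : torus2 R) : topologicalType :=
  quotient_topology {eq_quot lattice_equiv X}.

Definition torus_proj (X : torus2 R) : C2 R -> torus_points X :=
  \pi_(quotient_topology {eq_quot lattice_equiv X}).

(* The complex structure of C^2/L: its charts are the inverses of the
   projection restricted to open sets U of C^2 on which it is injective. *)
Definition chart_range (X : torus2 R) (U : set (C2 R)) : Prop :=
  open U /\ {in U &, injective (torus_proj X)}.

Definition chart (X : torus2 R) (U : set (C2 R)) : torus_points X -> C2 R :=
  'pinv_(fun=> 0) U (torus_proj X).

(* f is holomorphic if it is continuous and chart V \o f \o (chart U)^-1 is
   complex differentiable at every point of its domain, an open subset of U. *)
Definition holomorphic (X Y : torus2 R)
    (f : torus_points X -> torus_points Y) : Prop :=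
  continuous f /\
  forall U V, chart_range X U -> chart_range Y V ->
  forall z, U z -> (torus_proj Y @` V) (f (torus_proj X z)) ->
  differentiable (chart V \o f \o torus_proj X) z.

Definition biholomorphic (X Y : torus2 R)
    (f : torus_points X -> torus_points Y) : Prop :=
  exists g : torus_points Y -> torus_points X,
    [/\ cancel f g, cancel g f, holomorphic f & holomorphic g].

Definition isomorphic (X Y : torus2 R) : Prop :=
  exists f : torus_points X -> torus_points Y, biholomorphic f.

Definition isomorphism_class (X : torus2 R) : set (torus2 R) :=
  [set Y | isomorphic X Y].

Definition automorphism (X : torus2 R) (f : torus_points X -> torus_points X) :=
  biholomorphic f.

Definition admits_entropy (h : \bar R) (X : torus2 R) : Prop :=
  exists f : torus_points X -> torus_points X,
    automorphism f /\ topological_entropy R f = h.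

End Torus.

Definition reciprocal_poly (p : {poly int}) : Prop :=
  forall i, (i < size p)%N -> p`_i = p`_((size p).-1 - i).

Definition salem_poly (R : realType) (p : {poly int}) : Prop :=
  [/\ p \is monic, reciprocal_poly p,
      irreducible_poly (map_poly intr p : {poly rat}) &
      ([set z : R[i] | root (map_poly intr p) z /\ `|z| != 1%R] #= `I_2)%card].

Definition salem_number (R : realType) (x : R) : Prop :=
  1 < x /\ exists p : {poly int},
    [/\ salem_poly R p, root (map_poly intr p) x &
        forall y : R, root (map_poly intr p) y -> y <= x].

(* Main.v *)
Require Import Defs.
From HB Require Import structures.
From mathcomp Require Import all_boot all_order all_algebra.
From mathcomp Require Import generic_quotient.
From mathcomp Require Import all_classical all_reals all_analysis.
From mathcomp.real_closed Require Import complex.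
From mathcomp Require Import ring lra.

(** An automorphism of the torus C^2/L is induced by an affine map z |-> zA + b
    with LA = L: the lift of an increment of the map to C^2 is a bounded entire
    function, hence constant.  Its entropy is 2 log |a1| when the eigenvalues of A
    satisfy |a1| > 1 > |a2| and 0 when both have modulus one, so entropy
    log(lambda) > 0 forces |a1|^2 = lambda and |a2|^2 = 1/lambda.  The
    characteristic polynomial of A acting on L is the integral polynomial P with
    roots a1, a2 and their conjugates.  A linear factor of P over Q would have the
    root 1 or -1, which is excluded by the moduli; a quadratic factor has one root
    of each modulus, hence real roots a1 and 1/a1 or -1/a1, whose sum is an integer
    with square lambda + 1/lambda + 2 or lambda + 1/lambda - 2.  Otherwise P is
    irreducible.  There are finitely many possible P because the coefficients are
    bounded, and for fixed (a1, a2) the lattice L, written in eigencoordinates, is a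
    module over Z[A].  Take l in L whose norm |l_1 l_2| is minimal up to a factor 2
    and rescale the coordinates so that l = (1, 1).  By simultaneous approximation
    (Hurwitz's argument for the finiteness of class numbers) L then lies between
    the module O spanned over Z by the vectors (a1^k, a2^k), k < 4, and O/H for an
    integer H depending only on (a1, a2), which leaves finitely many lattices. *)

Set Implicit Arguments.
Unset Strict Implicit.
Unset Printing Implicit Defensive.

Import Order.TTheory GRing.Theory Num.Theory.
Import numFieldNormedType.Exports.
Import ComplexField.Normc.

Local Open Scope classical_set_scope.
Local Open Scope ring_scope.
Local Open Scope complex_scope.

(** * The real-valued modulus on C *)

(** The order Z[A] need not be maximal, so ideal factorisation is not at hand. Hurwitz's argument
    asks for less: |q(a1) q(a2)| >= 1 for an integer polynomial q vanishing at neither a1 nor a2,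
    which holds because the square of this number is the determinant of an integer matrix.
    Irreducibility of P enters in the form that no nonzero integer polynomial of degree at most 3
    vanishes at a1 or a2; hence no nonzero vector of L has a zero coordinate, and rescaling by such
    a vector is invertible. The rescaling is diagonal, so it commutes with A. Minimality up to a
    factor 2 avoids showing that the infimum is attained, and it suffices: a remainder with both
    coordinates below 1/2 has norm below 1/4. The integer H is (T^4)!, where T makes all real
    combinations of the four power vectors with coefficients below 1/T shorter than 1/2. The
    relation |a1 a2| = 1 holds because |det A|^2 is the determinant of A on L, a unit of Z. Entropy
    is estimated directly with covers: from above by a grid adapted to an eigenbasis, from below by
    separated points on an expanding eigenline. When both moduli are 1, A may be a Jordan block,
    which calls for a separate upper bound. *)

Section ComplexModulus.
Context (R : realType).
Implicit Types (z w : R[i]) (x y : R).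

(** The norm of [R[i]] takes its values in [R[i]] itself; the real-valued [normc] brings estimates
    into an ordered field where [lra] applies. *)
Lemma normcE z : `|z| = (normc z)%:C. Proof. by []. Qed.

Lemma normc_ge0 z : 0 <= normc z.
Proof. by case: z => a b; exact: sqrtr_ge0. Qed.

Lemma normc_eq0 z : (normc z == 0) = (z == 0).
Proof. by apply/eqP/eqP => [/eq0_normc//|->]; exact: normc0. Qed.

Lemma normc_gt0 z : (0 < normc z) = (z != 0).
Proof. by rewrite lt_def normc_ge0 andbT normc_eq0. Qed.

Lemma ler_normcD z w : normc (z + w) <= normc z + normc w.
Proof. exact: le_normcD. Qed.

Lemma normc_opp z : normc (- z) = normc z.
Proof. exact: normcN. Qed.

Lemma normc_distC z w : normc (z - w) = normc (w - z).
Proof. by rewrite -opprB normc_opp. Qed.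

Lemma ler_normcB z w : normc (z - w) <= normc z + normc w.
Proof. by rewrite -(normc_opp w); exact: ler_normcD. Qed.

Lemma normc_real x : normc x%:C = `|x|.
Proof. by rewrite /= expr0n addr0 sqrtr_sqr. Qed.

Lemma normc_i : normc ('i%C : R[i]) = 1.
Proof. by rewrite /= expr0n add0r expr1n sqrtr1. Qed.

Lemma normcX z n : normc (z ^+ n) = normc z ^+ n.
Proof. by elim: n => [|n IH]; rewrite ?normc1 // !exprS normcM IH. Qed.

Lemma sqr_normcE z : normc z ^+ 2 = complex.Re z ^+ 2 + complex.Im z ^+ 2.
Proof. by case: z => a b /=; rewrite sqr_sqrtr // addr_ge0 ?sqr_ge0. Qed.

Lemma ler_normcRe z : `|complex.Re z| <= normc z.
Proof.
rewrite -(@ler_pXn2r _ 2) ?nnegrE ?normc_ge0 // sqr_normcE real_normK ?num_real //.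
by rewrite lerDl sqr_ge0.
Qed.

Lemma ler_normcIm z : `|complex.Im z| <= normc z.
Proof.
rewrite -(@ler_pXn2r _ 2) ?nnegrE ?normc_ge0 // sqr_normcE real_normK ?num_real //.
by rewrite lerDr sqr_ge0.
Qed.

Lemma normc_le_ReIm z : normc z <= `|complex.Re z| + `|complex.Im z|.
Proof.
rewrite -(@ler_pXn2r _ 2) ?nnegrE ?normc_ge0 ?addr_ge0 // sqr_normcE sqrrD.
rewrite !real_normK ?num_real //.
by have := mulr_ge0 (normr_ge0 (complex.Re z)) (normr_ge0 (complex.Im z)); lra.
Qed.

Lemma normc_conj z : normc z^* = normc z.
Proof. by case: z => a b /=; rewrite sqrrN. Qed.

Lemma mulc_conj z : z * z^* = (normc z ^+ 2)%:C.
Proof. by rewrite -sqr_normc normcE -rmorphXn. Qed.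

End ComplexModulus.

(** * Simultaneous approximation and lattices in C^2 *)

Section Dirichlet.
Context (R : realType).

(** Dirichlet's pigeonhole: among the [T ^ n + 1] points of fractional parts of [m * t], two lie in
    the same one of the [T ^ n] boxes of side [1 / T], and the difference of their indices works. *)
Lemma simultaneous_approximation (n : nat) (t : 'I_n -> R) (T : nat) : (0 < T)%N ->
  exists (m : nat) (c : 'I_n -> int), (0 < m <= T ^ n)%N /\
    forall i, `|m%:R * t i - (c i)%:~R| < T%:R^-1.
Proof.
move=> T0; have T0' : 0 < T%:R :> R by rewrite ltr0n.
pose fr (x : R) := x - (Num.floor x)%:~R.
have fr_ge0 x : 0 <= fr x by rewrite subr_ge0 floor_le_tmp.
have fr_lt1 x : fr x < 1 by rewrite ltrBlDr addrC -intrD1 floorD1_gt.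
pose box (x : R) := Num.trunc (T%:R * fr x).
have boxP x : (box x)%:R <= T%:R * fr x < (box x).+1%:R.
  by apply: truncn_itv; apply: mulr_ge0 => //; exact: ltW.
have box_lt x : (box x < T)%N.
  rewrite -(ltr_nat R); have /andP[le_b _] := boxP x; apply: le_lt_trans le_b _.
  by rewrite -[ltRHS]mulr1 ltr_pM2l.
pose F (m : 'I_(T ^ n).+1) := [ffun i : 'I_n => Ordinal (box_lt (m%:R * t i))].
have /injectivePn[m [m' mm' Fmm']] : ~~ injectiveb F.
  apply/negP => /injectiveP/leq_card.
  by rewrite card_ord card_ffun !card_ord ltnn.
wlog ltm : m m' mm' Fmm' / (m < m')%N.
  move=> wl; have [lt|lt|/val_inj eqm] := ltngtP m m'; first exact: (wl m m').
    by apply: (wl m' m) => //; rewrite eq_sym.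
  by rewrite eqm eqxx in mm'.
exists (m' - m)%N, (fun i => Num.floor (m'%:R * t i) - Num.floor (m%:R * t i)).
split=> [|i].
  by rewrite subn_gt0 ltm (leq_trans (leq_subr _ _)) // -ltnS.
have /(congr1 val) /= eqbox := congr1 (fun f : {ffun 'I_n -> 'I_T} => f i) Fmm'.
rewrite !ffunE /= in eqbox.
have := boxP (m%:R * t i); have := boxP (m'%:R * t i); rewrite eqbox.
rewrite natrB 1?ltnW // rmorphB /=.
have -> : (m'%:R - m%:R) * t i -
    ((Num.floor (m'%:R * t i))%:~R - (Num.floor (m%:R * t i))%:~R) =
    fr (m'%:R * t i) - fr (m%:R * t i) by rewrite /fr; ring.
set x := fr _; set y := fr _; set k := box _; rewrite -(natr1 k) => xk yk.
rewrite -(@ltr_pM2l _ T%:R) // divff ?gt_eqF // -[X in X * _]gtr0_norm // -normrM.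
by rewrite mulrBr ltr_norml; lra.
Qed.

End Dirichlet.

(** * The maximum norm and the topology of C^2 *)

Section PlaneNorm.
Context (R : realType).
Implicit Types (u v w : C2 R) (a : Cplx R).

Definition vnorm v : R := Num.max (normc (v ord0 ord0)) (normc (v ord0 ord_max)).

Lemma ord2P (P : 'I_2 -> Prop) : P ord0 -> P ord_max -> forall i, P i.
Proof.
move=> P0 P1 i; case: (unliftP ord0 i) => [j ->|->] //.
by have -> : lift ord0 j = ord_max by apply/val_inj; case: j => [[]].
Qed.

Lemma vnorm_lt v (e : R) :
  (vnorm v < e) = (normc (v ord0 ord0) < e) && (normc (v ord0 ord_max) < e).
Proof. by rewrite /vnorm gt_max. Qed.

Lemma vnorm_le v (e : R) :
  (vnorm v <= e) = (normc (v ord0 ord0) <= e) && (normc (v ord0 ord_max) <= e).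
Proof. by rewrite /vnorm ge_max. Qed.

Lemma normc_le_vnorm v i : normc (v ord0 i) <= vnorm v.
Proof. by move: i; apply: ord2P; rewrite /vnorm le_max lexx ?orbT. Qed.

Lemma vnorm_ge0 v : 0 <= vnorm v.
Proof. exact: le_trans (normc_ge0 _) (normc_le_vnorm v ord0). Qed.

Lemma vnormD u v : vnorm (u + v) <= vnorm u + vnorm v.
Proof.
by rewrite vnorm_le !mxE; apply/andP; split; apply: le_trans (ler_normcD _ _) _;
  apply: lerD; exact: normc_le_vnorm.
Qed.

Lemma vnormZ a v : vnorm (a *: v) = normc a * vnorm v.
Proof. by rewrite /vnorm !mxE !normcM maxr_pMr // normc_ge0. Qed.

Lemma vnormN v : vnorm (- v) = vnorm v.
Proof. by rewrite /vnorm !mxE !normc_opp. Qed.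

Lemma vnormB u v : vnorm (u - v) <= vnorm u + vnorm v.
Proof. by rewrite -(vnormN v); exact: vnormD. Qed.

Lemma vnorm_distC u v : vnorm (u - v) = vnorm (v - u).
Proof. by rewrite -opprB vnormN. Qed.

Lemma vnorm0 : vnorm 0 = 0.
Proof. by rewrite /vnorm !mxE normc0 maxxx. Qed.

Lemma vnorm_eq0 v : (vnorm v == 0) = (v == 0).
Proof.
apply/idP/eqP => [/eqP v0|->]; last by rewrite vnorm0.
have le0 i : normc (v ord0 i) <= 0 by rewrite -v0 normc_le_vnorm.
apply/rowP => i; rewrite mxE; apply/eqP; rewrite -normc_eq0 eq_le le0 normc_ge0 //.
Qed.

Lemma vnorm_gt0 v : (0 < vnorm v) = (v != 0).
Proof. by rewrite lt_def vnorm_ge0 andbT vnorm_eq0. Qed.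

Lemma vnorm_sum (I : finType) (F : I -> C2 R) : vnorm (\sum_i F i) <= \sum_i vnorm (F i).
Proof.
elim/big_rec2 : _ => [|i x y _ xy]; first by rewrite vnorm0.
by apply: le_trans (vnormD _ _) _; rewrite lerD2l.
Qed.

Lemma vnorm_mulmx (A : 'M[Cplx R]_2) : exists2 K : R, 0 < K &
  forall v, vnorm (v *m A) <= K * vnorm v.
Proof.
pose K := \sum_i \sum_j normc (A i j) + 1.
have K0 : 0 <= \sum_i \sum_j normc (A i j).
  by apply: sumr_ge0 => i _; apply: sumr_ge0 => j _; exact: normc_ge0.
exists K => [|v]; first by rewrite /K ltr_wpDl.
have le_j j : normc ((v *m A) ord0 j) <= K * vnorm v.
  rewrite mxE; apply: (@le_trans _ _ (\sum_i vnorm v * normc (A i j))).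
    elim/big_rec2 : _ => [|i x y _ xy]; first by rewrite normc0.
    apply: le_trans (ler_normcD _ _) _; apply: lerD => //.
    by rewrite normcM; apply: ler_wpM2r; [exact: normc_ge0|exact: normc_le_vnorm].
  rewrite -mulr_sumr mulrC; apply: ler_wpM2r; first exact: vnorm_ge0.
  rewrite /K ler_wpDr //; apply: ler_sum => i _.
  by rewrite (bigD1 j) //= lerDl sumr_ge0 // => k _; exact: normc_ge0.
by rewrite vnorm_le !le_j.
Qed.

Lemma nbhs_vnormP v (A : set (C2 R)) :
  nbhs v A <-> exists2 e : R, 0 < e & forall w, vnorm (w - v) < e -> A w.
Proof.
split=> [/nbhs_ballP[/= e e0 eA]|[e e0 eA]].
  (* The radius of a ball is an element of [R[i]]; being positive forces its imaginary part to
     vanish. *)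
  case: e e0 eA => a b; rewrite ltcE /= => /andP[/eqP -> a0] eA.
  exists a => // w; rewrite vnorm_distC vnorm_lt => /andP[w0 w1].
  apply: eA; split=> [|i]; first by rewrite ltcR.
  rewrite (ord1 i); apply: ord2P.
    by rewrite /ball /= -[X in X < _]/((normc _)%:C) ltcR; move: w0; rewrite !mxE.
  by rewrite /ball /= -[X in X < _]/((normc _)%:C) ltcR; move: w1; rewrite !mxE.
apply/nbhs_ballP; exists (e%:C) => /=; first by rewrite ltcR.
move=> w /= wb; apply: eA; rewrite vnorm_distC vnorm_lt !mxE.
have wi i : normc (v ord0 i - w ord0 i) < e.
  by have := wb.2 ord0 i; rewrite /ball /= -[X in X < _]/((normc _)%:C) ltcR.
by rewrite !wi.
Qed.

Lemma open_vnormP (A : set (C2 R)) :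
  open A <-> forall v, A v -> exists2 e : R, 0 < e & forall w, vnorm (w - v) < e -> A w.
Proof.
split=> [oA v Av|oA]; first by apply/nbhs_vnormP; exact: open_nbhs_nbhs.
by rewrite openE => v /oA /nbhs_vnormP.
Qed.

End PlaneNorm.

(** * Discrete subgroups of C^2 and their real bases *)

Section DiscreteSubgroups.
Context (R : realType).
Implicit Types (L : set (C2 R)) (v : C2 R).

Definition subgroup L := L 0 /\ forall x y, L x -> L y -> L (x - y).

Definition separated L := exists2 e : R, 0 < e & forall l, L l -> vnorm l < e -> l = 0.

Definition real_comb n (b : 'I_n -> C2 R) (t : 'I_n -> R) : C2 R :=
  \sum_i ((t i)%:C : Cplx R) *: b i.

Lemma subgroupN L x : subgroup L -> L x -> L (- x).
Proof. by move=> [L0 LB] Lx; rewrite -sub0r; exact: LB. Qed.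

Lemma subgroupD L x y : subgroup L -> L x -> L y -> L (x + y).
Proof. by move=> sL Lx Ly; rewrite -[y]opprK; apply: sL.2 => //; exact: subgroupN. Qed.

Lemma subgroupMn L x n : subgroup L -> L x -> L (x *+ n).
Proof.
move=> sL Lx; elim: n => [|n IH]; first by rewrite mulr0n; exact: sL.1.
by rewrite mulrS; exact: subgroupD.
Qed.

Lemma subgroupMz L x (n : int) : subgroup L -> L x -> L (x *~ n).
Proof.
move=> sL Lx; case: n => n; first exact: subgroupMn.
by rewrite NegzE mulrNz; apply: subgroupN => //; exact: subgroupMn.
Qed.

Lemma subgroup_sum L (I : finType) (F : I -> C2 R) : subgroup L ->
  (forall i, L (F i)) -> L (\sum_i F i).
Proof. by move=> sL LF; elim/big_rec : _ => [|i x _]; [exact: sL.1|exact: subgroupD]. Qed.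

Lemma scale_intr (c : int) v : ((c%:~R)%:C : Cplx R) *: v = v *~ c.
Proof. by rewrite -(@scaler_int (Cplx R)); congr (_ *: _); exact: rmorph_int. Qed.

Lemma int_combE n (b : 'I_n -> C2 R) (c : 'I_n -> int) :
  \sum_i b i *~ c i = real_comb b (fun i => (c i)%:~R).
Proof. by apply: eq_bigr => i _; rewrite scale_intr. Qed.

Lemma real_combB n (b : 'I_n -> C2 R) s t :
  real_comb b (fun i => s i - t i) = real_comb b s - real_comb b t.
Proof.
rewrite /real_comb -sumrB; apply: eq_bigr => i _; rewrite -scalerBl; congr (_ *: _).
exact: (rmorphB (real_complex R)).
Qed.

Lemma real_combZ n (b : 'I_n -> C2 R) a t :
  real_comb b (fun i => a * t i) = (a%:C : Cplx R) *: real_comb b t.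
Proof.
rewrite /real_comb scaler_sumr; apply: eq_bigr => i _; rewrite scalerA; congr (_ *: _).
exact: (rmorphM (real_complex R)).
Qed.

Lemma vnorm_real_comb n (b : 'I_n -> C2 R) t (e : R) : 0 <= e ->
  (forall i, `|t i| <= e) -> vnorm (real_comb b t) <= e * \sum_i vnorm (b i).
Proof.
move=> e0 te; apply: le_trans (vnorm_sum _) _; rewrite mulr_sumr; apply: ler_sum => i _.
by rewrite vnormZ; apply: ler_wpM2r; [exact: vnorm_ge0|rewrite normc_real].
Qed.

Lemma vnorm_real_comb_small n (b : 'I_n -> C2 R) (e : R) : 0 < e ->
  exists T : nat, (0 < T)%N /\ forall t, (forall i, `|t i| < T%:R^-1) ->
  vnorm (real_comb b t) < e.
Proof.
move=> e0; set S := \sum_i vnorm (b i).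
have S0 : 0 <= S by apply: sumr_ge0 => i _; exact: vnorm_ge0.
exists (Num.trunc (S / e)).+1; split=> // t tT.
apply: le_lt_trans (vnorm_real_comb b _ (fun i => ltW (tT i))) _.
  by rewrite invr_ge0 ler0n.
by rewrite mulrC ltr_pdivrMr ?ltr0n // mulrC -ltr_pdivrMr // truncnS_gt.
Qed.

(* Simultaneous approximation turns a real dependency into arbitrarily short
   nonzero integer combinations. *)
Lemma Zfree_Rfree L n (b : 'I_n -> C2 R) : subgroup L -> separated L ->
  (forall i, L (b i)) ->
  (forall c : 'I_n -> int, \sum_i b i *~ c i = 0 -> forall i, c i = 0) ->
  forall t, real_comb b t = 0 -> forall i, t i = 0.
Proof.
move=> sL [e e0 eL] Lb bfree t t0 j; apply/eqP; apply: contrapT => /negP tj.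
have [T [T0 TP]] := vnorm_real_comb_small b e0.
have [m [c [/andP[m0 _] mc]]] := simultaneous_approximation (fun i => (t j)^-1 * t i) T0.
have c0 : \sum_i b i *~ c i = 0.
  apply: eL; first by apply: subgroup_sum => // i; exact: subgroupMz.
  rewrite int_combE -vnormN.
  have -> : - real_comb b (fun i => (c i)%:~R) =
      real_comb b (fun i => m%:R * ((t j)^-1 * t i) - (c i)%:~R).
    by rewrite real_combB !real_combZ t0 !scaler0 sub0r.
  exact: TP.
(* The number approximated at index [j] is 1, so [c j = 0] would give [m < 1 / T], although
   [m >= 1]. *)
have := mc j; rewrite (bfree _ c0 j) subr0 mulVf // mulr1 normr_nat.
rewrite ltNge (@le_trans _ _ 1) //; last by rewrite ler1n.
by rewrite invf_le1 ?ltr0n // ler1n.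
Qed.

Definition real_coord v : 'rV[R]_4 :=
  \row_(i < 4) nth 0 [:: complex.Re (v ord0 ord0); complex.Im (v ord0 ord0);
                 complex.Re (v ord0 ord_max); complex.Im (v ord0 ord_max)] i.

Lemma real_coord_inj : injective real_coord.
Proof.
move=> u v /rowP uv; apply/rowP; apply: ord2P.
- have := uv (@Ordinal 4 0 isT); have := uv (@Ordinal 4 1 isT); rewrite !mxE /=.
  by case: (u _ _) (v _ _) => [? ?] [? ?] /= -> ->.
- have := uv (@Ordinal 4 2 isT); have := uv (@Ordinal 4 3 isT); rewrite !mxE /=.
  by case: (u _ _) (v _ _) => [? ?] [? ?] /= -> ->.
Qed.

Lemma real_coordD u v : real_coord (u + v) = real_coord u + real_coord v.
Proof.
apply/rowP => -[[|[|[|[|//]]]] i4]; rewrite !mxE /=;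
  by case: (u _ _) (v _ _) => [? ?] [].
Qed.

Lemma real_coordZ (a : R) v : real_coord ((a%:C : Cplx R) *: v) = a *: real_coord v.
Proof.
by apply/rowP => -[[|[|[|[|//]]]] i4]; rewrite !mxE /=; case: (v _ _) => x y /=; ring.
Qed.

Lemma real_coord_comb n (b : 'I_n -> C2 R) t :
  real_coord (real_comb b t) = (\row_i t i) *m (\matrix_i real_coord (b i)).
Proof.
have rc0 : real_coord 0 = 0 by apply/rowP => -[[|[|[|[|//]]]] i4]; rewrite !mxE.
rewrite mulmx_sum_row /real_comb.
elim/big_rec2 : _ => [//|i x y _ xy].
by rewrite real_coordD xy real_coordZ rowK mxE.
Qed.

Lemma Rfree_span (b : 'I_4 -> C2 R) :
  (forall t, real_comb b t = 0 -> forall i, t i = 0) ->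
  forall v, exists t, v = real_comb b t.
Proof.
move=> bfree v; set M := \matrix_i real_coord (b i).
have Mfree : row_free M.
  apply: inj_row_free => u uM; apply/rowP => i; rewrite mxE.
  apply: (bfree (fun i => u 0 i)); apply: real_coord_inj.
  have -> : 0 = real_comb b (fun=> 0).
    by rewrite /real_comb big1 // => k _; rewrite scale0r.
  rewrite !real_coord_comb -/M.
  have -> : (\row_j u 0 j) = u by apply/rowP => j; rewrite mxE.
  have -> : (\row_(j < 4) (0 : R)) = 0 by apply/rowP => j; rewrite !mxE.
  by rewrite uM mul0mx.
exists (fun i => (real_coord v *m invmx M) 0 i); apply: real_coord_inj.
rewrite real_coord_comb -/M.
have -> : (\row_i (real_coord v *m invmx M) 0 i) = real_coord v *m invmx M.
  by apply/rowP => j; rewrite mxE.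
by rewrite mulmxKV // -row_free_unit.
Qed.

Lemma lattice_subgroup (X : torus2 R) : subgroup (lattice X).
Proof. by have [L0 LB _ _] := latticeP X. Qed.

Lemma lattice_separated (X : torus2 R) : separated (lattice X).
Proof.
have [L0 LB Ld _] := latticeP X; have [_] := Ld _ L0.
move=> [V /nbhs_vnormP[e e0 eV] VL]; exists e => // l Ll le.
by have : (V `&` lattice X) l; [split=> //; apply: eV; rewrite subr0|rewrite VL].
Qed.

Lemma lattice_basis (X : torus2 R) : exists b : 'I_4 -> C2 R,
  [/\ forall l, lattice X l <-> exists c : 'I_4 -> int, l = \sum_i b i *~ c i,
      forall t, real_comb b t = 0 -> forall i, t i = 0 &
      forall v, exists t, v = real_comb b t].
Proof.
have sL := lattice_subgroup X; have dL := lattice_separated X.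
have [_ _ _ [b [bfree bL]]] := latticeP X; exists b.
have Lb i : lattice X (b i).
  rewrite bL; exists (fun j => (j == i)%:R) => //.
  rewrite (bigD1 i) //= eqxx mulr1z big1 ?addr0 // => j /negPf ->.
  by rewrite mulr0z.
have bR := Zfree_Rfree sL dL Lb bfree.
split => //; last exact: Rfree_span.
by move=> l; rewrite bL; split=> [[c _ <-]|[c ->]]; exists c.
Qed.

Lemma lattice_cobounded (X : torus2 R) : exists2 K : R, 0 < K &
  forall v, exists2 l, lattice X l & vnorm (v - l) <= K.
Proof.
have [b [bL _ bspan]] := lattice_basis X.
have S0 : 0 <= \sum_i vnorm (b i) by apply: sumr_ge0 => i _; exact: vnorm_ge0.
exists (\sum_i vnorm (b i) + 1) => [|v]; first by rewrite ltr_wpDl.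
have [t ->] := bspan v; exists (\sum_i b i *~ Num.floor (t i)).
  by apply/bL; exists (fun i => Num.floor (t i)).
rewrite int_combE -real_combB.
apply: le_trans (vnorm_real_comb b ler01 _) _; last by rewrite mul1r lerDl.
move=> i; rewrite ger0_norm ?subr_ge0 ?floor_le_tmp // lerBlDr addrC -intrD1.
exact/ltW/floorD1_gt.
Qed.

End DiscreteSubgroups.

(** * Liouville's theorem *)

Section CurveIntegral.
Context (R : realType).
Implicit Types (u v : R -> R[i]) (a b c : R).
Local Notation mu := (@lebesgue_measure R).

Definition continuous_curve u : Prop :=
  continuous (fun t => complex.Re (u t)) /\ continuous (fun t => complex.Im (u t)).

Definition curve_int u a b : R[i] :=
  (\int[mu]_(t in `[a, b]) complex.Re (u t))%R +i*
  (\int[mu]_(t in `[a, b]) complex.Im (u t))%R.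

Lemma continuous_itv_integrable (f : R -> R) a b :
  continuous f -> mu.-integrable `[a, b] (EFin \o f).
Proof.
move=> cf; apply: continuous_compact_integrable; first exact: segment_compact.
exact: continuous_subspaceT.
Qed.

Lemma Rintegral_itv_cst a b c : a <= b ->
  (\int[mu]_(t in `[a, b]) c)%R = c * (b - a).
Proof.
move=> ab; rewrite Rintegral_cst //= lebesgue_measure_itv /= lte_fin.
by case: ltgtP ab => // -> _; rewrite subrr.
Qed.

Lemma Rintegral_itv_id a b : a <= b ->
  (\int[mu]_(t in `[a, b]) t)%R = (b ^+ 2 - a ^+ 2) / 2.
Proof.
rewrite le_eqVlt => /predU1P[->|ab].
  by rewrite set_itv1 Rintegral_set1 subrr mul0r.
have dF (x : R) : is_derive x 1 (fun t : R => t ^+ 2 * 2^-1) x.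
  have -> : (fun t : R => t ^+ 2 * 2^-1) = 2^-1 \*: (fun t : R => t ^+ 2).
    by apply/funext => t; rewrite /= mulrC.
  apply: is_derive_eq; rewrite /GRing.scale /= ?expr1; lra.
have cF (x : R) : {for x, continuous (fun t : R => t ^+ 2 * 2^-1)}.
  by apply: differentiable_continuous; exact/derivable1_diffP.
rewrite /Rintegral (@continuous_FTC2 _ id (fun t => t ^+ 2 / 2)) //=.
- by rewrite -mulrBl.
- by apply: continuous_subspaceT => x; exact: cvg_id.
- by split=> [x _||]; [|apply: cvg_at_right_filter; exact: cF|apply: cvg_at_left_filter; exact: cF].
- by move=> x _; rewrite derive1E derive_val.
Qed.

Lemma normr_Rintegral_itv_le (f : R -> R) a b c : a <= b -> continuous f ->
  (forall t, a <= t <= b -> `|f t| <= c) ->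
  `|(\int[mu]_(t in `[a, b]) f t)%R| <= c * (b - a).
Proof.
move=> ab cf fc; rewrite -Rintegral_itv_cst //.
have intf := continuous_itv_integrable a b cf.
apply: le_trans (le_normr_Rintegral _ intf) _ => //.
apply: le_Rintegral => //.
- apply: continuous_itv_integrable => x.
  by apply: (@continuous_comp _ _ _ f Num.norm); [exact: cf|exact: norm_continuous].
- by apply: continuous_itv_integrable => x; exact: cvg_cst.
Qed.

Lemma Rintegral_itv_split (f : R -> R) a b c : a <= b -> b <= c -> continuous f ->
  (\int[mu]_(t in `[a, c]) f t)%R =
  (\int[mu]_(t in `[a, b]) f t)%R + (\int[mu]_(t in `[b, c]) f t)%R.
Proof.
move=> ab bc cf.
have := @Rintegral_itvB _ f (BLeft a) (BRight c) b.
rewrite Rintegral_itv_obnd_cbnd; last first.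
  apply: integrableS (continuous_itv_integrable b c cf) => // x /=.
  by rewrite !in_itv /= => /andP[/ltW -> ->].
move=> <-; rewrite ?bnd_simp //; last exact: continuous_itv_integrable.
by rewrite addrC subrK.
Qed.

Lemma eq_curve_int u v a b : (forall t, a <= t <= b -> u t = v t) ->
  curve_int u a b = curve_int v a b.
Proof.
move=> uv; rewrite /curve_int; congr (_ +i* _); apply: eq_Rintegral => t;
by rewrite inE /= in_itv /= => /uv ->.
Qed.

Lemma curve_intD u v a b : continuous_curve u -> continuous_curve v ->
  curve_int (fun t => u t + v t) a b = curve_int u a b + curve_int v a b.
Proof.
move=> [u1 u2] [v1 v2]; rewrite /curve_int; simpc.
have Re_D t : complex.Re (u t + v t) = complex.Re (u t) + complex.Re (v t).
  by case: (u t) (v t) => [? ?] [].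
have Im_D t : complex.Im (u t + v t) = complex.Im (u t) + complex.Im (v t).
  by case: (u t) (v t) => [? ?] [].
congr (_ +i* _).
- by under eq_Rintegral do rewrite Re_D; rewrite RintegralD //; exact: continuous_itv_integrable.
- by under eq_Rintegral do rewrite Im_D; rewrite RintegralD //; exact: continuous_itv_integrable.
Qed.

Lemma continuous_curveZ k u : continuous_curve u -> continuous_curve (fun t => k * u t).
Proof.
case: k => k1 k2 [u1 u2]; split.
- have -> : (fun t => complex.Re ((k1 +i* k2) * u t)) =
      (fun t => k1 * complex.Re (u t)) \- (fun t => k2 * complex.Im (u t)).
    by apply/funext => t /=; case: (u t).
  by move=> x; apply: cvgB; apply: cvgM; (try exact: cvg_cst); [exact: u1|exact: u2].
- have -> : (fun t => complex.Im ((k1 +i* k2) * u t)) =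
      (fun t => k1 * complex.Im (u t)) \+ (fun t => k2 * complex.Re (u t)).
    by apply/funext => t /=; case: (u t).
  by move=> x; apply: cvgD; apply: cvgM; (try exact: cvg_cst); [exact: u2|exact: u1].
Qed.

Lemma curve_intZ k u a b : continuous_curve u ->
  curve_int (fun t => k * u t) a b = k * curve_int u a b.
Proof.
case: k => k1 k2 [u1 u2]; rewrite /curve_int; simpc.
have cM (f : R -> R) (k : R) : continuous f -> continuous (fun t => k * f t).
  by move=> cf x; apply: cvgM; [exact: cvg_cst|exact: cf].
have Re_Z t : complex.Re ((k1 +i* k2) * u t) = k1 * complex.Re (u t) - k2 * complex.Im (u t).
  by case: (u t).
have Im_Z t : complex.Im ((k1 +i* k2) * u t) = k1 * complex.Im (u t) + k2 * complex.Re (u t).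
  by case: (u t).
have Zl (f : R -> R) (k : R) : continuous f ->
    (\int[mu]_(t in `[a, b]) (k * f t))%R = k * (\int[mu]_(t in `[a, b]) f t)%R.
  by move=> cf; rewrite RintegralZl //; exact: continuous_itv_integrable.
congr (_ +i* _).
- under eq_Rintegral do rewrite Re_Z.
  rewrite RintegralB ?Zl //; apply: continuous_itv_integrable; exact: cM.
- under eq_Rintegral do rewrite Im_Z.
  rewrite RintegralD ?Zl //; apply: continuous_itv_integrable; exact: cM.
Qed.

Lemma curve_int_split u a b c : a <= b -> b <= c -> continuous_curve u ->
  curve_int u a c = curve_int u a b + curve_int u b c.
Proof.
move=> ab bc [u1 u2]; rewrite /curve_int; simpc.
by rewrite !(Rintegral_itv_split ab bc).
Qed.

(** The factor 2 is the price of bounding real and imaginary parts separately; Liouville's theorem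
    tolerates any constant. *)
Lemma normc_curve_int_le u a b c : a <= b -> continuous_curve u ->
  (forall t, a <= t <= b -> normc (u t) <= c) ->
  normc (curve_int u a b) <= 2 * c * (b - a).
Proof.
move=> ab [u1 u2] uc; apply: le_trans (normc_le_ReIm _) _ => /=.
rewrite -mulrA mulrDl mul1r; apply: lerD; apply: normr_Rintegral_itv_le => // t /uc;
  apply: le_trans; [exact: ler_normcRe|exact: ler_normcIm].
Qed.

Lemma curve_int_cst k a b : a <= b -> curve_int (fun=> k) a b = k * (b - a)%:C.
Proof.
by move=> ab; case: k => k1 k2; rewrite /curve_int /= !Rintegral_itv_cst //; simpc.
Qed.

Lemma curve_int_id a b : a <= b ->
  curve_int (fun t => t%:C) a b = ((b ^+ 2 - a ^+ 2) / 2)%:C.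
Proof.
by move=> ab; rewrite /curve_int /= Rintegral_itv_id // Rintegral_itv_cst // mul0r.
Qed.

Lemma continuous_curve_cst k : continuous_curve (fun=> k).
Proof. by split=> x; exact: cvg_cst. Qed.

Lemma continuous_curve_id : continuous_curve (fun t => t%:C).
Proof. by split=> x /=; [exact: cvg_id|exact: cvg_cst]. Qed.

End CurveIntegral.

(** * Contour integrals over squares *)

Section SquareIntegral.
Context (R : realType).
Implicit Types (g h : R[i] -> R[i]) (z w : R[i]) (x y s : R).

Definition ccontinuous_at g z := forall e : R, 0 < e -> exists2 d : R, 0 < d &
  forall w, normc (w - z) < d -> normc (g w - g z) <= e.

Definition cdifferentiable_at g z := exists a : R[i], forall e : R, 0 < e ->
  exists2 d : R, 0 < d & forall w, normc (w - z) < d ->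
  normc (g w - g z - a * (w - z)) <= e * normc (w - z).

Lemma cdifferentiable_continuous g z : cdifferentiable_at g z -> ccontinuous_at g z.
Proof.
move=> [a ga] e e0; have [d d0 gd] := ga 1 ltr01.
have k0 : 0 < 1 + normc a by rewrite ltr_pwDl ?normc_ge0.
exists (Num.min d (e / (1 + normc a))); first by rewrite lt_min d0 divr_gt0.
move=> w; rewrite lt_min => /andP[/gd gw]; rewrite ltr_pdivlMr // => we.
have -> : g w - g z = (g w - g z - a * (w - z)) + a * (w - z) by rewrite subrK.
apply: le_trans (ler_normcD _ _) _; rewrite normcM; apply: le_trans (ltW we).
by move: gw; lra.
Qed.

Lemma ccontinuousD g h z : ccontinuous_at g z -> ccontinuous_at h z ->
  ccontinuous_at (fun w => g w + h w) z.
Proof.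
move=> cg ch e e0.
have e2 : 0 < e / 2 by rewrite divr_gt0.
have [d d0 gd] := cg _ e2; have [d' d'0 hd] := ch _ e2.
exists (Num.min d d'); first by rewrite lt_min d0.
move=> w; rewrite lt_min => /andP[/gd gw /hd hw].
rewrite opprD addrACA; apply: le_trans (ler_normcD _ _) _; move: gw hw; lra.
Qed.

Lemma ccontinuousM g h z : ccontinuous_at g z -> ccontinuous_at h z ->
  ccontinuous_at (fun w => g w * h w) z.
Proof.
move=> cg ch e e0.
set M := normc (g z) + normc (h z) + 1.
have Mg := normc_ge0 (g z); have Mh := normc_ge0 (h z).
have M1 : 1 <= M by rewrite /M; lra.
have M0 : 0 < M by lra.
have e2 : 0 < Num.min 1 (e / (3 * M)) by rewrite lt_min ltr01 divr_gt0 // mulr_gt0.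
have [d d0 gd] := cg _ e2; have [d' d'0 hd] := ch _ e2.
exists (Num.min d d'); first by rewrite lt_min d0.
move=> w; rewrite lt_min => /andP[/gd + /hd]; rewrite !le_min => /andP[g1 ge] /andP[h1 he].
have -> : g w * h w - g z * h z =
  (g w - g z) * (h w - h z) + ((g w - g z) * h z + g z * (h w - h z)) by ring.
apply: le_trans (ler_normcD _ _) _; apply: le_trans (lerD (lexx _) (ler_normcD _ _)) _.
rewrite !normcM.
set A := normc (g w - g z) in g1 ge *; set B := normc (h w - h z) in h1 he *.
have A0 : 0 <= A := normc_ge0 _; have B0 : 0 <= B := normc_ge0 _.
move: ge he; rewrite !ler_pdivlMr ?mulr_gt0 // => ge he.
have : A * B <= A * 1 by apply: ler_wpM2l.
have : A * 1 <= A * M by apply: ler_wpM2l.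
have : A * normc (h z) <= A * M by apply: ler_wpM2l => //; rewrite /M; lra.
have : normc (g z) * B <= M * B by apply: ler_wpM2r => //; rewrite /M; lra.
by move: ge he; lra.
Qed.

Lemma ccontinuous_cst a z : ccontinuous_at (fun=> a) z.
Proof.
by move=> e e0; exists 1 => // w _; rewrite subrr normc0 ltW.
Qed.

Lemma ccontinuous_id z : ccontinuous_at id z.
Proof. by move=> e e0; exists e => // w /ltW. Qed.

Lemma ccontinuousV z : z != 0 -> ccontinuous_at (fun w => w^-1) z.
Proof.
move=> z0 e e0; have nz : 0 < normc z by rewrite normc_gt0.
have k0 : 0 < e * (normc z ^+ 2) / 2 by rewrite divr_gt0 // mulr_gt0 // exprn_gt0.
exists (Num.min (normc z / 2) (e * (normc z ^+ 2) / 2)).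
  by rewrite lt_min k0 divr_gt0.
move=> w; rewrite lt_min => /andP[w1 w2].
have nw : normc z / 2 < normc w.
  have := ler_normcB w (w - z); rewrite opprB addrCA subrr addr0; move: w1; lra.
have w0 : w != 0 by rewrite -normc_gt0; move: nw nz; lra.
have -> : w^-1 - z^-1 = - (w - z) * w^-1 * z^-1 by field; rewrite ?w0 ?z0.
have nw0 : 0 < normc w by rewrite normc_gt0.
rewrite !normcM normc_opp !normcV -mulrA -invfM ler_pdivrMr ?mulr_gt0 //.
apply: le_trans (ltW w2) _; rewrite -mulrA; apply: ler_wpM2l; first exact: ltW.
rewrite expr2 mulrAC; apply: ler_wpM2r; exact: ltW.
Qed.

Lemma continuous_realP (f : R -> R) : (forall t e, 0 < e -> exists2 d : R, 0 < d &
  forall r, `|r - t| < d -> `|f r - f t| <= e) -> continuous f.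
Proof.
move=> fc t; apply/cvgrPdist_le => e e0; have [d d0 fd] := fc t e e0.
near=> r; rewrite distrC; apply: fd.
by near: r; apply: cvgr_distC_lt => //; exact: cvg_id.
Unshelve. all: by end_near. Qed.

Lemma continuous_curve_comp g (p : R -> R[i]) :
  (forall r t, normc (p r - p t) <= `|r - t|) ->
  (forall t, ccontinuous_at g (p t)) -> continuous_curve (fun t => g (p t)).
Proof.
move=> plip gc; split; apply: continuous_realP => t e e0;
  have [d d0 gd] := gc t e e0; exists d => // r rt;
  (have gr := gd _ (le_lt_trans (plip _ _) rt); apply: le_trans gr).
- have -> : complex.Re (g (p r)) - complex.Re (g (p t)) = complex.Re (g (p r) - g (p t)).
    by case: (g _) (g _) => [? ?] [].
  exact: ler_normcRe.
- have -> : complex.Im (g (p r)) - complex.Im (g (p t)) = complex.Im (g (p r) - g (p t)).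
    by case: (g _) (g _) => [? ?] [].
  exact: ler_normcIm.
Qed.

Lemma continuous_hline g y : (forall t, ccontinuous_at g (t +i* y)) ->
  continuous_curve (fun t => g (t +i* y)).
Proof.
apply: (continuous_curve_comp (p := fun t => t +i* y)) => r t; simpc.
by rewrite normc_real.
Qed.

Lemma continuous_vline g x : (forall t, ccontinuous_at g (x +i* t)) ->
  continuous_curve (fun t => g (x +i* t)).
Proof.
apply: (continuous_curve_comp (p := fun t => x +i* t)) => r t; simpc.
by rewrite /= expr0n add0r sqrtr_sqr.
Qed.

(** The integral of [g] dz counterclockwise along the boundary of the square with lower left corner
    [x +i* y] and side [s]. *)
Definition square_int g x y s : R[i] :=
  curve_int (fun t => g (t +i* y)) x (x + s) -
  curve_int (fun t => g (t +i* (y + s))) x (x + s) +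
  'i%C * (curve_int (fun t => g ((x + s) +i* t)) y (y + s) -
        curve_int (fun t => g (x +i* t)) y (y + s)).

(** The condition covers the whole lines that carry the sides, since [continuous_curve] speaks of
    curves parametrised by the entire real line. *)
Definition continuous_sides g x y s := forall z,
  (complex.Re z == x) || (complex.Re z == x + s) ||
  (complex.Im z == y) || (complex.Im z == y + s) -> ccontinuous_at g z.

Definition on_sides x y s z :=
  [/\ x <= complex.Re z <= x + s, y <= complex.Im z <= y + s &
  (complex.Re z == x) || (complex.Re z == x + s) ||
  (complex.Im z == y) || (complex.Im z == y + s)].

Lemma continuous_sidesE g x y s : continuous_sides g x y s ->
  [/\ continuous_curve (fun t => g (t +i* y)),
      continuous_curve (fun t => g (t +i* (y + s))),
      continuous_curve (fun t => g ((x + s) +i* t)) &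
      continuous_curve (fun t => g (x +i* t))].
Proof.
by move=> cg; split; [apply: continuous_hline|apply: continuous_hline|
  apply: continuous_vline|apply: continuous_vline] => t; apply: cg; rewrite /= eqxx ?orbT.
Qed.

Lemma square_intD g h x y s : continuous_sides g x y s -> continuous_sides h x y s ->
  square_int (fun z => g z + h z) x y s = square_int g x y s + square_int h x y s.
Proof.
move=> /continuous_sidesE[g1 g2 g3 g4] /continuous_sidesE[h1 h2 h3 h4].
by rewrite /square_int !curve_intD //; ring.
Qed.

Lemma square_intZ a g x y s : continuous_sides g x y s ->
  square_int (fun z => a * g z) x y s = a * square_int g x y s.
Proof.
move=> /continuous_sidesE[g1 g2 g3 g4].
by rewrite /square_int !curve_intZ //; ring.
Qed.

Lemma eq_square_int g h x y s : 0 < s -> (forall z, on_sides x y s z -> g z = h z) ->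
  square_int g x y s = square_int h x y s.
Proof.
move=> s0 gh; have s1 : forall u : R, u <= u <= u + s by move=> u; rewrite lexx lerDl ltW.
have s2 : forall u : R, u <= u + s <= u + s by move=> u; rewrite lexx lerDl ltW.
by rewrite /square_int; congr (_ - _ + _ * (_ - _)); apply: eq_curve_int => t tx;
  apply: gh; split; rewrite /= ?eqxx ?orbT.
Qed.

Lemma normc_square_int_le g x y s c : 0 < s -> continuous_sides g x y s ->
  (forall z, on_sides x y s z -> normc (g z) <= c) ->
  normc (square_int g x y s) <= 8 * c * s.
Proof.
move=> s0 /continuous_sidesE[g1 g2 g3 g4] gc.
have s1 : forall u : R, u <= u <= u + s by move=> u; rewrite lexx lerDl ltW.
have s2 : forall u : R, u <= u + s <= u + s by move=> u; rewrite lexx lerDl ltW.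
have le_s : forall u : R, u <= u + s by move=> u; rewrite lerDl ltW.
have B u v : continuous_curve u -> (forall t, v <= t <= v + s -> normc (u t) <= c) ->
    normc (curve_int u v (v + s)) <= 2 * c * s.
  by move=> cu uc; have := normc_curve_int_le (le_s v) cu uc; rewrite addrAC subrr add0r.
rewrite /square_int; apply: le_trans (ler_normcD _ _) _; rewrite normcM normc_i mul1r.
have -> : 8 * c * s = (2 * c * s + 2 * c * s) + (2 * c * s + 2 * c * s) by ring.
by apply: lerD; apply: le_trans (ler_normcB _ _) _; apply: lerD; apply: B => // t tx;
  apply: gc; split; rewrite /= ?eqxx ?orbT.
Qed.

Lemma square_int_affine a b x y s : 0 < s ->
  square_int (fun z => a + b * z) x y s = 0.
Proof.
move=> s0.
have le_s : forall u : R, u <= u + s by move=> u; rewrite lerDl ltW.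
have hline q u : curve_int (fun t => a + b * (t +i* q)) u (u + s) =
    (a + b * ('i%C * q%:C)) * s%:C + b * (((u + s) ^+ 2 - u ^+ 2) / 2)%:C.
  have -> : (fun t => a + b * (t +i* q)) = (fun t => (a + b * ('i%C * q%:C)) + b * t%:C).
    by apply/funext => t; rewrite (complexE (t +i* q)) [complex.Re _]/= [complex.Im _]/=; ring.
  rewrite curve_intD; [|exact: continuous_curve_cst|
    exact/continuous_curveZ/continuous_curve_id].
  rewrite curve_int_cst // curve_intZ; last exact: continuous_curve_id.
  by rewrite curve_int_id // addrAC subrr add0r.
have vline q u : curve_int (fun t => a + b * (q +i* t)) u (u + s) =
    (a + b * q%:C) * s%:C + b * 'i%C * (((u + s) ^+ 2 - u ^+ 2) / 2)%:C.
  have -> : (fun t => a + b * (q +i* t)) = (fun t => (a + b * q%:C) + b * 'i%C * t%:C).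
    by apply/funext => t; rewrite (complexE (q +i* t)) [complex.Re _]/= [complex.Im _]/=; ring.
  rewrite curve_intD; [|exact: continuous_curve_cst|
    exact/continuous_curveZ/continuous_curve_id].
  rewrite curve_int_cst // curve_intZ; last exact: continuous_curve_id.
  by rewrite curve_int_id // addrAC subrr add0r.
rewrite /square_int !hline !vline.
have -> : (x + s)%:C = x%:C + s%:C :> R[i] by exact: rmorphD.
have -> : (y + s)%:C = y%:C + s%:C :> R[i] by exact: rmorphD.
ring.
Qed.

(** The inner sides are traversed twice, in opposite directions, and cancel. *)
Lemma square_int_quarter g x y s : 0 < s -> (forall z, ccontinuous_at g z) ->
  square_int g x y (s + s) =
  square_int g x y s + square_int g (x + s) y s +
  (square_int g x (y + s) s + square_int g (x + s) (y + s) s).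
Proof.
move=> s0 cg.
have ch q : continuous_curve (fun t => g (t +i* q)) by apply: continuous_hline.
have cv q : continuous_curve (fun t => g (q +i* t)) by apply: continuous_vline.
have le1 (u : R) : u <= u + s by rewrite lerDl ltW.
have le2 (u : R) : u + s <= u + (s + s) by rewrite addrA.
rewrite /square_int.
rewrite (curve_int_split (le1 _) (le2 _) (ch y)).
rewrite (curve_int_split (le1 _) (le2 _) (ch (y + (s + s)))).
rewrite (curve_int_split (le1 _) (le2 _) (cv x)).
rewrite (curve_int_split (le1 _) (le2 _) (cv (x + (s + s)))).
by rewrite !addrA; ring.
Qed.

(** Goursat's bisection as an induction principle: a bad square has a bad quarter, and a nested
    sequence of bad squares shrinks to a point that contradicts the local hypothesis. *)
Lemma square_induction (P : R -> R -> R -> Prop) :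
  (forall x y s, 0 < s -> P x y s -> P (x + s) y s -> P x (y + s) s ->
     P (x + s) (y + s) s -> P x y (s + s)) ->
  (forall p q, exists2 d : R, 0 < d & forall x y s, 0 < s < d ->
     x <= p <= x + s -> y <= q <= y + s -> P x y s) ->
  forall x y s, 0 < s -> P x y s.
Proof.
move=> Pquarter Plocal x y s s0; apply: contrapT => nP.
pose Q (c : R * R * R) := 0 < c.2 /\ ~ P c.1.1 c.1.2 c.2.
pose sub (c c' : R * R * R) := [/\ c'.2 = c.2 / 2, c.1.1 <= c'.1.1,
  c'.1.1 + c'.2 <= c.1.1 + c.2, c.1.2 <= c'.1.2 & c'.1.2 + c'.2 <= c.1.2 + c.2].
have step (c : {c | Q c}) : exists c' : {c | Q c}, sub (sval c) (sval c').
  case: c => [[[a b] r] [/= r0 nPr]].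
  have r2 : 0 < r / 2 by rewrite divr_gt0.
  have rr : r = r / 2 + r / 2 by lra.
  apply/not_existsP => nsub; apply: nPr; rewrite rr; apply: Pquarter => //;
    apply: contrapT => nP'.
  - by apply: (nsub (exist Q (a, b, r / 2) (conj r2 nP'))); split => //=; lra.
  - by apply: (nsub (exist Q (a + r / 2, b, r / 2) (conj r2 nP'))); split => //=; lra.
  - by apply: (nsub (exist Q (a, b + r / 2, r / 2) (conj r2 nP'))); split => //=; lra.
  - by apply: (nsub (exist Q (a + r / 2, b + r / 2, r / 2) (conj r2 nP'))); split => //=; lra.
have [f fP] := choice step.
pose c n := sval (iter n f (exist Q (x, y, s) (conj s0 nP))).
have cS n : sub (c n) (c n.+1) by exact: fP.
have cQ n : Q (c n) by rewrite /c; case: (iter n f _).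
have cs n : (c n).2 = s / 2 ^+ n.
  elim: n => [|n IH]; first by rewrite expr0 divr1.
  by have [-> _ _ _ _] := cS n; rewrite IH exprSr invfM mulrA.
have mono m n : [/\ (c m).1.1 <= (c (m + n)%N).1.1,
    (c (m + n)%N).1.1 + (c (m + n)%N).2 <= (c m).1.1 + (c m).2,
    (c m).1.2 <= (c (m + n)%N).1.2 &
    (c (m + n)%N).1.2 + (c (m + n)%N).2 <= (c m).1.2 + (c m).2].
  elim: n => [|n [IH1 IH2 IH3 IH4]]; first by rewrite addn0.
  by rewrite addnS; have [_ *] := cS (m + n)%N; split; lra.
have c0 n : 0 < (c n).2 by case: (cQ n).
have nest m n : (c m).1.1 <= (c n).1.1 + (c n).2 /\ (c m).1.2 <= (c n).1.2 + (c n).2.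
  have [mn|/ltnW nm] := leqP m n.
    have [h1 h2 h3 h4] := mono m (n - m)%N; rewrite subnKC // in h1 h2 h3 h4.
    by have := c0 n; split; lra.
  have [h1 h2 h3 h4] := mono n (m - n)%N; rewrite subnKC // in h1 h2 h3 h4.
  by have := c0 m; split; lra.
(* Every left end stays below every right end, so the supremum of the left ends lies in all the
   intervals. *)
have lim (u : nat -> R) : (forall m n, u m <= u n + (c n).2) ->
    exists p, forall n, u n <= p <= u n + (c n).2.
  move=> un; exists (sup (range u)) => n; apply/andP; split.
    apply: ub_le_sup; last by exists n.
    by exists (u 0%N + (c 0%N).2) => _ [m _ <-].
  by apply: ge_sup; [exists (u 0%N); exists 0%N|move=> _ [m _ <-]].
have [p pP] := lim (fun n => (c n).1.1) (fun m n => proj1 (nest m n)).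
have [q qP] := lim (fun n => (c n).1.2) (fun m n => proj2 (nest m n)).
have [d d0 dP] := Plocal p q.
have [n nd] : exists n, (c n).2 < d.
  exists (Num.trunc (s / d)).+1; rewrite cs ltr_pdivrMr ?exprn_gt0 // mulrC -ltr_pdivrMr //.
  apply: lt_trans (truncnS_gt _) _.
  by rewrite -natrX ltr_nat; exact: ltn_expl.
by have [_] := cQ n; apply; apply: dP; rewrite ?c0.
Qed.

End SquareIntegral.

(** * Goursat's lemma, a crude Cauchy estimate and Liouville's theorem *)

Section Liouville.
Context (R : realType).
Implicit Types (g h : R[i] -> R[i]) (z w : R[i]) (x y s : R).

Let sg_le (a b : R) : a <= b -> Num.sg a <= Num.sg b.
Proof. by move=> ab; case: (sgrP a) (sgrP b) => ? [] ?; lra. Qed.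

(* The mass given to the square by the Dirac measure [4 delta_z], split evenly
   between the squares sharing [z]: unlike the indicator function of the closed
   square, it is additive under subdivision. *)
Definition point_weight z x y s : R :=
  (Num.sg (x + s - complex.Re z) - Num.sg (x - complex.Re z)) *
  (Num.sg (y + s - complex.Im z) - Num.sg (y - complex.Im z)).

Lemma point_weight_ge0 z x y s : 0 < s -> 0 <= point_weight z x y s.
Proof. by move=> s0; apply: mulr_ge0; rewrite subr_ge0; apply: sg_le; lra. Qed.

Lemma point_weight_ge1 z x y s : 0 < s -> x <= complex.Re z <= x + s ->
  y <= complex.Im z <= y + s -> 1 <= point_weight z x y s.
Proof.
have sg1 (a p : R) : 0 < s -> a <= p <= a + s -> 1 <= Num.sg (a + s - p) - Num.sg (a - p).
  by move=> s0 ap; case: (sgrP (a + s - p)) (sgrP (a - p)) => ? [] ?; lra.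
by move=> s0 xz yz; rewrite -[1]mulr1; apply: ler_pM => //; exact: sg1.
Qed.

Lemma point_weight_quarter z x y s : point_weight z x y (s + s) =
  point_weight z x y s + point_weight z (x + s) y s +
  (point_weight z x (y + s) s + point_weight z (x + s) (y + s) s).
Proof. by rewrite /point_weight !addrA; ring. Qed.

Let normc_sub_le z w x y s : x <= complex.Re z <= x + s -> y <= complex.Im z <= y + s ->
  x <= complex.Re w <= x + s -> y <= complex.Im w <= y + s -> normc (z - w) <= s + s.
Proof.
move=> *; apply: le_trans (normc_le_ReIm _) _.
have -> : complex.Re (z - w) = complex.Re z - complex.Re w by case: (z) (w) => [? ?] [].
have -> : complex.Im (z - w) = complex.Im z - complex.Im w by case: (z) (w) => [? ?] [].
by apply: lerD; rewrite ler_norml; lra.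
Qed.

(* Goursat's argument by bisection; [point_weight] absorbs the points of mere
   continuity. *)
Lemma square_int_eq0 (ps : seq R[i]) g x y s : 0 < s ->
  (forall z, ccontinuous_at g z) -> (forall z, z \notin ps -> cdifferentiable_at g z) ->
  square_int g x y s = 0.
Proof.
move=> s0 cg dg.
(* The integral of an affine function vanishes, so the first-order part of [g] at a point can be
   subtracted at will. *)
have sub_affine a b p q r : 0 < r -> square_int g p q r =
    square_int (fun z => g z - (a + b * z)) p q r.
  move=> r0; have caff z : ccontinuous_at (fun z => - a + - b * z) z.
    apply: ccontinuousD; first exact: ccontinuous_cst.
    by apply: ccontinuousM; [exact: ccontinuous_cst|exact: ccontinuous_id].
  have -> : (fun z => g z - (a + b * z)) = (fun z => g z + (- a + - b * z)).
    by apply/funext => z; ring.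
  by rewrite square_intD ?square_int_affine ?addr0 // => z _.
(* Area plus point weights is additive under quartering, so this bound passes from the quarters to
   the square. *)
have bound e : 0 < e -> forall x y s, 0 < s ->
    normc (square_int g x y s) <= e * (s ^+ 2 + \sum_(p <- ps) point_weight p x y s).
  move=> e0; apply: square_induction => [p q r r0 b1 b2 b3 b4|p q].
    have -> : (r + r) ^+ 2 + \sum_(u <- ps) point_weight u p q (r + r) =
      (r ^+ 2 + \sum_(u <- ps) point_weight u p q r) +
      (r ^+ 2 + \sum_(u <- ps) point_weight u (p + r) q r) +
      ((r ^+ 2 + \sum_(u <- ps) point_weight u p (q + r) r) +
       (r ^+ 2 + \sum_(u <- ps) point_weight u (p + r) (q + r) r)).
      have -> : \sum_(u <- ps) point_weight u p q (r + r) =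
        \sum_(u <- ps) point_weight u p q r + \sum_(u <- ps) point_weight u (p + r) q r +
        (\sum_(u <- ps) point_weight u p (q + r) r +
         \sum_(u <- ps) point_weight u (p + r) (q + r) r).
        by rewrite -!big_split; apply: eq_bigr => u _; exact: point_weight_quarter.
      by ring.
    rewrite square_int_quarter //.
    apply: le_trans (ler_normcD _ _) _; rewrite mulrDr; apply: lerD;
      by apply: le_trans (ler_normcD _ _) _; rewrite mulrDr; apply: lerD.
  have sum_ge0 a b r : 0 < r -> 0 <= \sum_(u <- ps) point_weight u a b r.
    by move=> r0; apply: sumr_ge0 => u _; exact: point_weight_ge0.
  have [zps|zps] := boolP (p +i* q \in ps).
    have [d d0 gd] := cg (p +i* q) 1 ltr01.
    (* At an exceptional point continuity alone bounds the integral by [8 * r <= e], and the weight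
       of that point is at least 1. All points of the square are within [2 * r < d] of it. *)
    exists (Num.min (d / 2) (e / 8)); first by rewrite lt_min !divr_gt0.
    move=> a b r /andP[r0]; rewrite lt_min => /andP[rd re] pa qb.
    rewrite (sub_affine (g (p +i* q)) 0) //.
    have g1 : normc (square_int (fun z => g z - (g (p +i* q) + 0 * z)) a b r) <= 8 * 1 * r.
      apply: normc_square_int_le => // [z _|z [az bz _]].
        apply: ccontinuousD; first exact: cg.
        have -> : (fun z => - (g (p +i* q) + 0 * z)) = (fun=> - g (p +i* q)).
          by apply/funext => u; rewrite mul0r addr0.
        exact: ccontinuous_cst.
      rewrite mul0r addr0; apply: gd.
      by apply: le_lt_trans (normc_sub_le (w := p +i* q) az bz pa qb) _; lra.
    apply: le_trans g1 _.
    apply: (@le_trans _ _ (e * point_weight (p +i* q) a b r)); last first.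
      apply: ler_wpM2l; first exact: ltW.
      rewrite (big_rem _ zps) /= addrCA lerDl addr_ge0 ?sqr_ge0 //.
      by apply: sumr_ge0 => u _; exact: point_weight_ge0.
    have : 1 <= point_weight (p +i* q) a b r by apply: point_weight_ge1.
    by rewrite -(ler_pM2l e0) mulr1; apply: le_trans; lra.
  have [k gk] := dg _ zps.
  (* On the square the deviation from the affine part is at most [e / 16 * (2 * r)], so the integral
     is at most [8 * (e * r / 8) * r = e * r ^+ 2]. *)
  have e16 : 0 < e / 16 by rewrite divr_gt0.
  have [d d0 gd] := gk _ e16.
  exists (d / 2); first by rewrite divr_gt0.
  move=> a b r /andP[r0 rd] pa qb.
  rewrite (sub_affine (g (p +i* q) - k * (p +i* q)) k) //.
  apply: (@le_trans _ _ (8 * (e * r / 8) * r)); last first.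
    by rewrite mulrDr ler_wpDr ?mulr_ge0 ?sum_ge0 ?(ltW e0) //; lra.
  apply: normc_square_int_le => // [z _|z [az bz _]].
    apply: ccontinuousD; first exact: cg.
    have -> : (fun w => - (g (p +i* q) - k * (p +i* q) + k * w)) =
        (fun w => - (g (p +i* q) - k * (p +i* q)) + - k * w).
      by apply/funext => u; ring.
    apply: ccontinuousD; first exact: ccontinuous_cst.
    by apply: ccontinuousM; [exact: ccontinuous_cst|exact: ccontinuous_id].
  have zr : normc (z - (p +i* q)) <= r + r := normc_sub_le (w := p +i* q) az bz pa qb.
  have -> : g z - (g (p +i* q) - k * (p +i* q) + k * z) =
    g z - g (p +i* q) - k * (z - (p +i* q)) by ring.
  apply: le_trans (gd _ _) _; first by apply: le_lt_trans zr _; lra.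
  by apply: le_trans (ler_wpM2l (ltW e16) zr) _; lra.
apply/eqP; rewrite -normc_eq0; apply: contrapT => /negP nz.
set W := s ^+ 2 + \sum_(p <- ps) point_weight p x y s.
have W0 : 0 < W.
  by rewrite ltr_pwDl ?exprn_gt0 // sumr_ge0 // => u _; exact: point_weight_ge0.
have n0 : 0 < normc (square_int g x y s) by rewrite lt_def nz normc_ge0.
(* For this choice of [e] the bound says that the modulus of the integral is at most half of
   itself. *)
have := bound (normc (square_int g x y s) / (2 * W)) _ x y s s0.
rewrite -/W divr_gt0 ?mulr_gt0 // => /(_ isT).
have -> : normc (square_int g x y s) / (2 * W) * W = normc (square_int g x y s) / 2.
  by field; rewrite gt_eqF.
lra.
Qed.

(** Caratheodory's criterion: an increment that factors through a function continuous at [z] gives a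
    derivative, so product and sum rules reduce to continuity. *)
Lemma cdifferentiable_factor g h z (d : R) : 0 < d -> ccontinuous_at h z ->
  (forall w, normc (w - z) < d -> g w - g z = h w * (w - z)) -> cdifferentiable_at g z.
Proof.
move=> d0 ch gh; exists (h z) => e e0; have [d' d'0 hd] := ch e e0.
exists (Num.min d d'); first by rewrite lt_min d0.
move=> w; rewrite lt_min => /andP[/gh -> /hd hw].
by rewrite -mulrBl normcM; apply: ler_wpM2r => //; exact: normc_ge0.
Qed.

(** With [a] the derivative of [g] at [z], this is continuous at [z]. Differentiability at [z] is
    not claimed; this is why [square_int_eq0] admits exceptional points. *)
Definition cslope g a z w := if w == z then a else (g w - g z) / (w - z).

Lemma ccontinuous_near g h z (d : R) : 0 < d ->
  (forall w, normc (w - z) < d -> g w = h w) -> ccontinuous_at g z -> ccontinuous_at h z.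
Proof.
move=> d0 gh cg e e0; have [d' d'0 gd] := cg e e0.
exists (Num.min d d'); first by rewrite lt_min d0.
by move=> w; rewrite lt_min => /andP[/gh <- /gd]; rewrite (gh z) // subrr normc0.
Qed.

Lemma cdifferentiable_near g h z (d : R) : 0 < d ->
  (forall w, normc (w - z) < d -> g w = h w) -> cdifferentiable_at g z -> cdifferentiable_at h z.
Proof.
move=> d0 gh [a ag]; exists a => e e0; have [d' d'0 gd] := ag e e0.
exists (Num.min d d'); first by rewrite lt_min d0.
by move=> w; rewrite lt_min => /andP[/gh <- /gd]; rewrite (gh z) // subrr normc0.
Qed.

Lemma cslope_continuous g z : cdifferentiable_at g z ->
  exists a, ccontinuous_at (cslope g a z) z.
Proof.
move=> [a ag]; exists a => e e0; have [d d0 gd] := ag e e0; exists d => // w wd.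
rewrite /cslope eqxx; case: eqVneq => [_|wz]; first by rewrite subrr normc0 ltW.
have wz0 : w - z != 0 by rewrite subr_eq0.
rewrite -(@ler_pM2r _ (normc (w - z))) ?normc_gt0 // -normcM.
by have -> : ((g w - g z) / (w - z) - a) * (w - z) = g w - g z - a * (w - z);
  [field|exact: gd].
Qed.

Lemma cdifferentiableM g h z : cdifferentiable_at g z -> cdifferentiable_at h z ->
  cdifferentiable_at (fun w => g w * h w) z.
Proof.
move=> dg dh; have [a ca] := cslope_continuous dg; have [b cb] := cslope_continuous dh.
have slopeE f c w : f w - f z = cslope f c z w * (w - z).
  rewrite /cslope; case: eqVneq => [->|wz]; first by rewrite !subrr mulr0.
  by rewrite divfK // subr_eq0.
apply: (@cdifferentiable_factor _ (fun w => cslope g a z w * h w + g z * cslope h b z w) z 1) => //.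
  apply: ccontinuousD; apply: ccontinuousM => //; last exact: ccontinuous_cst.
  exact: cdifferentiable_continuous.
by move=> w _; rewrite mulrDl mulrAC -slopeE -mulrA -slopeE; ring.
Qed.

Lemma cdifferentiableD g h z : cdifferentiable_at g z -> cdifferentiable_at h z ->
  cdifferentiable_at (fun w => g w + h w) z.
Proof.
move=> dg dh; have [a ca] := cslope_continuous dg; have [b cb] := cslope_continuous dh.
have slopeE f c w : f w - f z = cslope f c z w * (w - z).
  rewrite /cslope; case: eqVneq => [->|wz]; first by rewrite !subrr mulr0.
  by rewrite divfK // subr_eq0.
apply: (@cdifferentiable_factor _ (fun w => cslope g a z w + cslope h b z w) z 1) => //.
  exact: ccontinuousD.
by move=> w _; rewrite mulrDl -!slopeE; ring.
Qed.

Lemma cdifferentiable_cst a z : cdifferentiable_at (fun=> a) z.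
Proof.
apply: (@cdifferentiable_factor _ (fun=> 0) z 1) => //; first exact: ccontinuous_cst.
by move=> w _; rewrite subrr mul0r.
Qed.

Lemma ccontinuous_invB w z : z != w -> ccontinuous_at (fun u => (u - w)^-1) z.
Proof.
move=> zw e e0; have zw0 : z - w != 0 by rewrite subr_eq0.
have [d d0 vd] := ccontinuousV zw0 e0; exists d => // u ud; apply: vd.
by rewrite opprB addrA subrK.
Qed.

Lemma cdifferentiable_invB w z : z != w -> cdifferentiable_at (fun u => (u - w)^-1) z.
Proof.
move=> zw.
have zw0 : 0 < normc (z - w) by rewrite normc_gt0 subr_eq0.
apply: (@cdifferentiable_factor _ (fun u => - (z - w)^-1 * (u - w)^-1) z (normc (z - w))) => //.
  by apply: ccontinuousM; [exact: ccontinuous_cst|exact: ccontinuous_invB].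
move=> u ud; have uw : u - w != 0.
  rewrite subr_eq0; apply/eqP => uw; move: ud.
  by rewrite uw normc_distC ltxx.
by field; rewrite uw subr_eq0 zw.
Qed.

Lemma normc_near_neq z w u : normc (u - z) < normc (z - w) -> u != w.
Proof. by apply: contraTneq => ->; rewrite normc_distC ltxx. Qed.

Lemma cslope_continuous_off g a w z : z != w -> ccontinuous_at g z ->
  ccontinuous_at (cslope g a w) z.
Proof.
move=> zw cg; have zw0 : 0 < normc (z - w) by rewrite normc_gt0 subr_eq0.
apply: (@ccontinuous_near (fun u => (g u + - g w) * (u - w)^-1) _ z _ zw0).
  by move=> u /normc_near_neq /negPf; rewrite /cslope => ->.
apply: ccontinuousM; last exact: ccontinuous_invB.
by apply: ccontinuousD => //; exact: ccontinuous_cst.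
Qed.

Lemma cslope_differentiable g a w z : z != w -> cdifferentiable_at g z ->
  cdifferentiable_at (cslope g a w) z.
Proof.
move=> zw dg; have zw0 : 0 < normc (z - w) by rewrite normc_gt0 subr_eq0.
apply: (@cdifferentiable_near (fun u => (g u + - g w) * (u - w)^-1) _ z _ zw0).
  by move=> u /normc_near_neq /negPf; rewrite /cslope => ->.
apply: cdifferentiableM; last exact: cdifferentiable_invB.
by apply: cdifferentiableD => //; exact: cdifferentiable_cst.
Qed.

Local Notation mu := (@lebesgue_measure R).

Lemma Rintegral_itv_ge (f : R -> R) (a b c : R) : a <= b -> continuous f ->
  (forall t, a <= t <= b -> c <= f t) -> c * (b - a) <= (\int[mu]_(t in `[a, b]) f t)%R.
Proof.
move=> ab cf cle; rewrite -Rintegral_itv_cst //; apply: le_Rintegral => //.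
- by apply: continuous_itv_integrable => x; exact: cvg_cst.
- exact: continuous_itv_integrable.
Qed.

Lemma on_sides_normc_ge w r z : 0 < r ->
  (complex.Re z == complex.Re w - r) || (complex.Re z == complex.Re w - r + (r + r)) ||
  (complex.Im z == complex.Im w - r) || (complex.Im z == complex.Im w - r + (r + r)) ->
  r <= normc (z - w).
Proof.
move=> r0.
have ReB : complex.Re (z - w) = complex.Re z - complex.Re w by case: (z) (w) => [? ?] [].
have ImB : complex.Im (z - w) = complex.Im z - complex.Im w by case: (z) (w) => [? ?] [].
move=> /orP[/orP[/orP[]|]|] /eqP zw.
- apply: le_trans (ler_normcRe _); rewrite ReB zw ler_normr; apply/orP; right; lra.
- apply: le_trans (ler_normcRe _); rewrite ReB zw ler_normr; apply/orP; left; lra.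
- apply: le_trans (ler_normcIm _); rewrite ImB zw ler_normr; apply/orP; right; lra.
- apply: le_trans (ler_normcIm _); rewrite ImB zw ler_normr; apply/orP; left; lra.
Qed.

Lemma invB_continuous_sides w r : 0 < r -> continuous_sides (fun z => (z - w)^-1)
  (complex.Re w - r) (complex.Im w - r) (r + r).
Proof.
move=> r0 z /(on_sides_normc_ge r0) rz; apply: ccontinuous_invB.
by rewrite -subr_eq0 -normc_gt0; exact: lt_le_trans rz.
Qed.

(** The exact value 2 pi is replaced by a bound without arctangents: the part of the integrand that
    counts is r / (t^2 + r^2) >= 1 / (2 r) on each side, of length 2 r, so each of the four sides
    contributes at least 1. *)
Lemma Im_square_int_invB_ge w r : 0 < r -> 4 <= complex.Im (square_int (fun z => (z - w)^-1)
  (complex.Re w - r) (complex.Im w - r) (r + r)).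
Proof.
move=> r0.
have [[_ c1] [_ c2] [c3 _] [c4 _]] := continuous_sidesE (invB_continuous_sides (w := w) r0).
have r2 : 0 < r + r by lra.
have le2 (u : R) : u <= u + (r + r) by lra.
have kle u t : u - r <= t <= u - r + (r + r) ->
    (r + r)^-1 <= r / ((t - u) ^+ 2 + r ^+ 2).
  move=> ut; rewrite ler_pdivlMr; last by rewrite ltr_wpDl ?sqr_ge0 ?exprn_gt0.
  rewrite mulrC ler_pdivrMr //; have : 0 <= (r - (t - u)) * (r + (t - u)).
    by apply: mulr_ge0; lra.
  by rewrite expr2 expr2; lra.
have int1 (f : R -> R) u : continuous f ->
    (forall t, u <= t <= u + (r + r) -> (r + r)^-1 <= f t) ->
    1 <= (\int[mu]_(t in `[u, (u + (r + r))]) f t)%R.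
  move=> cf fc; have := Rintegral_itv_ge (le2 u) cf fc.
  by rewrite addrAC subrr add0r mulVf // gt_eqF.
have intN (f : R -> R) u : continuous f -> 1 <= (\int[mu]_(t in `[u, (u + (r + r))]) - f t)%R ->
    (\int[mu]_(t in `[u, (u + (r + r))]) f t)%R <= - 1.
  move=> cf; have -> : (fun t => - f t) = (fun t => - 1 * f t).
    by apply/funext => t; rewrite mulN1r.
  by rewrite RintegralZl //; [lra|exact: continuous_itv_integrable].
have ImE (A B C D : R[i]) : complex.Im (A - B + 'i%C * (C - D)) =
    complex.Im A - complex.Im B + (complex.Re C - complex.Re D).
  by case: A B C D => [? ?] [? ?] [? ?] [? ?] /=; lra.
have Im_inv (p q : R) : complex.Im ((p +i* q)^-1) = - (q / (p ^+ 2 + q ^+ 2)) by [].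
have Re_inv (p q : R) : complex.Re ((p +i* q)^-1) = p / (p ^+ 2 + q ^+ 2) by [].
have subE (p q : R) : (p +i* q) - w = (p - complex.Re w) +i* (q - complex.Im w).
  by case: (w).
have sqrC (p q : R) : p ^+ 2 + q ^+ 2 = q ^+ 2 + p ^+ 2 by rewrite addrC.
rewrite /square_int ImE.
have i1 : 1 <= complex.Im (curve_int (fun t => ((t +i* (complex.Im w - r)) - w)^-1)
    (complex.Re w - r) (complex.Re w - r + (r + r))).
  apply: int1 => // t /kle; rewrite subE Im_inv addrAC subrr add0r mulNr opprK sqrrN.
  exact.
have i2 : complex.Im (curve_int (fun t => ((t +i* (complex.Im w - r + (r + r))) - w)^-1)
    (complex.Re w - r) (complex.Re w - r + (r + r))) <= - 1.
  apply: intN => //; apply: int1; first by move=> x; apply: cvgN; exact: c2.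
  move=> t /kle; rewrite subE Im_inv opprK.
  by have -> : complex.Im w - r + (r + r) - complex.Im w = r by ring.
have i3 : 1 <= complex.Re (curve_int (fun t => (((complex.Re w - r + (r + r)) +i* t) - w)^-1)
    (complex.Im w - r) (complex.Im w - r + (r + r))).
  apply: int1 => // t /kle; rewrite subE Re_inv sqrC.
  by have -> : complex.Re w - r + (r + r) - complex.Re w = r by ring.
have i4 : complex.Re (curve_int (fun t => (((complex.Re w - r) +i* t) - w)^-1)
    (complex.Im w - r) (complex.Im w - r + (r + r))) <= - 1.
  apply: intN => //; apply: int1; first by move=> x; apply: cvgN; exact: c4.
  move=> t /kle; rewrite subE Re_inv sqrC addrAC subrr add0r mulNr opprK sqrrN.
  exact.
lra.
Qed.

(** Cauchy's formula with crude constants. The slope of [g] at [w] has integral 0, so the integral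
    of [g z / (z - w)] equals [g w] times that of [1 / (z - w)]; the former is at most [16 * M], the
    latter at least 4 in modulus. *)
Lemma mean_value_le (ps : seq R[i]) g w r M : 0 < r ->
  (forall z, ccontinuous_at g z) -> (forall z, z \notin ps -> cdifferentiable_at g z) ->
  w \notin ps -> (forall z, r <= normc (z - w) -> normc (g z) <= M) ->
  normc (g w) <= 4 * M.
Proof.
move=> r0 cg dg wps gM.
have [a ca] := cslope_continuous (dg _ wps).
have rr : 0 < r + r by lra.
have int0 : square_int (cslope g a w) (complex.Re w - r) (complex.Im w - r) (r + r) = 0.
  apply: (@square_int_eq0 (w :: ps)) => // z; last first.
    by rewrite inE negb_or => /andP[zw /dg]; exact: cslope_differentiable.
  by have [->//|zw] := eqVneq z w; exact: cslope_continuous_off.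
have cinv := invB_continuous_sides (w := w) r0.
have cginv : continuous_sides (fun z => g z * (z - w)^-1)
    (complex.Re w - r) (complex.Im w - r) (r + r).
  by move=> z zs; apply: ccontinuousM; [exact: cg|exact: cinv].
have : square_int (fun z => g z * (z - w)^-1 + - g w * (z - w)^-1)
    (complex.Re w - r) (complex.Im w - r) (r + r) = 0.
  rewrite -int0; apply: eq_square_int => // z [_ _ /(on_sides_normc_ge r0) rz].
  rewrite /cslope; case: eqVneq => [zw|_]; last by rewrite mulrBl mulNr.
  by exfalso; move: rz; rewrite zw subrr normc0; lra.
rewrite square_intD //; last first.
  by move=> z zs; apply: ccontinuousM; [exact: ccontinuous_cst|exact: cinv].
rewrite square_intZ // mulNr => /eqP; rewrite subr_eq0 => /eqP intE.
have : normc (square_int (fun z => g z * (z - w)^-1)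
    (complex.Re w - r) (complex.Im w - r) (r + r)) <= 8 * (M / r) * (r + r).
  apply: normc_square_int_le => // z [_ _ /(on_sides_normc_ge r0) rz].
  rewrite normcM normcV; apply: ler_pM; rewrite ?normc_ge0 ?invr_ge0 ?normc_ge0 ?gM //.
  by rewrite lef_pV2 ?posrE //; exact: lt_le_trans rz.
rewrite intE normcM.
have -> : 8 * (M / r) * (r + r) = 16 * M by field; rewrite gt_eqF.
have := Im_square_int_invB_ge w r0; set K := square_int _ _ _ _ => K4 le16.
have K4' : 4 <= normc K.
  by apply: le_trans K4 _; apply: le_trans (ler_normcIm K); exact: ler_norm.
by have := ler_wpM2l (normc_ge0 (g w)) K4'; lra.
Qed.

(** The slope of [g] at 0 tends to 0 at infinity, and [mean_value_le], with 0 as exceptional point,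
    carries its smallness from far away to every [w]. *)
Theorem liouville g M : (forall z, cdifferentiable_at g z) ->
  (forall z, normc (g z) <= M) -> forall z, g z = g 0.
Proof.
move=> dg gM w; have [->//|w0] := eqVneq w 0.
have [a ca] := cslope_continuous (dg 0).
have M0 : 0 <= M := le_trans (normc_ge0 _) (gM 0).
have cs z : ccontinuous_at (cslope g a 0) z.
  have [->//|z0] := eqVneq z 0.
  by apply: cslope_continuous_off => //; exact: cdifferentiable_continuous.
have ds z : z \notin [:: 0] -> cdifferentiable_at (cslope g a 0) z.
  by rewrite inE => z0; exact: cslope_differentiable.
have small e : 0 < e -> normc (cslope g a 0 w) <= 4 * e.
  (* Points at distance at least [r] from [w] have modulus above [2 * M / e], where the slope is at
     most [e]. *)
  move=> e0; pose r := normc w + (M + M) / e + 1.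
  have re0 : 0 <= (M + M) / e by apply: divr_ge0; [lra|exact: ltW].
  have w1 := normc_ge0 w.
  apply: (@mean_value_le [:: 0] _ _ r) => //; first by rewrite /r; lra.
    by rewrite inE.
  move=> z rz; have zr : (M + M) / e + 1 <= normc z.
    by have := ler_normcB z w; rewrite /r in rz; lra.
  have z0 : z != 0 by rewrite -normc_gt0; lra.
  rewrite /cslope (negPf z0) subr0 normcM normcV ler_pdivrMr ?normc_gt0 //.
  apply: le_trans (ler_normcB _ _) _.
  have := gM z; have := gM 0; have := ler_wpM2l (ltW e0) zr.
  by rewrite mulrDr mulrCA divff ?gt_eqF // mulr1; lra.
have : normc (cslope g a 0 w) <= 0.
  by apply/ler_addgt0Pr => e e0; have := small (e / 4); lra.
rewrite /cslope (negPf w0) subr0 => le0.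
have : normc ((g w - g 0) / w) == 0 by rewrite eq_le le0 normc_ge0.
by rewrite normc_eq0 mulf_eq0 invr_eq0 (negPf w0) orbF subr_eq0 => /eqP.
Qed.

End Liouville.

(** * Holomorphic maps between tori *)

Section Differentiability.
Context (R : realType).
Implicit Types (z h v : C2 R) (f : C2 R -> C2 R) (A : 'M[Cplx R]_2).

Lemma norm_vnorm v : `|v| = ((vnorm v)%:C : Cplx R).
Proof.
have le_v i : `|v ord0 i| <= (vnorm v)%:C :> Cplx R.
  by rewrite -[X in X <= _]/((normc _)%:C) lecR normc_le_vnorm.
apply/le_anti/andP; split.
  rewrite -[X in X <= _]/(mx_norm v).
  have [->|/mx_norm_neq0[[i j] /= ->]] := eqVneq (mx_norm v) 0.
    by rewrite lecR vnorm_ge0.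
  by rewrite (ord1 i).
have ge_v i : ((normc (v ord0 i))%:C : Cplx R) <= `|v|.
  rewrite -[X in X <= _]/(`|v ord0 i|) -[X in _ <= X]/(mx_norm v) mx_normE.
  exact: (le_bigmax _ (fun k : 'I_1 * 'I_2 => `|v k.1 k.2|%:nng) (ord0, i)).
by rewrite /vnorm /Num.max; case: ifP.
Qed.

Definition vdifferentiable f z A := forall e : R, 0 < e -> exists2 d : R, 0 < d &
  forall h, vnorm h < d -> vnorm (f (z + h) - f z - h *m A) <= e * vnorm h.

Lemma mulmx_continuous A : continuous (fun h : C2 R => h *m A).
Proof.
move=> z B /nbhs_vnormP[e e0 eB]; apply/nbhs_vnormP.
have [K K0 KA] := vnorm_mulmx A; exists (e / K); first exact: divr_gt0.
move=> w wz; apply: eB; rewrite -mulmxBl; apply: le_lt_trans (KA _) _.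
by rewrite mulrC -ltr_pdivlMr.
Qed.

Lemma differentiable_vnormP f z : differentiable f z <-> exists A, vdifferentiable f z A.
Proof.
split=> [df|[A dA]].
  have /eqaddoP fo := diff_locally df.
  exists (lin1_mx ('d f z)) => e e0.
  have /fo /nbhs_vnormP[d d0 dP] : 0 < (e%:C : Cplx R) by rewrite ltcR.
  exists d => // h hd; have := dP h; rewrite subr0 => /(_ hd).
  rewrite !norm_vnorm -(rmorphM (real_complex R)) lecR mul_rV_lin1.
  by rewrite !fctE /= opprD addrA [h + z]addrC.
have key (eps : Cplx R) : 0 < eps -> \forall h \near (0 : C2 R),
    `|(f \o shift z - (cst (f z) + (mulmxr A : C2 R -> C2 R))) h| <= eps * `|h|.
  case: eps => a b; rewrite ltcE /= => /andP[/eqP -> a0].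
  have [d d0 dP] := dA _ a0; apply/nbhs_vnormP; exists d => // h; rewrite subr0 => /dP.
  rewrite !norm_vnorm -(rmorphM (real_complex R)) lecR.
  by rewrite !fctE /= opprD addrA [h + z]addrC.
have dE : 'd f z = mulmxr A :> (C2 R -> C2 R).
  by apply: diff_unique; [exact: mulmx_continuous|apply/eqaddoP; exact: key].
apply/diff_locallyP; rewrite dE; split; first exact: mulmx_continuous.
by apply/eqaddoP; exact: key.
Qed.

Lemma vdifferentiable_near f g z A (d : R) : 0 < d ->
  (forall h, vnorm h < d -> f (z + h) = g (z + h)) ->
  vdifferentiable f z A -> vdifferentiable g z A.
Proof.
move=> d0 fg df e e0; have [d' d'0 fd] := df e e0.
exists (Num.min d d'); first by rewrite lt_min d0.
move=> h; rewrite lt_min => /andP[/fg <- /fd].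
by have := fg 0; rewrite vnorm0 addr0 => /(_ d0) ->.
Qed.

Lemma vdifferentiable_affine A b z : vdifferentiable (fun z => z *m A + b) z A.
Proof.
move=> e e0; exists 1 => // h _.
rewrite opprD addrACA subrr addr0 -!mulmxBl [z + h]addrC addrK subrr mul0mx vnorm0.
by rewrite mulr_ge0 ?vnorm_ge0 // ltW.
Qed.

Lemma vdifferentiable_continuous f z A : vdifferentiable f z A ->
  forall e : R, 0 < e -> exists2 d : R, 0 < d &
  forall h, vnorm h < d -> vnorm (f (z + h) - f z) < e.
Proof.
move=> df e e0; have [d d0 fd] := df 1 ltr01; have [K K0 KA] := vnorm_mulmx A.
have k0 : 0 < 1 + K by lra.
exists (Num.min d (e / (1 + K))); first by rewrite lt_min d0 divr_gt0.
move=> h; rewrite lt_min => /andP[/fd hd]; rewrite ltr_pdivlMr // => he.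
rewrite -[f (z + h) - f z](subrK (h *m A)); apply: le_lt_trans (vnormD _ _) _.
by have := KA h; lra.
Qed.

End Differentiability.

(** * The quotient topology of a torus and Lebesgue numbers *)

Section TorusTopology.
Context (R : realType).
Implicit Types (X Y : torus2 R) (z w v h : C2 R).

Lemma torus_proj_eq X z w : torus_proj X z = torus_proj X w <-> lattice X (z - w).
Proof.
split=> [/eqquotP /asboolP //|zw]; apply/eqquotP; exact/asboolP.
Qed.

Lemma torus_proj_surj X (p : torus_points X) : exists z, torus_proj X z = p.
Proof. by exists (repr p); exact: reprK. Qed.

Lemma torus_proj_addl X z w v : torus_proj X z = torus_proj X w ->
  torus_proj X (z + v) = torus_proj X (w + v).
Proof. by move=> /torus_proj_eq zw; apply/torus_proj_eq; rewrite opprD addrACA subrr addr0. Qed.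

Lemma torus_proj_lattice X z l : lattice X l -> torus_proj X (z + l) = torus_proj X z.
Proof. by move=> Xl; apply/torus_proj_eq; rewrite addrAC subrr add0r. Qed.

Lemma torus_openP X (A : set (torus_points X)) : open A <-> open (torus_proj X @^-1` A).
Proof. by []. Qed.

Lemma torus_proj_open X (B : set (C2 R)) : open B -> open (torus_proj X @` B).
Proof.
move=> /open_vnormP oB; apply/torus_openP/open_vnormP => z [w Bw /torus_proj_eq wz].
have [e e0 eB] := oB _ Bw; exists e => // v vz; exists (w + (v - z)).
  by apply: eB; rewrite addrAC subrr add0r.
apply/torus_proj_eq; have -> : w + (v - z) - v = w - z by rewrite addrA addrAC addrK.
exact: wz.
Qed.

Lemma ball_open z (e : R) : open [set w : C2 R | vnorm (w - z) < e].
Proof.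
apply/open_vnormP => v /= ve; exists (e - vnorm (v - z)) => [|w wv]; first by rewrite subr_gt0.
have -> : w - z = (w - v) + (v - z) by rewrite addrA subrK.
by apply: le_lt_trans (vnormD _ _) _; rewrite -ltrBrDr.
Qed.

(** Compactness of the torus enters only here: every point of the plane is moved by a lattice vector
    into a fixed compact box. The number [d] is stated upstairs in C^2, where maps are iterated and
    lifted. *)
Lemma lebesgue_number X (U : set (set (torus_points X))) : open_cover U ->
  exists2 d : R, 0 < d & forall z, exists2 A, U A &
    forall h, vnorm h < d -> A (torus_proj X (z + h)).
Proof.
move=> [Uo Ucov]; have [K K0 Kcov] := lattice_cobounded X.
(* Real coordinates make the box a product of four real segments. *)
pose plane (t : 'rV[R]_4) : C2 R := \row_(i < 2)
  (if i == ord0 then t 0 (@Ordinal 4 0 isT) +i* t 0 (@Ordinal 4 1 isT)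
   else t 0 (@Ordinal 4 2 isT) +i* t 0 (@Ordinal 4 3 isT)).
have plane_lip (s t : 'rV[R]_4) (e : R) : (forall i, `|s 0 i - t 0 i| < e) ->
    vnorm (plane s - plane t) < e + e.
  by move=> st; rewrite vnorm_lt; apply/andP; split;
    apply: le_lt_trans (normc_le_ReIm _) _; rewrite !mxE /=; apply: ltrD; exact: st.
pose box := [set t : 'rV[R]_4 | forall i, `[- K, K]%classic (t ord0 i)].
have cbox : compact box.
  by apply: (@rV_compact _ 4 (fun=> `[- K, K]%classic)) => i; exact: segment_compact.
pose P (d : R) (t : 'rV[R]_4) := exists2 A, U A &
  forall h, vnorm h < d -> A (torus_proj X (plane t + h)).
have [d /= d0 dP] : exists2 d : R, 0 < d & box `<=` P d.
  (* Compactness in the form of near-covering: a radius that works locally near each point of the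
     box works on the whole box. *)
  have nearP : \forall d \near (0 : R)^'+, box `<=` P d.
    move: cbox => /compact_near_coveringP; apply => t _.
    have [A UA At] : (\bigcup_(A in U) A) (torus_proj X (plane t)) by rewrite Ucov.
    have /torus_openP/open_vnormP/(_ _ At)[e e0 eA] := Uo _ UA.
    (* Moving each real coordinate by less than [e / 4] moves the point by less than [e / 2], which
       leaves room for [h]. *)
    have e4 : 0 < e / 4 by rewrite divr_gt0.
    exists (ball t (e / 4), [set d | d < e / 4]) => /=.
      split; first exact: nbhsx_ballx.
      exact: nbhs_right_lt.
    move=> [s d] /= [ts de]; exists A => // h hd; apply: eA.
    have -> : plane s + h - plane t = (plane s - plane t) + h by rewrite addrAC.
    have st : vnorm (plane s - plane t) < e / 4 + e / 4.
      by apply: plane_lip => i; have := ts.2 ord0 i; rewrite /ball /= distrC.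
    by apply: le_lt_trans (vnormD _ _) _; move: st hd de; lra.
  near (0 : R)^'+ => d; exists d; near: d; last exact: nearP.
  exact: nbhs_right_gt.
exists d => // z; have [l Xl zl] := Kcov z.
have [s sz] : exists s, plane s = z - l.
  exists (real_coord (z - l)); apply/rowP; apply: ord2P; rewrite !mxE /=;
    by case: (z _ _) (l _ _) => [? ?] [].
have [|A UA dA] := dP s.
  have cz i : normc (plane s ord0 i) <= K by rewrite sz; exact: le_trans (normc_le_vnorm _ _) zl.
  have Rez i : `|complex.Re (plane s ord0 i)| <= K := le_trans (ler_normcRe _) (cz i).
  have Imz i : `|complex.Im (plane s ord0 i)| <= K := le_trans (ler_normcIm _) (cz i).
  move: (Rez ord0) (Rez ord_max) (Imz ord0) (Imz ord_max); rewrite !mxE /= => r0 r1 i0 i1.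
  move=> [[|[|[|[|//]]]] i4] /=; rewrite in_itv /= -ler_norml.
  - by move: r0; congr (`|s _ _| <= K); apply/val_inj.
  - by move: i0; congr (`|s _ _| <= K); apply/val_inj.
  - by move: r1; congr (`|s _ _| <= K); apply/val_inj.
  - by move: i1; congr (`|s _ _| <= K); apply/val_inj.
exists A => // h /dA; rewrite sz.
by rewrite -(torus_proj_lattice _ Xl) addrAC subrK.
Unshelve. all: by end_near. Qed.

End TorusTopology.

(** * Lifting holomorphic maps of tori to C^2 *)

Section Rigidity.
Context (R : realType).
Implicit Types (X Y : torus2 R) (z w v h : C2 R).

Lemma torus_proj_locally_inj Y : exists2 e : R, 0 < e & forall w v v',
  vnorm v < e -> vnorm v' < e -> torus_proj Y (w + v) = torus_proj Y (w + v') -> v = v'.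
Proof.
have [e e0 eL] := lattice_separated Y.
exists (e / 2) => [|w v v' ve ve']; first by rewrite divr_gt0.
move=> /torus_proj_eq; rewrite opprD addrACA subrr add0r => /eL vv'.
by apply/eqP; rewrite -subr_eq0 vv' //; apply: le_lt_trans (vnormB _ _) _; lra.
Qed.

Lemma torus_ball_chart Y : exists2 e : R, 0 < e & forall w,
  chart_range Y [set v | vnorm (v - w) < e].
Proof.
have [e e0 einj] := torus_proj_locally_inj Y; exists e => // w; split.
  exact: ball_open.
move=> u v; rewrite !inE /= => ue ve uv.
have := einj w _ _ ue ve; rewrite !(addrC w) !subrK => /(_ uv)/(congr1 (+%R^~ w)).
by rewrite !subrK.
Qed.

Lemma chartK Y V p : chart_range Y V -> (torus_proj Y @` V) p ->
  torus_proj Y (chart V p) = p.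
Proof. by move=> _ Vp; apply: pinvK; rewrite inE. Qed.

Lemma chart_proj Y V v : chart_range Y V -> V v -> chart V (torus_proj Y v) = v.
Proof. by move=> [_ Vinj] Vv; apply: pinvKV => //; rewrite inE. Qed.

Lemma torus_near X (A : set (torus_points X)) z : open A -> A (torus_proj X z) ->
  exists2 d : R, 0 < d & forall h, vnorm h < d -> A (torus_proj X (z + h)).
Proof.
move=> /torus_openP/open_vnormP oA /oA[d d0 dA]; exists d => // h hd; apply: dA.
by rewrite addrAC subrr add0r.
Qed.

Lemma continuous_openP X Y (f : torus_points X -> torus_points Y) B :
  continuous f -> open B -> open (f @^-1` B).
Proof. by move=> /continuousP; exact. Qed.

(** On small balls the charts invert the projections, so [f] read in charts is a differentiable lift
    through any prescribed point [w] above the image. *)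
Lemma local_lift X Y (f : torus_points X -> torus_points Y) z w : holomorphic f ->
  torus_proj Y w = f (torus_proj X z) -> exists g A,
  [/\ g z = w, vdifferentiable g z A & exists2 d : R, 0 < d &
   forall h, vnorm h < d -> torus_proj Y (g (z + h)) = f (torus_proj X (z + h))].
Proof.
move=> [cf hf] wz; have [eX eX0 /(_ z) cX] := torus_ball_chart X.
have [eY eY0 /(_ w) cY] := torus_ball_chart Y.
set V := [set v | _] in cY; set U := [set v | _] in cX.
have Vw : V w by rewrite /V /= subrr vnorm0.
have Uz : U z by rewrite /U /= subrr vnorm0.
have Vfz : (torus_proj Y @` V) (f (torus_proj X z)) by exists w.
have /differentiable_vnormP[A gA] := hf U V cX cY z Uz Vfz.
exists (chart V \o f \o torus_proj X), A; split => //.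
  by rewrite /= -wz chart_proj.
have oV : open (torus_proj Y @` V) by apply: torus_proj_open; exact: cY.1.
have [d d0 dV] := torus_near (continuous_openP cf oV) Vfz.
by exists d => // h /dV Vh; exact: chartK.
Qed.

(** Uniform continuity in terms of lifts: [d] is a Lebesgue number for the preimages of small balls,
    hence independent of [z] and of the lift [w]. *)
Lemma uniform_lift X Y (f : torus_points X -> torus_points Y) (e : R) : continuous f ->
  0 < e -> exists2 d : R, 0 < d & forall z w h, vnorm h < d ->
  torus_proj Y w = f (torus_proj X z) ->
  exists2 v, vnorm v < e & torus_proj Y (w + v) = f (torus_proj X (z + h)).
Proof.
move=> cf e0; have e2 : 0 < e / 2 by rewrite divr_gt0.
pose B w := torus_proj Y @` [set v | vnorm (v - w) < e / 2].
have oB w : open (B w) by apply: torus_proj_open; exact: ball_open.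
have [|d d0 dP] := @lebesgue_number _ X [set f @^-1` B w | w in setT].
  split=> [_ [w _ <-]|]; first exact: continuous_openP.
  apply/seteqP; split=> // p _; have [w wp] := torus_proj_surj (f p).
  exists (f @^-1` B w); first by exists w.
  by exists w => //=; rewrite subrr vnorm0.
exists d => // z w h hd wz; have [_ [u _ <-] uP] := dP z.
have [a au az] : B u (f (torus_proj X z)) by rewrite -[z]addr0; apply: uP; rewrite vnorm0.
have [b bu bz] := uP _ hd.
exists (b - a).
  have -> : b - a = (b - u) - (a - u) by rewrite opprB addrA subrK.
  by apply: le_lt_trans (vnormB _ _) _; move: au bu => /=; lra.
rewrite -bz -[b in RHS](subrK a) addrC [b - a + a]addrC addrC.
by apply: torus_proj_addl; rewrite wz az.
Qed.

(* The increment [z |-> f (z + h) - f z] lifts to a bounded entire map of the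
   plane, constant by Liouville's theorem. *)
Theorem holomorphic_affine X Y (f : torus_points X -> torus_points Y) :
  holomorphic f -> exists A b, forall z,
  f (torus_proj X z) = torus_proj Y (z *m A + b).
Proof.
move=> hf; have [cf _] := hf.
have [e1 e10 einj] := torus_proj_locally_inj Y.
(* Three terms below [e] are added when two candidate increments are compared, and the projection is
   injective only on balls of radius [e1]. *)
pose e := e1 / 3; have e0 : 0 < e by rewrite divr_gt0.
have e1E : e1 = e + e + e by rewrite /e; lra.
clearbody e.
have [d d0 dP] := uniform_lift cf e0.
(* The increment is the same for all lifts [w], by translation invariance; for [h] outside the ball
   it takes the default value 0. *)
have : forall hz : C2 R * C2 R, exists v, vnorm hz.1 < d -> vnorm v < e /\
    forall w, torus_proj Y w = f (torus_proj X hz.2) ->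
    torus_proj Y (w + v) = f (torus_proj X (hz.2 + hz.1)).
  move=> [h z]; case: (pselect (vnorm h < d)) => [hd|nhd]; last by exists 0.
  have [w wz] := torus_proj_surj (f (torus_proj X z)).
  have [v ve vw] := dP z w h hd wz; exists v => _; split=> // w' w'z.
  by rewrite /= -vw; apply: torus_proj_addl; rewrite w'z.
move=> /choice[D' D'P]; pose D h z := D' (h, z).
have DP h z : vnorm h < d -> vnorm (D h z) < e /\
    forall w, torus_proj Y w = f (torus_proj X z) ->
    torus_proj Y (w + D h z) = f (torus_proj X (z + h)) by exact: (D'P (h, z)).
have Duniq h z w v : vnorm h < d -> vnorm v < e1 -> torus_proj Y w = f (torus_proj X z) ->
    torus_proj Y (w + v) = f (torus_proj X (z + h)) -> D h z = v.
  move=> hd ve wz vw; have [De Dw] := DP h z hd.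
  by apply: (einj w) => //; [lra|rewrite Dw].
have Ddiff h z : vnorm h < d -> exists A, vdifferentiable (D h) z A.
  move=> hd; have [w wz] := torus_proj_surj (f (torus_proj X z)).
  have [De Dw] := DP h z hd.
  have [g1 [A1 [g1z dg1 [r1 r10 lift1]]]] := local_lift hf wz.
  have [g2 [A2 [g2z dg2 [r2 r20 lift2]]]] := local_lift hf (Dw w wz).
  have [r3 r30 near1] := vdifferentiable_continuous dg1 e0.
  have [r4 r40 near2] := vdifferentiable_continuous dg2 e0.
  exists (A2 - A1).
  (* By uniqueness of short increments, [D h] agrees near [z] with the difference of a local lift at
     [z + h] and one at [z]. *)
  have dg : vdifferentiable (fun u => g2 (u + h) - g1 u) z (A2 - A1).
    move=> c c0; have c2 : 0 < c / 2 by rewrite divr_gt0.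
    have [s s0 sP] := dg1 _ c2; have [t t0 tP] := dg2 _ c2.
    exists (Num.min s t); first by rewrite lt_min s0.
    move=> k; rewrite lt_min => /andP[/sP ks /tP kt]; rewrite mulmxBr.
    have -> : g2 (z + k + h) - g1 (z + k) - (g2 (z + h) - g1 z) - (k *m A2 - k *m A1) =
      (g2 (z + h + k) - g2 (z + h) - k *m A2) - (g1 (z + k) - g1 z - k *m A1).
      rewrite [z + k + h]addrAC.
      by apply/rowP => i; rewrite !mxE; ring.
    by apply: le_trans (vnormB _ _) _; move: ks kt; lra.
  pose m := Num.min (Num.min r1 r2) (Num.min r3 r4).
  have m0 : 0 < m by rewrite !lt_min r10 r20 r30.
  apply: (vdifferentiable_near m0 _ dg) => k; rewrite !lt_min.
  move=> /andP[/andP[/lift1 k1 /lift2 k2] /andP[/near1 k3 /near2 k4]].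
  apply/esym; apply: (Duniq _ _ (g1 (z + k))) => //.
    have -> : g2 (z + k + h) - g1 (z + k) =
        (g2 (z + h + k) - g2 (z + h)) - (g1 (z + k) - g1 z) + D h z.
      by rewrite [z + k + h]addrAC g1z g2z; apply/rowP => i; rewrite !mxE; ring.
    apply: le_lt_trans (vnormD _ _) _; rewrite e1E; apply: ltrD => //.
    by apply: le_lt_trans (vnormB _ _) _; exact: ltrD.
  by rewrite addrC subrK [z + k + h]addrAC.
have Dcst h z : vnorm h < d -> D h z = D h 0.
  move=> hd; apply/rowP => i.
  (* Liouville's theorem in one variable is applied to one coordinate of [D h] along the complex
     line through 0 and [z]; then t = 1 is compared with t = 0. *)
  pose g (t : R[i]) : R[i] := D h ((t : Cplx R) *: z) 0 i.
  have := @liouville R g e _ _ 1; rewrite /g scale1r scale0r; apply.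
    move=> t; have [A dA] := Ddiff h ((t : Cplx R) *: z) hd.
    exists ((z *m A) 0 i) => c c0.
    have c1 : 0 < c / (1 + vnorm z) by rewrite divr_gt0 // ltr_pwDl ?vnorm_ge0.
    have z1 : 0 < 1 + vnorm z by rewrite ltr_pwDl ?vnorm_ge0.
    have [r r0 rP] := dA _ c1.
    exists (r / (1 + vnorm z)); first by rewrite divr_gt0.
    move=> s; rewrite ltr_pdivlMr // => sr.
    have sz : vnorm (((s - t : R[i]) : Cplx R) *: z) <= normc (s - t) * (1 + vnorm z).
      by rewrite vnormZ; apply: ler_wpM2l; [exact: normc_ge0|lra].
    have := rP _ (le_lt_trans sz sr).
    rewrite -scalerDl [t + (s - t)]addrC subrK -scalemxAl => rle.
    apply: (@le_trans _ _ (vnorm (D h ((s : Cplx R) *: z) - D h ((t : Cplx R) *: z) -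
      ((s - t : R[i]) : Cplx R) *: (z *m A)))).
      by apply: le_trans (normc_le_vnorm _ i); rewrite !mxE mulrC.
    apply: le_trans rle _; apply: le_trans (ler_wpM2l (ltW c1) sz) _.
    by rewrite mulrCA divfK ?gt_eqF // mulrC.
  move=> t; apply/ltW; apply: le_lt_trans (normc_le_vnorm _ i) _.
  by case: (DP h ((t : Cplx R) *: z) hd).
pose inc h := D h 0.
have incP h z w : vnorm h < d -> torus_proj Y w = f (torus_proj X z) ->
    torus_proj Y (w + inc h) = f (torus_proj X (z + h)).
  by move=> hd wz; have [_ Dw] := DP h z hd; rewrite /inc -(Dcst _ z) // Dw.
have inc_lt h : vnorm h < d -> vnorm (inc h) < e by move=> hd; case: (DP h 0 hd).
have [w0 w0P] := torus_proj_surj (f (torus_proj X 0)).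
have [g [A [g0 dg [r r0 lift]]]] := local_lift hf w0P.
have [r' r'0 near0] := vdifferentiable_continuous dg e10.
have incE h : vnorm h < Num.min d (Num.min r r') -> inc h = g (0 + h) - g 0.
  rewrite !lt_min => /andP[hd /andP[/lift hr /near0 hr']].
  apply: (Duniq _ _ w0) => //.
  by rewrite g0 addrC subrK hr.
have incD h k : vnorm h < d -> vnorm k < d -> vnorm (h + k) < d ->
    inc (h + k) = inc h + inc k.
  move=> hd kd hkd; apply: (Duniq _ _ w0) => //.
    by apply: le_lt_trans (vnormD _ _) _; have := inc_lt h hd; have := inc_lt k kd; lra.
  by rewrite !addrA; apply: (incP) => //; exact: incP.
(* Halving: additivity gives inc h = 2^n inc (h / 2^n), and near 0 the map [inc] is an increment of
   [g], with derivative [A]; letting n grow yields linearity. *)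
pose part n h : C2 R := ((2^-1 ^+ n : R)%:C : Cplx R) *: h.
have part_norm n h : vnorm (part n h) = 2^-1 ^+ n * vnorm h.
  by rewrite vnormZ normc_real ger0_norm // exprn_ge0 // invr_ge0.
have partS n h : part n h = part n.+1 h + part n.+1 h.
  rewrite /part -scalerDl -(rmorphD (real_complex R)); congr (_%:C *: _).
  by rewrite exprS; lra.
have part_le n h : vnorm (part n h) <= vnorm h.
  rewrite part_norm ler_piMl ?vnorm_ge0 // exprn_ile1 // ?invr_ge0 //.
  by rewrite invf_le1 // ler1n.
have inc_part n h : vnorm h < d -> inc h = ((2 ^+ n : R)%:C : Cplx R) *: inc (part n h).
  move=> hd; have ltd m : vnorm (part m h) < d by exact: le_lt_trans (part_le m h) hd.
  elim: n => [|n ->]; first by rewrite /part !expr0 !scale1r.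
  rewrite [in LHS]partS incD -?partS // scalerDr -scalerDl.
  rewrite -(rmorphD (real_complex R)); congr (_%:C *: _).
  by rewrite exprS; lra.
have part_small h (c : R) : 0 < c -> exists n, vnorm (part n h) < c.
  move=> c0; exists (Num.trunc (vnorm h / c)).+1.
  rewrite part_norm exprVn mulrC ltr_pdivrMr ?exprn_gt0 // mulrC -ltr_pdivrMr //.
  apply: lt_trans (truncnS_gt _) _.
  by rewrite -natrX ltr_nat; exact: ltn_expl.
have inc_lin h : vnorm h < d -> inc h = h *m A.
  move=> hd; apply/eqP; rewrite -subr_eq0 -vnorm_eq0 eq_le vnorm_ge0 andbT.
  apply/ler_addgt0Pr => c c0; rewrite add0r.
  have c1 : 0 < c / (1 + vnorm h) by rewrite divr_gt0 // ltr_pwDl ?vnorm_ge0.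
  have [s s0 sP] := dg _ c1.
  have m0 : 0 < Num.min s (Num.min d (Num.min r r')) by rewrite !lt_min s0 d0 r0.
  have [n] := part_small h _ m0; rewrite lt_min => /andP[/sP ns /incE nE].
  have two0 : 0 < 2 ^+ n :> R by rewrite exprn_gt0.
  have hE : h = ((2 ^+ n : R)%:C : Cplx R) *: part n h.
    rewrite /part scalerA -(rmorphM (real_complex R)) -exprMn divff ?pnatr_eq0 //.
    by rewrite expr1n scale1r.
  rewrite (inc_part n h hd) [in X in _ - X]hE -scalemxAl -scalerBr vnormZ normc_real.
  rewrite (gtr0_norm two0) nE; apply: le_trans (ler_wpM2l (ltW two0) ns) _.
  rewrite part_norm mulrCA (mulrA (2 ^+ n)) -exprMn divff ?pnatr_eq0 // expr1n mul1r.
  rewrite mulrAC ler_pdivrMr; last by rewrite ltr_pwDl ?vnorm_ge0.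
  by rewrite ler_pM2l // lerDr.
exists A, w0 => z.
(* Increments are controlled only for short [h], so [z] is reached from 0 in [N + 1] equal steps. *)
have [N Nz] : exists N : nat, vnorm z / N.+1%:R < d.
  exists (Num.trunc (vnorm z / d)); rewrite ltr_pdivrMr ?ltr0n // mulrC -ltr_pdivrMr //.
  exact: truncnS_gt.
pose h : C2 R := ((N.+1%:R^-1 : R)%:C : Cplx R) *: z.
have hd : vnorm h < d by rewrite vnormZ normc_real ger0_norm ?invr_ge0 // mulrC.
have zE : z = h *+ N.+1.
  rewrite -scaler_nat scalerA -[N.+1%:R](rmorph_nat (real_complex R)).
  by rewrite -(rmorphM (real_complex R)) divff ?pnatr_eq0 // scale1r.
have steps k : torus_proj Y (w0 + (h *m A) *+ k) = f (torus_proj X (h *+ k)).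
  elim: k => [|k IH]; first by rewrite !mulr0n addr0.
  by have := incP h _ _ hd IH; rewrite inc_lin // -addrA -!mulrSr.
have hA : (h *+ N.+1) *m A = (h *m A) *+ N.+1 by exact: (raddfMn (mulmxr A)).
by rewrite zE -steps hA addrC.
Qed.

End Rigidity.

(** * Isomorphisms of tori as linear isomorphisms of lattices *)

Section Isomorphisms.
Context (R : realType).
Implicit Types (X Y Z : torus2 R) (z w v h : C2 R) (A : 'M[Cplx R]_2).

Lemma affine_holomorphic X Y (f : torus_points X -> torus_points Y) A b :
  (forall z, f (torus_proj X z) = torus_proj Y (z *m A + b)) -> holomorphic f.
Proof.
move=> fE; have cf : continuous f.
  apply/continuousP => B /torus_openP/open_vnormP oB.
  apply/torus_openP/open_vnormP => z /=; rewrite fE => /oB[e e0 eB].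
  have [K K0 KA] := vnorm_mulmx A; exists (e / K); first exact: divr_gt0.
  move=> w wz; rewrite fE; apply: eB; rewrite opprD addrACA subrr addr0 -mulmxBl.
  by apply: le_lt_trans (KA _) _; rewrite mulrC -ltr_pdivlMr.
split=> // U V cU cV z Uz [v Vv]; rewrite fE => vz.
have [d d0 dV] := (open_vnormP V).1 cV.1 v Vv.
have [K K0 KA] := vnorm_mulmx A.
apply/differentiable_vnormP; exists A.
apply: (@vdifferentiable_near _ (fun z' => z' *m A + (v - z *m A)) _ _ _ (d / K)).
- exact: divr_gt0.
- move=> h; rewrite ltr_pdivlMr // => hd.
  have E : (z + h) *m A + (v - z *m A) = v + h *m A.
    by rewrite mulmxDl addrC -addrA addKr.
  rewrite /= fE E -(chart_proj cV (v := v + h *m A)); last first.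
    by apply: dV; rewrite addrAC subrr add0r; apply: le_lt_trans (KA _) _; rewrite mulrC.
  congr chart; rewrite (torus_proj_addl _ vz) mulmxDl.
  by rewrite addrAC.
- exact: vdifferentiable_affine.
Qed.

Lemma linear_map_lift X Y A : (forall z, lattice X z -> lattice Y (z *m A)) ->
  exists f : torus_points X -> torus_points Y,
  forall z, f (torus_proj X z) = torus_proj Y (z *m A).
Proof.
move=> XY; exists (fun p => torus_proj Y (repr p *m A)) => z.
apply/torus_proj_eq; rewrite -mulmxBl; apply: XY; apply/torus_proj_eq.
exact: reprK.
Qed.

Lemma linear_isomorphic X Y A : A \in unitmx ->
  (forall z, lattice X z <-> lattice Y (z *m A)) -> isomorphic X Y.
Proof.
move=> uA XY; have [f fE] := linear_map_lift (fun z => (XY z).1).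
have YX z : lattice Y z -> lattice X (z *m invmx A).
  by move=> Yz; apply/XY; rewrite mulmxKV.
have [g gE] := linear_map_lift YX.
exists f, g; split.
- by move=> p; have [z <-] := torus_proj_surj p; rewrite fE gE mulmxK.
- by move=> p; have [z <-] := torus_proj_surj p; rewrite gE fE mulmxKV.
- by apply: (@affine_holomorphic _ _ _ A 0) => z; rewrite addr0.
- by apply: (@affine_holomorphic _ _ _ (invmx A) 0) => z; rewrite addr0.
Qed.

(** Dividing [z] by a large integer brings its image below the length of all nonzero lattice
    vectors, so this image is 0, and with it that of [z]. *)
Lemma small_linear_eq0 Y A : (forall z, lattice Y (z *m A)) -> A = 0.
Proof.
move=> YA; have [e e0 eL] := lattice_separated Y.
apply/row_matrixP => i; rewrite row0 rowE; move: (delta_mx _ _) => z.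
have [N Nz] : exists N : nat, vnorm (z *m A) / N.+1%:R < e.
  exists (Num.trunc (vnorm (z *m A) / e)).
  by rewrite ltr_pdivrMr ?ltr0n // mulrC -ltr_pdivrMr // truncnS_gt.
have := eL (((N.+1%:R^-1 : R)%:C : Cplx R) *: z *m A) (YA _).
rewrite -scalemxAl vnormZ normc_real ger0_norm ?invr_ge0 // mulrC => /(_ Nz)/eqP.
rewrite scaler_eq0 => /orP[/eqP/(@complexI R _ 0)/eqP|/eqP //].
by rewrite invr_eq0 pnatr_eq0.
Qed.

Lemma biholomorphic_affine X Y (f : torus_points X -> torus_points Y) :
  biholomorphic f -> exists A b, [/\ A \in unitmx,
  forall z, lattice X z <-> lattice Y (z *m A) &
  forall z, f (torus_proj X z) = torus_proj Y (z *m A + b)].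
Proof.
move=> [g [fgK gfK hf hg]].
have [A [b fE]] := holomorphic_affine hf; have [B [c gE]] := holomorphic_affine hg.
(* Since [g] inverts [f], the affine map u (A B - 1) + const takes all its values in the lattice;
   subtracting its value at 0 leaves a linear map with lattice values. *)
have AB : A *m B = 1%:M.
  apply/eqP; rewrite -subr_eq0; apply/eqP; apply: (@small_linear_eq0 X) => z.
  have E u : lattice X (u *m (A *m B - 1%:M) + (b *m B + c)).
    have -> : u *m (A *m B - 1%:M) + (b *m B + c) = (u *m A + b) *m B + c - u.
      by rewrite mulmxBr mulmx1 mulmxDl mulmxA addrAC addrA.
    by apply/torus_proj_eq; rewrite -gE -fE fgK.
  have := (lattice_subgroup X).2 _ _ (E z) (E 0).
  by rewrite mul0mx add0r addrK.
have [uA _] := mulmx1_unit AB.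
exists A, b; split=> // z; split=> [Xz|Yz].
  have /(congr1 f) : torus_proj X z = torus_proj X 0 by apply/torus_proj_eq; rewrite subr0.
  by rewrite !fE mul0mx add0r => /torus_proj_eq; rewrite addrK.
have /(congr1 g) : torus_proj Y (z *m A) = torus_proj Y 0 by apply/torus_proj_eq; rewrite subr0.
by rewrite !gE mul0mx add0r => /torus_proj_eq; rewrite addrK -mulmxA AB mulmx1.
Qed.

Lemma isomorphicP X Y : isomorphic X Y <-> exists2 A, A \in unitmx &
  forall z, lattice X z <-> lattice Y (z *m A).
Proof.
split=> [[f /biholomorphic_affine[A [b [uA XY _]]]]|[A uA XY]]; first by exists A.
exact: linear_isomorphic uA XY.
Qed.

Lemma isomorphic_sym X Y : isomorphic X Y -> isomorphic Y X.
Proof.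
move=> /isomorphicP[A uA XY]; apply/isomorphicP; exists (invmx A).
  by rewrite unitmx_inv.
by move=> z; rewrite XY mulmxKV.
Qed.

Lemma isomorphic_trans X Y Z : isomorphic X Y -> isomorphic Y Z -> isomorphic X Z.
Proof.
move=> /isomorphicP[A uA XY] /isomorphicP[B uB YZ]; apply/isomorphicP.
by exists (A *m B) => [|z]; [rewrite unitmx_mul uA|rewrite XY YZ mulmxA].
Qed.

Lemma isomorphism_class_eq X Y : isomorphic X Y ->
  isomorphism_class X = isomorphism_class Y.
Proof.
move=> XY; apply/seteqP; split=> Z /=; last exact: isomorphic_trans.
by apply: isomorphic_trans; exact: isomorphic_sym.
Qed.

End Isomorphisms.

(** * Topological entropy *)

Lemma card_setT_finType (I : finType) : ([set: I] #= `I_#|I|)%card.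
Proof.
rewrite (card_eqr card_II) card_eq_sym.
have -> : [set: 'I_#|I|] = enum_rank @` [set: I].
  by apply/seteqP; split=> // i _; exists (enum_val i) => //; exact: enum_valK.
by apply: inj_card_eq => i j _ _; exact: enum_rank_inj.
Qed.

Section CoverEntropy.
Context (R : realType) (T : topologicalType).
Implicit Types (U V : set (set T)) (f : T -> T).

Lemma cover_number_le U (I : finType) (W : I -> set T) :
  (forall i, U (W i)) -> \bigcup_i W i = setT -> (cover_number R U <= #|I|%:R%:E)%E.
Proof.
move=> UW Wcov; have [m mW] : finite_set (range W).
  by apply: finite_image; exact: finite_finset.
have mI : (m <= #|I|)%N.
  rewrite -card_le_II -(card_le_eqr (card_setT_finType I)).
  by rewrite -(card_le_eql mW) card_image_le.
apply: (@le_trans _ _ m%:R%:E); last by rewrite lee_fin ler_nat.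
apply: ereal_inf_lbound; exists m => //; exists (range W); split=> //.
- by move=> _ [i _ <-].
- by rewrite bigcup_image.
Qed.

(** Any subcover must spend a different member on each of the points [p i]. *)
Lemma cover_number_ge U (I : finType) (p : I -> T) :
  (forall A, U A -> forall i j, A (p i) -> A (p j) -> i = j) ->
  (#|I|%:R%:E <= cover_number R U)%E.
Proof.
move=> Usep; apply/ereal_infP => _ [m [V [VU Vm Vcov]] <-].
rewrite lee_fin ler_nat -card_le_II.
have /choice[c cP] : forall i, exists A, V A /\ A (p i).
  move=> i; have : (\bigcup_(A in V) A) (p i) by rewrite Vcov.
  by move=> [A VA Ai]; exists A.
have cinj : {in [set: I] &, injective c}.
  move=> i j _ _ cij; apply: (Usep (c i)); first exact/VU/(cP i).1.
    exact: (cP i).2.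
  by rewrite cij; exact: (cP j).2.
rewrite -(card_le_eqr Vm) -(card_le_eql (card_setT_finType I)).
rewrite -(card_le_eql (inj_card_eq cinj)); apply: subset_card_le.
by move=> _ [i _ <-]; exact: (cP i).1.
Qed.


Lemma big_cover_join_sub (I : eqType) (r : seq I) (G : I -> set (set T)) W :
  (\big[@cover_join T/[set setT]]_(i <- r) G i) W ->
  forall i, i \in r -> exists2 A, G i A & W `<=` A.
Proof.
elim: r W => [//|j r IH] W; rewrite big_cons => -[A GA [B rB <-]] i.
rewrite inE => /predU1P[->|ir]; first by exists A => //; exact: subIsetl.
by have [C GC BC] := IH _ rB _ ir; exists C => // x [_ /BC].
Qed.

Lemma big_cover_join_sup (I : eqType) (r : seq I) (G : I -> set (set T)) (A : I -> set T) :
  (forall i, G i (A i)) -> exists2 W, (\big[@cover_join T/[set setT]]_(i <- r) G i) W &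
  forall x, (forall i, i \in r -> A i x) -> W x.
Proof.
move=> GA; elim: r => [|j r [W rW WA]]; first by rewrite big_nil; exists setT.
rewrite big_cons; exists (A j `&` W); first by exists (A j) => //; exists W.
move=> x Ax; split; first by apply: Ax; exact: mem_head.
by apply: WA => i ir; apply: Ax; rewrite inE ir orbT.
Qed.

(** With [iterated_cover_sup] this replaces the iterated join by itineraries: which member of [U]
    contains each of the first [n] iterates. *)
Lemma iterated_cover_sub f U n W : iterated_cover f U n W ->
  forall i, (i < n)%N -> exists2 A, U A & forall x, W x -> A (iter i f x).
Proof.
move=> /big_cover_join_sub UW i ni.
by have [|_ [A UA <-] WA] := UW (Ordinal ni); [exact: mem_index_enum|exists A].
Qed.

Lemma iterated_cover_sup f U n (A : nat -> set T) : (forall i, U (A i)) ->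
  exists2 W, iterated_cover f U n W &
  forall x, (forall i, (i < n)%N -> A i (iter i f x)) -> W x.
Proof.
move=> UA; have [|W nW WA] := @big_cover_join_sup _ (index_enum 'I_n)
    (fun i : 'I_n => [set iter i f @^-1` B | B in U]) (fun i => iter i f @^-1` A i).
  by move=> i; exists (A i).
by exists W => // x Ax; apply: WA => i _; exact: Ax.
Qed.

Lemma limn_esup_le_near (u : (\bar R)^nat) (l : R) :
  (forall e, 0 < e -> \forall n \near \oo, (u n <= (l + e)%:E)%E) -> (limn_esup u <= l%:E)%E.
Proof.
move=> ul; apply/lee_addgt0Pr => e e0; apply: ge_ereal_inf.
exists (ereal_sup (u @` [set n | (u n <= (l + e)%:E)%E])).
  by exists [set n | (u n <= (l + e)%:E)%E] => //; exact: ul.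
by apply/ereal_supP => _ [n nl <-].
Qed.

Lemma limn_esup_ge_near (u : (\bar R)^nat) (l : R) :
  (forall e, 0 < e -> \forall n \near \oo, ((l - e)%:E <= u n)%E) -> (l%:E <= limn_esup u)%E.
Proof.
move=> ul; apply/ereal_infP => _ [V Voo <-].
apply/lee_subgt0Pr => e e0; rewrite -EFinB.
have [n [Vn le_n]] : exists n, V n /\ ((l - e)%:E <= u n)%E.
  by near \oo => n; exists n; split; near: n => //; exact: ul.
by apply: le_trans le_n _; apply: ereal_sup_ubound; exists n.
Unshelve. all: by end_near. Qed.

(** The constant of an exponential bound disappears after division by n. Positivity of n is carried
    along because the inverse of 0 is 0 by convention. *)
Lemma near_ln_div (Q e : R) : 0 < e -> \forall n \near \oo, (0 < n)%N /\ `|ln Q / n%:R| <= e.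
Proof.
move=> e0; exists (Num.trunc (`|ln Q| / e)).+1 => // n /= ln.
have n0 : (0 < n)%N by apply: leq_trans ln.
split=> //; rewrite normrM normfV normr_nat ler_pdivrMr ?ltr0n // mulrC -ler_pdivrMr //.
by apply/ltW; apply: lt_le_trans (truncnS_gt _) _; rewrite ler_nat.
Qed.

Lemma cover_number_ge0 U : (0 <= cover_number R U)%E.
Proof. by apply/ereal_infP => _ [n _ <-]; rewrite lee_fin. Qed.

Lemma cover_entropy_le f U (Q r : R) : 0 < Q -> 0 < r ->
  (forall n, (cover_number R (iterated_cover f U n) <= (Q * r ^+ n)%:E)%E) ->
  (cover_entropy R f U <= (ln r)%:E)%E.
Proof.
move=> Q0 r0 NQ; apply: limn_esup_le_near => e e0.
apply: filterS (near_ln_div Q e0) => n [n0 Qn].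
have n0' : 0 < n%:R :> R by rewrite ltr0n.
have Qr0 : 0 < Q * r ^+ n by rewrite mulr_gt0 // exprn_gt0.
apply: (@le_trans _ _ ((ln (Q * r ^+ n))%:E * (n%:R^-1)%:E)%E).
  apply: lee_wpmul2r; first by rewrite lee_fin invr_ge0 ltW.
  rewrite -(lne_EFin Qr0) lee_lne ?in_itv /= ?cover_number_ge0 ?leey //.
  by rewrite lee_fin ltW.
rewrite -EFinM lee_fin lnM ?posrE ?exprn_gt0 // lnXn // mulrDl addrC.
rewrite -(mulr_natr (ln r)) mulfK ?gt_eqF // lerD2l.
by apply: le_trans Qn; exact: ler_norm.
Qed.

Lemma cover_entropy_ge f U (Q r : R) : 0 < Q -> 0 < r ->
  (forall n, (0 < n)%N -> ((Q * r ^+ n)%:E <= cover_number R (iterated_cover f U n))%E) ->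
  ((ln r)%:E <= cover_entropy R f U)%E.
Proof.
move=> Q0 r0 NQ; apply: limn_esup_ge_near => e e0.
apply: filterS (near_ln_div Q e0) => n [n0 Qn].
have n0' : 0 < n%:R :> R by rewrite ltr0n.
have Qr0 : 0 < Q * r ^+ n by rewrite mulr_gt0 // exprn_gt0.
apply: (@le_trans _ _ ((ln (Q * r ^+ n))%:E * (n%:R^-1)%:E)%E); last first.
  apply: lee_wpmul2r; first by rewrite lee_fin invr_ge0 ltW.
  rewrite -(lne_EFin Qr0) lee_lne ?in_itv /= ?cover_number_ge0 ?leey ?NQ //.
  by rewrite lee_fin ltW.
rewrite -EFinM lee_fin lnM ?posrE ?exprn_gt0 // lnXn // mulrDl addrC.
rewrite -(mulr_natr (ln r)) mulfK ?gt_eqF // lerD2r.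
by rewrite lerNl; apply: le_trans Qn; rewrite -normrN ler_norm.
Qed.

End CoverEntropy.

(** * Entropy bounds for affine maps of a torus *)

Section AffineEntropy.
Context (R : realType) (X : torus2 R) (f : torus_points X -> torus_points X)
  (A : 'M[Cplx R]_2) (b : C2 R).
Hypothesis fE : forall z, f (torus_proj X z) = torus_proj X (z *m A + b).

Let F z := z *m A + b.
Let lin i (h : C2 R) := iter i (mulmx^~ A) h.

Let iter_fE i z : iter i f (torus_proj X z) = torus_proj X (iter i F z).
Proof. by elim: i => //= i ->; rewrite fE. Qed.

Let iter_FD i z h : iter i F (z + h) = iter i F z + lin i h.
Proof. by elim: i => //= i ->; rewrite /F mulmxDl addrAC. Qed.

Let iter_FB i z w : iter i F z - iter i F w = lin i (z - w).
Proof. by rewrite -[z in LHS](subrK w) addrC addrC [z - w + w]addrC iter_FD addrAC subrr add0r. Qed.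

Lemma real_grid (C s : R) : 0 < s -> 0 < C -> exists (N : nat) (G : 'I_N -> R),
  N%:R <= 2 * C / s + 1 /\ forall t, `|t| <= C -> exists i, `|t - G i| <= s.
Proof.
move=> s0 C0; have q0 : 0 <= 2 * C / s by rewrite divr_ge0 ?mulr_ge0 // ltW.
exists (Num.trunc (2 * C / s)).+1, (fun i => - C + i%:R * s); split.
  by rewrite -[(Num.trunc _).+1%:R]natr1 lerD2r; have /andP[] := truncn_itv q0.
move=> t; rewrite ler_norml => /andP[t1 t2].
have p0 : 0 <= (t + C) / s by apply: divr_ge0; [lra|exact: ltW].
have lt_i : (Num.trunc ((t + C) / s) < (Num.trunc (2 * C / s)).+1)%N.
  by rewrite ltnS; apply: le_truncn; rewrite ler_pM2r ?invr_gt0 //; lra.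
exists (Ordinal lt_i) => /=; have /andP[] := truncn_itv p0.
rewrite ler_pdivlMr // ltr_pdivrMr // -[(Num.trunc _).+1%:R]natr1.
rewrite [(_ + 1) * s]mulrDl mul1r => u1 u2.
by rewrite ler_norml; lra.
Qed.

(** A grid of mesh proportional to [r1 ^- n] and [r2 ^- n] along [v1] and [v2] follows every orbit
    up to time [n]. The exponent 2 appears because each complex coordinate needs a grid for its real
    and one for its imaginary part. *)
Lemma entropy_le (v1 v2 : C2 R) (C M r1 r2 : R) : 0 < C -> 0 < M -> 1 <= r1 -> 1 <= r2 ->
  (forall z, exists x1 x2 : Cplx R, [/\ z = x1 *: v1 + x2 *: v2,
     normc x1 <= C * vnorm z & normc x2 <= C * vnorm z]) ->
  (forall n i (x1 x2 : Cplx R), (i <= n)%N ->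
     vnorm (iter i (mulmx^~ A) (x1 *: v1 + x2 *: v2)) <=
     M * (normc x1 * r1 ^+ n + normc x2 * r2 ^+ n)) ->
  (topological_entropy R f <= (ln ((r1 * r2) ^+ 2))%:E)%E.
Proof.
move=> C0 M0 r1_ge1 r2_ge1 coord growth.
have r10 : 0 < r1 by lra.
have r20 : 0 < r2 by lra.
apply/ereal_supP => _ [U Ucov <-].
have [d d0 dP] := lebesgue_number Ucov.
have [K K0 KP] := lattice_cobounded X.
pose C1 := C * K; have C10 : 0 < C1 by rewrite mulr_gt0.
(* Each complex coordinate is off by at most [2 * c0 / r ^+ n], so the orbits stay within
   [4 * M * c0 = d / 2]. *)
pose c0 := d / (8 * M); have c00 : 0 < c0 by rewrite divr_gt0 // mulr_gt0.
(* A grid in one real direction has at most [2 * C1 * r ^+ n / c0 + 1] points, which is at most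
   [q * r ^+ n] since [r >= 1]. *)
pose q := 2 * C1 / c0 + 1.
have q1 : 1 <= q by rewrite lerDr; apply: divr_ge0; [apply: mulr_ge0 => //|]; exact: ltW.
have q0 : 0 < q by lra.
apply: (@cover_entropy_le _ _ _ _ (q ^+ 4)); rewrite ?exprn_gt0 ?mulr_gt0 // => n.
have rn0 (r : R) : 0 < r -> 0 < r ^+ n by move=> r0; rewrite exprn_gt0.
have s0 (r : R) : 0 < r -> 0 < c0 / r ^+ n by move=> r0; rewrite divr_gt0 // rn0.
have [N1 [G1 [N1le G1P]]] := real_grid (s0 _ r10) C10.
have [N2 [G2 [N2le G2P]]] := real_grid (s0 _ r20) C10.
pose I := (('I_N1 * 'I_N1) * ('I_N2 * 'I_N2))%type.
pose node (p : I) : C2 R := ((G1 p.1.1 +i* G1 p.1.2 : R[i]) : Cplx R) *: v1 +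
  ((G2 p.2.1 +i* G2 p.2.2 : R[i]) : Cplx R) *: v2.
have /choice[W WP] : forall p : I, exists W, iterated_cover f U n W /\
    forall h, (forall i, (i < n)%N -> vnorm (lin i h) < d) -> W (torus_proj X (node p + h)).
  move=> p; have /choice[B BP] : forall i, exists B, U B /\
      forall h, vnorm h < d -> B (torus_proj X (iter i F (node p) + h)).
    by move=> i; have [B UB Bh] := dP (iter i F (node p)); exists B.
  have [W UW WB] := @iterated_cover_sup _ f U n B (fun i => (BP i).1).
  exists W; split=> // h hd; apply: WB => i ni; rewrite iter_fE iter_FD.
  by apply: (BP i).2; exact: hd.
apply: (@le_trans _ _ (#|{: I}|%:R%:E)%E).
  apply: (@cover_number_le _ _ _ _ W); first by move=> p; exact: (WP p).1.
  apply/seteqP; split=> // x _; have [z' <-] := torus_proj_surj x.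
  have [l Xl zK] := KP z'.
  have -> : torus_proj X z' = torus_proj X (z' - l).
    by apply/torus_proj_eq; rewrite opprB addrC subrK.
  move: (z' - l) zK => z zK.
  have [x1 [x2 [zE x1C x2C]]] := coord z.
  have {}x1C : normc x1 <= C1 by apply: le_trans x1C _; rewrite ler_pM2l.
  have {}x2C : normc x2 <= C1 by apply: le_trans x2C _; rewrite ler_pM2l.
  have [i1 Hi1] := G1P _ (le_trans (ler_normcRe x1) x1C).
  have [j1 Hj1] := G1P _ (le_trans (ler_normcIm x1) x1C).
  have [i2 Hi2] := G2P _ (le_trans (ler_normcRe x2) x2C).
  have [j2 Hj2] := G2P _ (le_trans (ler_normcIm x2) x2C).
  pose p : I := ((i1, j1), (i2, j2)); exists p => //.
  have -> : z = node p + (z - node p) by rewrite addrC subrK.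
  apply: (WP p).2 => i ni.
  have -> : z - node p = ((x1 : R[i]) - (G1 i1 +i* G1 j1) : Cplx R) *: v1 +
                         ((x2 : R[i]) - (G2 i2 +i* G2 j2) : Cplx R) *: v2.
    by rewrite zE /node /= opprD addrACA -!scalerBl.
  apply: le_lt_trans (growth n i _ _ (ltnW ni)) _.
  have small (r u w : R) (k : R[i]) : 0 < r -> `|complex.Re k - u| <= c0 / r ^+ n ->
      `|complex.Im k - w| <= c0 / r ^+ n -> normc (k - (u +i* w)) * r ^+ n <= c0 + c0.
    move=> r0 xu xw; rewrite -ler_pdivlMr ?rn0 // mulrDl.
    apply: le_trans (normc_le_ReIm _) _.
    by case: k xu xw => a1 a2 /= xu xw; exact: lerD.
  have b1 := small r1 _ _ x1 r10 Hi1 Hj1.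
  have b2 := small r2 _ _ x2 r20 Hi2 Hj2.
  apply: (@le_lt_trans _ _ (M * (c0 + c0 + (c0 + c0)))).
    by apply: ler_wpM2l; [exact: ltW|exact: lerD].
  have -> : M * (c0 + c0 + (c0 + c0)) = d / 2 by rewrite /c0; field; rewrite gt_eqF.
  lra.
rewrite lee_fin !card_prod !card_ord !natrM.
have le_q (r N : R) : 1 <= r -> N <= 2 * C1 / (c0 / r ^+ n) + 1 -> N <= q * r ^+ n.
  move=> r1' NC; apply: le_trans NC _; rewrite /q [(_ + 1) * _]mulrDl mul1r.
  by rewrite invf_div mulrA mulrAC lerD2l exprn_ege1.
have n1 := le_q _ _ r1_ge1 N1le; have n2 := le_q _ _ r2_ge1 N2le.
have -> : q ^+ 4 * ((r1 * r2) ^+ 2) ^+ n =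
    ((q * r1 ^+ n) * (q * r1 ^+ n)) * ((q * r2 ^+ n) * (q * r2 ^+ n)).
  by rewrite -exprM mulnC exprM exprMn; ring.
by apply: ler_pM; rewrite ?mulr_ge0 //; apply: ler_pM.
Qed.

(** About [normc a ^+ (2 * n)] grid points in a small disc of the complex eigenline, a real plane,
    have pairwise different itineraries: differences along the line are stretched by exactly
    [normc a] at each step. *)
Lemma entropy_ge (v : C2 R) (a : Cplx R) : v != 0 -> v *m A = a *: v -> 1 < normc a ->
  ((ln (normc a ^+ 2))%:E <= topological_entropy R f)%E.
Proof.
move=> v0 vA a1; set rho := normc a in a1 *.
have rho0 : 0 < rho by lra.
have [e e0 eL] := lattice_separated X.
have [K K0 KA] := vnorm_mulmx A.
(* Two vectors below [2 * eps] and [K * (2 * eps)] that differ by a lattice vector are equal, as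
   [(K + 1) * (2 * eps) = e / 2 < e]. *)
pose eps := e / (4 * (K + 1)).
have K1 : 0 < 4 * (K + 1) by lra.
have eps0 : 0 < eps by rewrite divr_gt0.
have epsE : (K + 1) * (eps + eps) < e.
  have -> : (K + 1) * (eps + eps) = e / 2 by rewrite /eps; field; apply: lt0r_neq0; lra.
  lra.
pose U := [set torus_proj X @` [set z | vnorm (z - w) < eps] | w in setT].
have Ucov : open_cover U.
  split=> [_ [w _ <-]|]; first by apply: torus_proj_open; exact: ball_open.
  apply/seteqP; split=> // p _; have [w <-] := torus_proj_surj p.
  eexists; first by exists w.
  by exists w => //=; rewrite subrr vnorm0.
apply: (@le_trans _ _ (cover_entropy R f U)); last first.
  by apply: ereal_sup_ubound; exists U.
have vn0 : 0 < vnorm v by rewrite vnorm_gt0.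
apply: (@cover_entropy_ge _ _ _ _ ((4 * rho)^-1 ^+ 2)); rewrite ?exprn_gt0 ?invr_gt0 ?mulr_gt0 //.
move=> n n0.
(* The grid has more than [y] points in each direction, and index differences of modulus at most
   [2 * y]; with the mesh [s * vnorm v], initial differences are at most [eps]. *)
pose y := rho ^+ n / (4 * rho); pose N := (Num.trunc y).+1.
have y0 : 0 <= y by rewrite divr_ge0 ?exprn_ge0 ?mulr_ge0 // ltW.
(* Chosen so that neighbouring grid points are exactly [2 * eps] apart at time [n - 1]. *)
pose s := 2 * eps * rho / (rho ^+ n * vnorm v).
have rn0 : 0 < rho ^+ n by rewrite exprn_gt0.
have num0 : 0 < 2 * eps * rho by apply: mulr_gt0 => //; exact: mulr_gt0.
have den0 : 0 < rho ^+ n * vnorm v by exact: mulr_gt0.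
have s0 : 0 < s by exact: divr_gt0.
pose pt (p : 'I_N * 'I_N) : C2 R := (((s * p.1%:R) +i* (s * p.2%:R) : R[i]) : Cplx R) *: v.
apply: (@le_trans _ _ (#|{: 'I_N * 'I_N}|%:R%:E)%E).
  rewrite lee_fin card_prod card_ord natrM -exprM mulnC exprM -exprMn mulrC -/y expr2.
  by apply: ler_pM => //; exact/ltW/truncnS_gt.
apply: (@cover_number_ge _ _ _ _ (fun p => torus_proj X (pt p))) => W UW p p' Wp Wp'.
apply/eqP; apply: contrapT => /negP pp'.
have ptB : pt p - pt p' =
    (((s%:C : R[i]) * ((p.1%:R - p'.1%:R) +i* (p.2%:R - p'.2%:R)) : R[i]) : Cplx R) *: v.
  rewrite /pt -scalerBl; congr (_ *: _); apply/eqP; rewrite eq_complex /=.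
  by apply/andP; split; apply/eqP; ring.
pose D : R[i] := (p.1%:R - p'.1%:R) +i* (p.2%:R - p'.2%:R).
have D1 : 1 <= normc D.
  have int_ge1 (i j : 'I_N) : i != j -> 1 <= `|i%:R - j%:R : R|.
    move=> ij; have -> : (i%:R - j%:R : R) = ((i%:Z - j%:Z)%:~R) by rewrite rmorphB.
    rewrite -intr_norm -[1](mulr1z 1) ler_int.
    by rewrite -gtz0_ge1 normr_gt0 subr_eq0 eqz_nat.
  have /orP[h|h] : (p.1 != p'.1) || (p.2 != p'.2).
    by rewrite -negb_and; apply: contra pp' => /andP[/eqP h1 /eqP h2];
      rewrite [p]surjective_pairing [p']surjective_pairing h1 h2.
  - exact: le_trans (int_ge1 _ _ h) (ler_normcRe D).
  - exact: le_trans (int_ge1 _ _ h) (ler_normcIm D).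
have D2 : normc D <= 2 * y.
  have le_y (i j : 'I_N) : `|i%:R - j%:R : R| <= y.
    have iy (k : 'I_N) : (k%:R : R) <= y.
      have /andP[ty _] := truncn_itv y0; apply: le_trans ty.
      by rewrite ler_nat -ltnS.
    have := iy i; have := iy j; have := ler0n R i; have := ler0n R j.
    by move=> *; rewrite ler_norml; lra.
  apply: le_trans (normc_le_ReIm D) _; rewrite mulrDl mul1r.
  by apply: lerD; exact: le_y.
have linE i : lin i (pt p - pt p') = a ^+ i *: (pt p - pt p').
  elim: i => [|i IH]; first by rewrite expr0 scale1r.
  rewrite /lin iterS -/(lin i _) IH -scalemxAl ptB -scalemxAl vA !scalerA; congr (_ *: v).
  by rewrite exprSr; ring.
have norm_lin i : vnorm (lin i (pt p - pt p')) = rho ^+ i * (s * normc D * vnorm v).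
  rewrite linE vnormZ normcX ptB vnormZ normcM normc_real (gtr0_norm s0) //.
have svE : s * vnorm v = 2 * eps * rho / rho ^+ n.
  by rewrite /s; field; rewrite !gt_eqF.
(* A common itinerary gives closeness only modulo the lattice. By induction on time the lattice
   vector is 0: the difference starts below [eps] and one step multiplies it by at most [K]. *)
have small i : (i < n)%N -> vnorm (lin i (pt p - pt p')) < eps + eps.
  have common j : (j < n)%N -> exists2 l, lattice X l &
      vnorm (lin j (pt p - pt p') - l) < eps + eps.
    move=> jn; have [_ [w _ <-] Ww] := iterated_cover_sub UW jn.
    move: (Ww _ Wp) (Ww _ Wp'); rewrite !iter_fE -iter_FB.
    move: (iter j F (pt p)) (iter j F (pt p')) => x x'.
    move=> [u uw /torus_proj_eq ul] [u' u'w /torus_proj_eq u'l].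
    exists ((u' - x') - (u - x)); first exact: (lattice_subgroup X).2 u'l ul.
    have -> : x - x' - (u' - x' - (u - x)) = (u - w) - (u' - w).
      by apply/rowP => k; rewrite !mxE; ring.
    by apply: le_lt_trans (vnormB _ _) _; exact: ltrD.
  have zero_lattice l j : lattice X l -> vnorm (lin j (pt p - pt p') - l) < eps + eps ->
      vnorm (lin j (pt p - pt p')) <= K * (eps + eps) -> l = 0.
    move=> Xl ll lK; apply: eL => //; apply: le_lt_trans epsE.
    have -> : l = lin j (pt p - pt p') - (lin j (pt p - pt p') - l) by rewrite opprB addrC subrK.
    by apply: le_trans (vnormB _ _) _; lra.
  elim: i => [|i IH] iN.
    rewrite norm_lin expr0 mul1r mulrAC svE.
    apply: (@le_lt_trans _ _ (2 * eps * rho / rho ^+ n * (2 * y))).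
      by apply: ler_wpM2l => //; apply/ltW; exact: divr_gt0.
    have -> : 2 * eps * rho / rho ^+ n * (2 * y) = eps by rewrite /y; field; rewrite !gt_eqF.
    lra.
  have linS : vnorm (lin i.+1 (pt p - pt p')) <= K * (eps + eps).
    rewrite /lin iterS; apply: le_trans (KA _) _; rewrite ler_pM2l //.
    exact/ltW/IH/ltnW.
  have [l Xl ll] := common _ iN.
  by move: (ll); rewrite (zero_lattice _ _ Xl ll linS) subr0.
have nE : rho ^+ n = rho ^+ n.-1 * rho by rewrite -exprSr prednK.
have := small n.-1; rewrite prednK // leqnn => /(_ isT).
rewrite norm_lin mulrAC svE => lt2.
have : rho ^+ n.-1 * (2 * eps * rho / rho ^+ n * 1) <=
    rho ^+ n.-1 * (2 * eps * rho / rho ^+ n * normc D).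
  by rewrite !ler_pM2l ?exprn_gt0 // divr_gt0.
have -> : rho ^+ n.-1 * (2 * eps * rho / rho ^+ n * 1) = eps + eps.
  by rewrite nE; field; rewrite !gt_eqF ?exprn_gt0.
by move: lt2; lra.
Qed.


End AffineEntropy.

(** * Eigenvalues *)

Section FullLattices.
Context (R : realType).
Implicit Types (L : set (C2 R)) (b : 'I_4 -> C2 R) (A g : 'M[Cplx R]_2).

(** What is used of a lattice, in a form that linear changes of coordinates preserve without the
    construction of a new torus. *)
Definition full_lattice L b := [/\
  forall l, L l <-> exists c : 'I_4 -> int, l = \sum_i b i *~ c i,
  forall t, real_comb b t = 0 -> forall i, t i = 0,
  forall v, exists t, v = real_comb b t &
  separated L].

Lemma torus_full_lattice (X : torus2 R) : exists b, full_lattice (lattice X) b.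
Proof.
by have [b [? ? ?]] := lattice_basis X; exists b; split=> //; exact: lattice_separated.
Qed.

Lemma full_lattice_subgroup L b : full_lattice L b -> subgroup L.
Proof.
move=> [bL _ _ _]; split.
  by apply/bL; exists (fun=> 0); rewrite big1 // => i _; rewrite mulr0z.
move=> x y /bL[c ->] /bL[d ->]; apply/bL; exists (fun i => c i - d i).
by rewrite -sumrB; apply: eq_bigr => i _; rewrite mulrzBr.
Qed.

Lemma full_lattice_map L b g : g \in unitmx -> full_lattice L b ->
  full_lattice [set z | L (z *m invmx g)] (fun i => b i *m g).
Proof.
move=> ug [bL bfree bspan [e e0 eL]].
have combE t : real_comb (fun i => b i *m g) t = real_comb b t *m g.
  by rewrite /real_comb mulmx_suml; apply: eq_bigr => i _; rewrite scalemxAl.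
have icombE (c : 'I_4 -> int) : \sum_i b i *m g *~ c i = (\sum_i b i *~ c i) *m g.
  by rewrite mulmx_suml; apply: eq_bigr => i _; exact/esym/(raddfMz (mulmxr g)).
split.
- move=> l /=; rewrite bL; split=> -[c cE]; exists c.
    by rewrite icombE -cE mulmxKV.
  by rewrite cE icombE mulmxK.
- move=> t; rewrite combE => /(congr1 (mulmx^~ (invmx g))).
  by rewrite mulmxK // mul0mx; exact: bfree.
- move=> v; have [t vt] := bspan (v *m invmx g); exists t.
  by rewrite combE -vt mulmxKV.
- have [K K0 KP] := vnorm_mulmx (invmx g).
  exists (e / K) => [|l Ll]; first exact: divr_gt0.
  rewrite ltr_pdivlMr // mulrC => lK.
  have /(congr1 (mulmx^~ g)) := eL _ Ll (le_lt_trans (KP l) lK).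
  by rewrite mulmxKV // mul0mx.
Qed.

Lemma lattice_int_matrix L b A : full_lattice L b -> (forall z, L z -> L (z *m A)) ->
  exists M : 'M[int]_4, forall i, b i *m A = \sum_j b j *~ M i j.
Proof.
move=> fL LA; have [bL _ _ _] := fL.
have /choice[c cP] : forall i, exists c : 'I_4 -> int, b i *m A = \sum_j b j *~ c j.
  move=> i; apply/bL/LA/bL; exists (fun j => (j == i)%:R).
  by rewrite (bigD1 i) //= eqxx mulr1z big1 ?addr0 // => j /negPf ->; rewrite mulr0z.
by exists (\matrix_(i, j) c i j) => i; rewrite cP; apply: eq_bigr => j _; rewrite mxE.
Qed.

(* [conj_block A] is the complexification of [A] as a real linear map; [conj_basis b]
   carries it to the matrix of [A] in the lattice basis [b]. *)
Definition conj_mx m n (A : 'M[R[i]]_(m, n)) : 'M[R[i]]_(m, n) := map_mx conjc A.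

Definition conj_ext (v : 'rV[R[i]]_2) : 'rV[R[i]]_(2 + 2) := row_mx v (conj_mx v).

Definition conj_basis b : 'M[R[i]]_(2 + 2) := \matrix_(i < 4) conj_ext (b i).

Definition conj_block (A : 'M[R[i]]_2) : 'M[R[i]]_(2 + 2) := block_mx A 0 0 (conj_mx A).

(** A vector [v] in the left kernel yields two relations between the [b i], with coefficients [v]
    and its conjugate; half their sum and ['i%C / 2] times their difference are real relations,
    hence trivial. *)
Lemma conj_basis_unit b : (forall t, real_comb b t = 0 -> forall i, t i = 0) ->
  conj_basis b \in unitmx.
Proof.
move=> bfree; rewrite -row_free_unit; apply: inj_row_free => v.
rewrite mulmx_sum_row => vB.
pose c (i : 'I_(2 + 2)) : 'rV[R[i]]_2 := b i.
have sum0 : \sum_(i < 2 + 2) v 0 i *: c i = 0.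
  have /(congr1 lsubmx) := vB; rewrite linear0 linear_sum /= => vBl; rewrite -[RHS]vBl.
  by apply: eq_bigr => i _; rewrite linearZ /= rowK /conj_ext row_mxKl.
have sum0' : \sum_(i < 2 + 2) (v 0 i)^* *: c i = 0.
  have /(congr1 (fun w => conj_mx (rsubmx w))) := vB.
  rewrite linear0 linear_sum /= /conj_mx map_mx_sum map_mx0 => vBr; rewrite -[RHS]vBr.
  apply: eq_bigr => i _; rewrite linearZ /= rowK /conj_ext row_mxKr map_mxZ.
  congr (_ *: _); apply/matrixP => j k; rewrite !mxE; exact/esym/conjcK.
have Re0 i : complex.Re (v 0 i) = 0.
  apply: (bfree (fun i => complex.Re (v 0 i))).
  have : \sum_(i < 2 + 2) (complex.Re (v 0 i))%:C *: c i = 0.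
    transitivity (2^-1 *: (\sum_(i < 2 + 2) v 0 i *: c i + \sum_(i < 2 + 2) (v 0 i)^* *: c i)).
      rewrite -big_split /= scaler_sumr; apply: eq_bigr => j _.
      by rewrite -scalerDl scalerA; congr (_ *: _); rewrite ReJ_add mulrC.
    by rewrite sum0 sum0' addr0 scaler0.
  exact.
have Im0 i : complex.Im (v 0 i) = 0.
  apply: (bfree (fun i => complex.Im (v 0 i))).
  have : \sum_(i < 2 + 2) (complex.Im (v 0 i))%:C *: c i = 0.
    transitivity (('i%C / 2) *: (\sum_(i < 2 + 2) (v 0 i)^* *: c i -
        \sum_(i < 2 + 2) v 0 i *: c i)).
      rewrite -sumrB scaler_sumr; apply: eq_bigr => j _.
      by rewrite -scalerBl scalerA; congr (_ *: _); rewrite ImJ_sub; ring.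
    by rewrite sum0 sum0' subr0 scaler0.
  exact.
apply/rowP => i; rewrite mxE; move: (Re0 i) (Im0 i).
by case: (v 0 i) => x y /= -> ->.
Qed.

Lemma conj_basis_intertwine b A (M : 'M[int]_4) :
  (forall i, b i *m A = \sum_j b j *~ M i j) ->
  conj_basis b *m conj_block A = map_mx intr M *m conj_basis b.
Proof.
move=> bA; apply/row_matrixP => i; rewrite !row_mul rowK.
have -> : conj_ext (b i) *m conj_block A = conj_ext (b i *m A).
  rewrite /conj_ext /conj_block mul_row_block !mulmx0 addr0 add0r.
  by rewrite /conj_mx map_mxM.
rewrite bA mulmx_sum_row.
have intz (v : 'rV[R[i]]_2) (n : int) : conj_ext (v *~ n) = n%:~R *: conj_ext v.
  rewrite /conj_ext /conj_mx -scaler_int map_mxZ rmorph_int scale_row_mx //.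
have sumE (I : finType) (F : I -> 'rV[R[i]]_2) : conj_ext (\sum_j F j) = \sum_j conj_ext (F j).
  elim/big_rec2 : _ => [|j x y _ <-].
    by rewrite /conj_ext /conj_mx map_mx0 row_mx0.
  by rewrite /conj_ext /conj_mx map_mxD add_row_mx.
transitivity (\sum_j conj_ext ((b j : 'rV[R[i]]_2) *~ M i j)); first exact: sumE.
by apply: eq_bigr => j _; rewrite intz rowK !mxE.
Qed.

End FullLattices.

(** * Determinants, norms and characteristic polynomials on a lattice *)

Section IntegralInvariants.
Context (R : realType).
Implicit Types (L : set (C2 R)) (b : 'I_4 -> C2 R) (A : 'M[R[i]]_2) (d : 'rV[R[i]]_2).
Local Notation toC := (map_poly (intr : int -> R[i])).

Lemma conj_block_similar b A (M : 'M[int]_4) :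
  (forall t, real_comb b t = 0 -> forall i, t i = 0) ->
  (forall i, b i *m (A : 'M[Cplx R]_2) = \sum_j b j *~ M i j) ->
  map_mx intr M = conj_basis b *m conj_block A *m invmx (conj_basis b).
Proof.
by move=> bfree /conj_basis_intertwine ->; rewrite mulmxK // conj_basis_unit.
Qed.

Lemma det_similar n (B D : 'M[R[i]]_n) : B \in unitmx -> \det (B *m D *m invmx B) = \det D.
Proof.
move=> uB; rewrite !det_mulmx mulrAC -det_mulmx mulmxV // det1 mul1r //.
Qed.

Lemma det_conj_block A : \det (conj_block A) = \det A * (\det A)^*.
Proof. by rewrite /conj_block det_ublock det_map_mx. Qed.

Lemma det_diag_row_mx (S : comNzRingType) (u v : 'rV[S]_2) : \det (diag_mx (row_mx u v)) =
  (u 0 ord0 * u 0 ord_max) * (v 0 ord0 * v 0 ord_max).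
Proof.
rewrite det_diag big_split_ord /= !big_ord_recl !big_ord0 !mulr1.
have -> : lift ord0 ord0 = ord_max :> 'I_2 by apply/val_inj.
by rewrite !row_mxEl !row_mxEr.
Qed.

Lemma det_diag_map_row_mx (S : comNzRingType) (h : S -> S) (u v : 'rV[S]_2) :
  \det (diag_mx (map_mx h (row_mx u v))) =
  (h (u 0 ord0) * h (u 0 ord_max)) * (h (v 0 ord0) * h (v 0 ord_max)).
Proof. by rewrite map_row_mx det_diag_row_mx !mxE. Qed.

Lemma lattice_normc_det L b A : full_lattice L b ->
  (forall z, L z -> L (z *m (A : 'M[Cplx R]_2))) ->
  exists m : nat, normc (\det A) ^+ 2 = m%:R.
Proof.
move=> fL LA; have [M MP] := lattice_int_matrix fL LA; have [_ bfree _ _] := fL.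
have detE : (\det M)%:~R = (normc (\det A) ^+ 2)%:C :> R[i].
  rewrite -(det_map_mx intr) (conj_block_similar bfree MP).
  by rewrite det_similar ?conj_basis_unit // det_conj_block mulc_conj.
exists `|\det M|%N.
have := congr1 (@complex.Re R) detE.
have -> : (\det M)%:~R = ((\det M)%:~R : R)%:C :> R[i] by rewrite rmorph_int.
move=> /= E; rewrite natr_absz ger0_norm; first by rewrite E.
by rewrite -(ler_int R) E exprn_ge0 // normc_ge0.
Qed.

(** The squared moduli of the determinants of [A] and of its inverse are natural numbers with
    product 1. *)
Lemma lattice_det_unit L b A : A \in unitmx -> full_lattice L b ->
  (forall z, L z <-> L (z *m (A : 'M[Cplx R]_2))) -> normc (\det A) = 1.
Proof.
move=> uA fL LA.
have [m mE] := lattice_normc_det fL (fun z => (LA z).1).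
have [m' m'E] : exists m : nat, normc (\det (invmx A)) ^+ 2 = m%:R.
  apply: (lattice_normc_det fL) => z Lz; apply/LA.
  by rewrite (mulmxKV (uA : (A : 'M[Cplx R]_2) \in unitmx)).
have detI : normc (\det A) * normc (\det (invmx A)) = 1.
  by rewrite -normcM -det_mulmx mulmxV // det1 normc1.
have : (m * m' == 1)%N.
  by rewrite -(eqr_nat R) natrM -mE -m'E -exprMn detI expr1n.
rewrite muln_eq1 => /andP[/eqP m1 _].
apply/eqP; rewrite -(@eqrXn2 _ 2) ?normc_ge0 ?ler01 //.
by rewrite mE m1 expr1n.
Qed.

Lemma conj_block_diag d : conj_block (diag_mx d) = diag_mx (row_mx d (conj_mx d)).
Proof. by rewrite diag_mx_row /conj_block /conj_mx map_diag_mx. Qed.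

(** The squared product is the determinant of the integer matrix of [q] applied to the action on the
    lattice. It later shows that a nonzero value is at least 1. *)
Lemma lattice_norm_int L b d (q : {poly int}) : full_lattice L b ->
  (forall z, L z -> L (z *m (diag_mx d : 'M[Cplx R]_2))) ->
  exists m : nat, (normc (toC q).[d 0 ord0] * normc (toC q).[d 0 ord_max]) ^+ 2 = m%:R.
Proof.
move=> fL LA; have [M MP] := lattice_int_matrix fL LA; have [_ bfree _ _] := fL.
have uB := conj_basis_unit bfree.
have ME := conj_block_similar bfree MP; rewrite conj_block_diag in ME.
have detE : (\det (horner_mx M q))%:~R =
    (((normc (toC q).[d 0 ord0] * normc (toC q).[d 0 ord_max]) ^+ 2 : R)%:C : R[i]).
  rewrite -(det_map_mx intr) map_horner_mx ME horner_mx_uconj //.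
  rewrite det_similar // horner_mx_diag det_diag_map_row_mx !mxE.
  have cE (x : R[i]) : (toC q).[x^*] = ((toC q).[x])^*.
    rewrite -horner_map -map_poly_comp; congr (_.[_]); apply: eq_map_poly => c /=.
    by rewrite rmorph_int.
  by rewrite !cE mulrACA !mulc_conj exprMn; exact/esym/(rmorphM (real_complex R)).
exists `|\det (horner_mx M q)|%N.
have := congr1 (@complex.Re R) detE.
have -> : (\det (horner_mx M q))%:~R = ((\det (horner_mx M q))%:~R : R)%:C :> R[i].
  by rewrite rmorph_int.
move=> /= E; rewrite natr_absz ger0_norm; first by rewrite E.
by rewrite -(ler_int R) E exprn_ge0 // mulr_ge0 ?normc_ge0.
Qed.

Definition conj_roots (a1 a2 : R[i]) : seq R[i] := [:: a1; a2; a1^*; a2^*].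

Lemma lattice_char_poly L b d : full_lattice L b ->
  (forall z, L z -> L (z *m (diag_mx d : 'M[Cplx R]_2))) ->
  exists P : {poly int}, toC P =
    \prod_(x <- conj_roots (d 0 ord0) (d 0 ord_max)) ('X - x%:P).
Proof.
move=> fL LA; have [M MP] := lattice_int_matrix fL LA; have [_ bfree _ _] := fL.
have uB := conj_basis_unit bfree.
have ME := conj_block_similar bfree MP; rewrite conj_block_diag in ME.
exists (char_poly M); rewrite map_char_poly ME /char_poly /char_poly_mx.
set D := diag_mx _; set B := conj_basis b.
have uBP : map_mx (polyC) B \in unitmx by rewrite map_unitmx.
have -> : 'X%:M - map_mx polyC (B *m D *m invmx B) =
    map_mx polyC B *m ('X%:M - map_mx polyC D) *m invmx (map_mx polyC B).
  by rewrite !map_mxM map_invmx mulmxBr mulmxBl scalar_mxC mulmxK.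
rewrite !det_mulmx mulrAC -det_mulmx mulmxV // det1 mul1r.
have -> : 'X%:M - map_mx polyC D = diag_mx (\row_i ('X - (row_mx d (conj_mx d) 0 i)%:P)).
  apply/matrixP => i j; rewrite !mxE; case: eqVneq => [->|_]; first by rewrite !mulr1n.
  by rewrite !mulr0n subr0.
have -> : \row_i ('X - (row_mx d (conj_mx d) 0 i)%:P) =
    row_mx (\row_i ('X - (d 0 i)%:P)) (\row_i ('X - ((d 0 i)^*)%:P)).
  by apply/rowP => i; rewrite !mxE; case: (fintype.split i) => j; rewrite !mxE.
rewrite det_diag_row_mx !mxE.
by rewrite /conj_roots !big_cons big_nil !mulr1 !mulrA.
Qed.

End IntegralInvariants.

(** * Eigenvalues determined by the entropy *)

Section EigenvaluesFromEntropy.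
Context (R : realType).
Implicit Types (v w : 'rV[R[i]]_2) (A : 'M[R[i]]_2).

Definition mx_of_rows v w : 'M[R[i]]_2 := \matrix_(i < 2) (if i == ord0 then v else w).

Lemma mul_mx_of_rows c v w : c *m mx_of_rows v w = c 0 ord0 *: v + c 0 ord_max *: w.
Proof.
rewrite mulmx_sum_row !big_ord_recl big_ord0 addr0 !rowK /=.
by have -> : lift ord0 ord0 = ord_max :> 'I_2 by apply/val_inj.
Qed.

Lemma det_mx_of_rows v w : \det (mx_of_rows v w) =
  v 0 ord0 * w 0 ord_max - v 0 ord_max * w 0 ord0.
Proof.
rewrite (expand_det_row _ ord0) !big_ord_recl big_ord0 addr0 /cofactor !det_mx11 !mxE /=.
rewrite ?mxE /= expr0 mul1r.
have -> : lift ord0 ord0 = ord_max :> 'I_2 by apply/val_inj.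
have -> : lift ord_max ord0 = ord0 :> 'I_2 by apply/val_inj.
by rewrite expr1 mulN1r mulrN.
Qed.

Lemma mx_of_rowsM v w A : mx_of_rows v w *m A = mx_of_rows (v *m A) (w *m A).
Proof. by apply/row_matrixP => i; rewrite row_mul !rowK; case: ifP. Qed.

Lemma eigenvector_exists A : exists a v, v != 0 /\ v *m A = a *: v.
Proof.
have /closed_rootP[a] : size (char_poly A) != 1%N by rewrite size_char_poly.
rewrite -eigenvalue_root_char => /eigenvalueP[v vA v0]; by exists a, v.
Qed.

(** The Hermitian orthogonal of [v]; the determinant with [v] is the sum of the squared moduli of
    its coordinates. *)
Definition row_complement v : 'rV[R[i]]_2 :=
  \row_j (if j == ord0 then - (v 0 ord_max)^* else (v 0 ord0)^*).

Lemma row_complement_unit v : v != 0 -> mx_of_rows v (row_complement v) \in unitmx.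
Proof.
move=> v0; rewrite unitmxE unitfE det_mx_of_rows !mxE /= mulrN opprK !mulc_conj.
rewrite -(rmorphD (real_complex R)) -(rmorph0 (real_complex R)) (inj_eq (@complexI R)).
rewrite gt_eqF //; have := vnorm_gt0 (v : C2 R); rewrite v0 /vnorm lt_max => /orP[h|h].
  by rewrite ltr_pwDl ?exprn_ge0 ?normc_ge0 // exprn_gt0.
by rewrite ltr_wpDl ?exprn_ge0 ?normc_ge0 // exprn_gt0.
Qed.

Lemma triangular_basis A : exists a c k v w, [/\ mx_of_rows v w \in unitmx,
  v *m A = a *: v, w *m A = k *: v + c *: w & \det A = a * c].
Proof.
have [a [v [v0 vA]]] := eigenvector_exists A.
have uG := row_complement_unit v0; move: (row_complement v) uG => w uG.
pose c := w *m A *m invmx (mx_of_rows v w).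
have wA : w *m A = c 0 ord0 *: v + c 0 ord_max *: w by rewrite -mul_mx_of_rows mulmxKV.
exists a, (c 0 ord_max), (c 0 ord0), v, w; split => //.
have G0 : \det (mx_of_rows v w) != 0 by move: uG; rewrite unitmxE unitfE.
apply: (mulfI G0); rewrite -det_mulmx mx_of_rowsM !det_mx_of_rows vA wA !mxE; ring.
Qed.

Lemma rows_coordinates v w : mx_of_rows v w \in unitmx -> exists2 K : R, 0 < K &
  forall z : C2 R, exists x1 x2 : Cplx R, [/\ z = x1 *: (v : C2 R) + x2 *: (w : C2 R),
     normc x1 <= K * vnorm z & normc x2 <= K * vnorm z].
Proof.
move=> uG; have [K K0 KP] := vnorm_mulmx (invmx (mx_of_rows v w) : 'M[Cplx R]_2).
exists K => // z; pose c : 'rV[R[i]]_2 := (z : 'rV[R[i]]_2) *m invmx (mx_of_rows v w).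
have zE : (z : 'rV[R[i]]_2) = c 0 ord0 *: v + c 0 ord_max *: w.
  by rewrite -mul_mx_of_rows mulmxKV.
exists (c 0 ord0), (c 0 ord_max); split; first exact: zE.
- by apply: le_trans (KP z); exact: (normc_le_vnorm (c : C2 R)).
- by apply: le_trans (KP z); exact: (normc_le_vnorm (c : C2 R)).
Qed.

Section Bounds.
Context (X : torus2 R) (f : torus_points X -> torus_points X) (A : 'M[Cplx R]_2) (u : C2 R).
Hypothesis fE : forall z, f (torus_proj X z) = torus_proj X (z *m A + u).

Lemma diagonal_entropy_le (v w : C2 R) (a c : Cplx R) : mx_of_rows v w \in unitmx ->
  v *m A = a *: v -> w *m A = c *: w -> 1 <= normc a -> normc c <= 1 ->
  (topological_entropy R f <= (ln (normc a ^+ 2))%:E)%E.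
Proof.
move=> uG vA wA a1 c1; have [K K0 KP] := rows_coordinates uG.
pose M := vnorm v + vnorm w + 1.
have M0 : 0 < M by rewrite /M ltr_wpDl // addr_ge0 ?vnorm_ge0.
rewrite -[normc a]mulr1; apply: (entropy_le fE K0 M0 a1 (lexx 1) KP) => n i x1 x2 le_in.
have -> : iter i (mulmx^~ A) (x1 *: v + x2 *: w) = (x1 * a ^+ i) *: v + (x2 * c ^+ i) *: w.
  elim: i {le_in} => [|i IH]; first by rewrite !expr0 !mulr1.
  by rewrite iterS IH mulmxDl -!scalemxAl vA wA !scalerA !exprSr !mulrA.
apply: le_trans (vnormD _ _) _; rewrite !vnormZ !normcM !normcX expr1n mulr1 mulrDr.
have ai : normc a ^+ i <= normc a ^+ n by apply: ler_weXn2l.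
have ci : normc c ^+ i <= 1 by apply: exprn_ile1 => //; exact: normc_ge0.
have ai0 : 0 <= normc a ^+ i by rewrite exprn_ge0 // normc_ge0.
have ci0 : 0 <= normc c ^+ i by rewrite exprn_ge0 // normc_ge0.
apply: lerD; rewrite [leRHS]mulrC.
  apply: ler_pM; rewrite ?mulr_ge0 ?normc_ge0 ?vnorm_ge0 //.
    by apply: ler_wpM2l => //; exact: normc_ge0.
  by rewrite /M; have := vnorm_ge0 w; lra.
apply: ler_pM; rewrite ?mulr_ge0 ?normc_ge0 ?vnorm_ge0 //.
  by rewrite -[leRHS]mulr1; apply: ler_wpM2l => //; exact: normc_ge0.
by rewrite /M; have := vnorm_ge0 v; lra.
Qed.

(** Covers a Jordan block: replacing [w] by a small multiple shrinks the off-diagonal entry to at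
    most [r - 1], so that iterates grow at most like [r ^+ i], for any [r > 1]. *)
Lemma triangular_entropy_le (v w : C2 R) (a c k : Cplx R) (r : R) :
  mx_of_rows v w \in unitmx -> v *m A = a *: v -> w *m A = k *: v + c *: w ->
  normc a = 1 -> normc c = 1 -> 1 < r -> (topological_entropy R f <= (ln ((r * r) ^+ 2))%:E)%E.
Proof.
move=> uG vA wA a1 c1 r1.
have k1 : 0 < 1 + normc k by rewrite ltr_pwDl ?normc_ge0.
pose t := (r - 1) / (1 + normc k).
have t0 : 0 < t by rewrite divr_gt0 // subr_gt0.
have tk : t * normc k <= r - 1.
  rewrite /t mulrAC ler_pdivrMr // ler_wpM2l ?lerDr //; lra.
pose w' := (t%:C : Cplx R) *: w.
have w'A : w' *m A = (t%:C * k : Cplx R) *: v + c *: w'.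
  by rewrite -scalemxAl wA scalerDr !scalerA [c * _]mulrC.
have uG' : mx_of_rows v w' \in unitmx.
  move: uG; rewrite !unitmxE !unitfE !det_mx_of_rows !mxE.
  have -> : v 0 ord0 * (t%:C * w 0 ord_max) - v 0 ord_max * (t%:C * w 0 ord0) =
    (t%:C : R[i]) * (v 0 ord0 * w 0 ord_max - v 0 ord_max * w 0 ord0) by ring.
  move=> h; rewrite mulf_neq0 //; apply/eqP => /(@complexI R t 0) t00.
  by rewrite t00 ltxx in t0.
clearbody w'; have [K K0 KP] := rows_coordinates uG'.
pose M := vnorm v + vnorm w' + 1.
have M0 : 0 < M by rewrite /M ltr_wpDl // addr_ge0 ?vnorm_ge0.
apply: (entropy_le fE K0 M0 (ltW r1) (ltW r1) KP) => n i x1 x2 le_in.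
have [y1 [y2 [-> y1le y2le]]] : exists y1 y2 : Cplx R,
    [/\ iter i (mulmx^~ A) (x1 *: v + x2 *: w') = y1 *: v + y2 *: w',
    normc y1 <= (normc x1 + normc x2) * r ^+ i & normc y2 <= (normc x1 + normc x2) * r ^+ i].
  have s0 : 0 <= normc x1 + normc x2 by rewrite addr_ge0 ?normc_ge0.
  suff [y1 [y2 [E y1le y2le]]] : exists y1 y2 : Cplx R,
    [/\ iter i (mulmx^~ A) (x1 *: v + x2 *: w') = y1 *: v + y2 *: w',
    normc y1 <= (normc x1 + normc x2) * r ^+ i & normc y2 <= normc x1 + normc x2].
    exists y1, y2; split => //; apply: le_trans y2le _; rewrite -[leLHS]mulr1.
    by rewrite ler_wpM2l // exprn_ege1 // ltW.
  elim: i {le_in} => [|i [y1 [y2 [IH y1le y2le]]]].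
    by exists x1, x2; split=> //=; rewrite ?expr0 ?mulr1 ?lerDl ?lerDr ?normc_ge0.
  exists (a * y1 + t%:C * k * y2), (c * y2); split.
  - rewrite iterS IH mulmxDl -!scalemxAl vA w'A scalerDr !scalerA addrA -scalerDl.
    by congr (_ *: _ + _ *: _); ring.
  - apply: le_trans (ler_normcD _ _) _; rewrite !normcM a1 mul1r normc_real (gtr0_norm t0).
    have r_ge1 : 1 <= r ^+ i by rewrite exprn_ege1 // ltW.
    have y2r : normc y2 <= (normc x1 + normc x2) * r ^+ i.
      by apply: le_trans y2le _; rewrite -[leLHS]mulr1 ler_wpM2l.
    have : t * normc k * normc y2 <= (r - 1) * ((normc x1 + normc x2) * r ^+ i).
      apply: ler_pM => //; last exact: normc_ge0.
      by rewrite mulr_ge0 ?normc_ge0 // ltW.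
    by rewrite exprSr; lra.
  - by rewrite normcM c1 mul1r.
have ri : r ^+ i <= r ^+ n by apply: ler_weXn2l => //; exact: ltW.
have s0 : 0 <= normc x1 + normc x2 by rewrite addr_ge0 ?normc_ge0.
have sr : (normc x1 + normc x2) * r ^+ i <= (normc x1 + normc x2) * r ^+ n.
  exact: ler_wpM2l.
apply: le_trans (vnormD _ _) _; rewrite !vnormZ -mulrDl.
have h1 : normc y1 * vnorm v <= ((normc x1 + normc x2) * r ^+ n) * vnorm v.
  by apply: ler_wpM2r; [exact: vnorm_ge0|exact: le_trans sr].
have h2 : normc y2 * vnorm w' <= ((normc x1 + normc x2) * r ^+ n) * vnorm w'.
  by apply: ler_wpM2r; [exact: vnorm_ge0|exact: le_trans sr].
apply: le_trans (lerD h1 h2) _; rewrite -mulrDr [leRHS]mulrC; apply: ler_wpM2l.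
  by rewrite mulr_ge0 // exprn_ge0 //; lra.
by rewrite /M; lra.
Qed.

End Bounds.

Theorem entropy_eigenvalues (X : torus2 R) (f : torus_points X -> torus_points X) (lambda : R) :
  1 < lambda -> automorphism f -> topological_entropy R f = (ln lambda)%:E ->
  exists (g : 'M[R[i]]_2) (d : 'rV[R[i]]_2), [/\ g \in unitmx,
    forall z, lattice X z -> lattice X (z *m (invmx g *m diag_mx d *m g : 'M[Cplx R]_2)),
    normc (d 0 ord0) ^+ 2 = lambda & normc (d 0 ord0) * normc (d 0 ord_max) = 1].
Proof.
move=> lam1 /biholomorphic_affine[A [u [uA XA fE]]] entf.
have [b fX] := torus_full_lattice X.
have detA : normc (\det (A : 'M[R[i]]_2)) = 1 := lattice_det_unit uA fX XA.
have lam0 : 0 < lambda by lra.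
have diag_case (v w : 'rV[R[i]]_2) (a c : R[i]) : mx_of_rows v w \in unitmx ->
    v *m (A : 'M[R[i]]_2) = a *: v -> w *m (A : 'M[R[i]]_2) = c *: w ->
    1 < normc a -> normc a * normc c = 1 ->
    exists (g : 'M[R[i]]_2) (d : 'rV[R[i]]_2), [/\ g \in unitmx,
    forall z, lattice X z -> lattice X (z *m (invmx g *m diag_mx d *m g : 'M[Cplx R]_2)),
    normc (d 0 ord0) ^+ 2 = lambda & normc (d 0 ord0) * normc (d 0 ord_max) = 1].
  move=> uG vA wA a1 ac1.
  have a0 : 0 < normc a by lra.
  have c1 : normc c <= 1.
    by rewrite -(ler_pM2l a0) ac1 mulr1 ltW.
  have v0 : v != 0.
    apply: contraTneq uG => ->; rewrite unitmxE unitfE det_mx_of_rows !mxE.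
    by rewrite !mul0r subrr eqxx.
  exists (mx_of_rows v w), (\row_i (if i == ord0 then a else c)); split => //.
  - move=> z Xz; suff -> : invmx (mx_of_rows v w) *m
        diag_mx (\row_i (if i == ord0 then a else c)) *m mx_of_rows v w = A.
      exact: (XA z).1.
    apply: (can_inj (mulKmx uG)); rewrite -mulmxA mulKVmx // mx_of_rowsM vA wA.
    apply/row_matrixP => i; rewrite row_mul !rowK row_diag_mx mxE -scalemxAl -rowE rowK.
    by case: ifP.
  - rewrite !mxE /=; apply: (@ln_inj R); rewrite ?posrE ?exprn_gt0 //.
    apply/le_anti; rewrite -!lee_fin -entf.
    by rewrite (entropy_ge fE v0 vA a1) (diagonal_entropy_le fE uG vA wA (ltW a1) c1).
  - by rewrite !mxE.
have [a [c [k [v [w [uG vA wA detE]]]]]] := triangular_basis A.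
have ac1 : normc a * normc c = 1 by rewrite -normcM -detE.
have [a1|a1] := eqVneq (normc a) 1.
  have c1 : normc c = 1 by move: ac1; rewrite a1 mul1r.
  (* With [r] the fourth root of a number strictly between 1 and [lambda], the triangular bound puts
     the entropy below [ln lambda]. *)
  pose mu := (1 + lambda) / 2; pose r := Num.sqrt (Num.sqrt mu).
  have mu1 : 1 < mu by rewrite /mu; lra.
  have mulam : mu < lambda by rewrite /mu; lra.
  have rE : (r * r) ^+ 2 = mu.
    by rewrite -expr2 sqr_sqrtr ?sqrtr_ge0 // sqr_sqrtr //; lra.
  have sqrt_gt1 (x : R) : 1 < x -> 1 < Num.sqrt x.
    move=> x1; rewrite -(@ltr_pXn2r _ 2) ?nnegrE ?sqrtr_ge0 // expr1n sqr_sqrtr //; lra.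
  have r1 : 1 < r by apply: (sqrt_gt1); exact: sqrt_gt1.
  have := triangular_entropy_le fE uG vA wA a1 c1 r1.
  by rewrite rE entf lee_fin ler_ln ?posrE //; lra.
have ac : a != c.
  apply/eqP => ac; move: ac1 a1; rewrite -ac -expr2 => /eqP.
  by rewrite sqrp_eq1 ?normc_ge0 // => ->.
have ca0 : c - a != 0 by rewrite subr_eq0 eq_sym.
(* Distinct eigenvalues: this shift of [w] removes the off-diagonal entry. *)
pose w' := w + (k / (c - a)) *: v.
have w'A : w' *m (A : 'M[R[i]]_2) = c *: w'.
  rewrite mulmxDl wA -scalemxAl vA /w' scalerDr !scalerA addrAC -scalerDl addrC.
  by congr (_ + _ *: _); field.
have uG' : mx_of_rows v w' \in unitmx.
  move: uG; rewrite !unitmxE !unitfE !det_mx_of_rows !mxE; congr (_ != 0); ring.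
have uG'' : mx_of_rows w' v \in unitmx.
  move: uG'; rewrite !unitmxE !unitfE !det_mx_of_rows -oppr_eq0.
  by congr (_ != 0); ring.
have [a_gt1|a_le1] := ltP 1 (normc a); first exact: (diag_case v w' a c).
apply: (diag_case w' v c a) => //; last by rewrite mulrC.
have a_lt1 : normc a < 1 by rewrite lt_neqAle a1.
have c0 : 0 < normc c.
  by rewrite normc_gt0; apply/eqP => c0; move: ac1; rewrite c0 normc0 mulr0; lra.
by rewrite -[X in X < _]ac1 gtr_pMl.
Qed.

End EigenvaluesFromEntropy.

(** * Factors of the characteristic polynomial *)

Section Reducibility.
Context (R : realType).
Local Notation toC := (map_poly (intr : int -> R[i])).

Definition square_case (lambda : R) := exists n : int,
  lambda + lambda^-1 + 2 = n%:~R ^+ 2 \/ lambda + lambda^-1 - 2 = n%:~R ^+ 2.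

Lemma quadratic_square_case (u v : R[i]) (n del : int) (lambda : R) : 1 < lambda ->
  u + v = n%:~R -> u * v = del%:~R -> `|del| = 1 -> normc u ^+ 2 = lambda ->
  square_case lambda.
Proof.
move=> lam1 uvD uvM del1 ulam.
have lam0 : 0 < lambda by lra.
have nu0 : 0 < normc u.
  by rewrite lt_def normc_ge0 andbT -(sqrf_eq0 (normc u)) ulam gt_eqF.
have nu1 : 1 < normc u.
  by rewrite -(@ltr_pXn2r _ 2) ?nnegrE ?(ltW nu0) // expr1n ulam.
have u0 : u != 0 by rewrite -normc_gt0.
have intC (m : int) : (m%:~R : R[i]) = (m%:~R : R)%:C by rewrite rmorph_int.
have nuv : normc u * normc v = 1.
  by rewrite -normcM uvM intC normc_real -intr_norm del1.
have nv1 : normc v < 1 by rewrite -nuv ltr_pMl //; nra.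
(* The conjugate of [u] is a root of the same integral quadratic; it is not [v], whose modulus is
   below 1, so [u] is real. *)
have uu : u^* = u.
  have sD : u^* + v^* = u + v.
    by transitivity ((u + v)^*); [rewrite rmorphD|rewrite uvD intC conjc_real].
  have sM : u^* * v^* = u * v.
    by transitivity ((u * v)^*); [rewrite rmorphM|rewrite uvM intC conjc_real].
  have : (u^* - u) * (u^* - v) = 0.
    have -> : (u^* - u) * (u^* - v) = u^* * u^* - (u + v) * u^* + u * v by ring.
    by rewrite -sD -sM; ring.
  move/eqP; rewrite mulf_eq0 !subr_eq0 => /orP[/eqP //|/eqP uv].
  by exfalso; move: nv1; rewrite -uv normc_conj; lra.
have uR : u = (complex.Re u)%:C.
  by case: u uu {ulam nu0 nu1 u0 nuv uvD uvM} => x y /= [yy]; congr (_ +i* _); lra.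
move: (complex.Re u) uR => x uR.
have xlam : x ^+ 2 = lambda by rewrite -ulam uR normc_real real_normK ?num_real.
have x0 : x != 0 by apply: contra_eq_neq xlam => ->; rewrite expr0n lt_eqF.
have vE : v = (del%:~R / x)%:C.
  apply: (mulfI u0); rewrite uvM uR intC -(rmorphM (real_complex R)); congr (_%:C).
  by rewrite mulrC divfK.
have nE : n%:~R = x + del%:~R / x.
  apply: (@complexI R); rewrite -intC -uvD uR vE; exact/esym/(rmorphD (real_complex R)).
exists n; rewrite nE.
have delE : (del%:~R : R) = 1 \/ (del%:~R : R) = - 1.
  have /eqP := del1; rewrite eqr_norml => /andP[/orP[/eqP->|/eqP->] _]; [by left|right].
  by rewrite rmorphN.
(* The square of x + del / x is x^2 + x^-2 + 2 del, with x^2 = lambda; the sign [del] selects the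
   alternative. *)
rewrite -xlam; case: delE => ->; [left|right]; field; exact: x0.
Qed.

Context (a1 a2 : R[i]) (lambda : R) (P : {poly int}).
Hypotheses (lam1 : 1 < lambda) (a1lam : normc a1 ^+ 2 = lambda)
  (a12 : normc a1 * normc a2 = 1)
  (PE : toC P = \prod_(x <- conj_roots a1 a2) ('X - x%:P)).

Let size_toC (p : {poly int}) : size (toC p) = size p.
Proof. by apply: size_map_inj_poly => //; exact: intr_inj. Qed.

Let nu0 : 0 < normc a1.
Proof.
rewrite lt_def normc_ge0 andbT -(sqrf_eq0 (normc a1)) a1lam gt_eqF //.
by apply: lt_trans lam1.
Qed.

Let nu1 : 1 < normc a1.
Proof. by rewrite -(@ltr_pXn2r _ 2) ?nnegrE ?(ltW nu0) // expr1n a1lam. Qed.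

Let size_P : size P = 5%N.
Proof. by rewrite -size_toC PE size_prod_XsubC. Qed.

Let root_P z : root (toC P) z -> normc z = normc a1 \/ normc z = normc a2.
Proof.
rewrite PE root_prod_XsubC !inE => /or4P[] /eqP ->; rewrite ?normc_conj;
  by [left|right].
Qed.

Let lead_P : lead_coef P = 1.
Proof.
apply: (@intr_inj R[i]); rewrite -lead_coef_map_inj //; last exact: intr_inj.
by rewrite PE (monicP (monic_prod_XsubC _ _ _)).
Qed.

Let coef0_P : P`_0 = 1.
Proof.
apply: (@intr_inj R[i]); rewrite -coef_map PE /= -horner_coef0 horner_prod.
transitivity ((a1 * a1^*) * (a2 * a2^*)).
  by rewrite !big_cons big_nil !hornerE /=; ring.
rewrite !mulc_conj -(rmorphM (real_complex R)) -exprMn a12 expr1n //.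
Qed.

Let absz_unit (m n : int) : m * n = 1 -> `|m| = 1.
Proof.
move=> mn; have /eqP := congr1 absz mn; rewrite abszM muln_eq1 => /andP[/eqP m1 _].
by rewrite -abszE m1.
Qed.

Let linear_factor (p r : {poly int}) : P = p * r -> size p <> 2%N.
Proof.
move=> Pp sp.
have lp : `|lead_coef p| = 1 by apply: (@absz_unit _ (lead_coef r)); rewrite -lead_coefM -Pp.
have cp : `|p`_0| = 1 by apply: (@absz_unit _ r`_0); rewrite -coef0M -Pp.
have [z pz] : exists z, root (toC p) z by apply/closed_rootP; rewrite size_toC sp.
have Pz : root (toC P) z by rewrite Pp rmorphM rootM pz.
have z1 : normc z = 1.
  have := pz; rewrite rootE horner_coef size_toC sp !big_ord_recl big_ord0 /= !coef_map /=.
  rewrite expr0 mulr1 addr0 expr1 => /eqP; rewrite lead_coefE sp /= in lp.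
  move/eqP; rewrite addrC addr_eq0 => /eqP/(congr1 (@normc R)).
  have intC (m : int) : normc (m%:~R : R[i]) = `|m|%:~R.
    by rewrite -[m%:~R](rmorph_int (real_complex R)) normc_real intr_norm.
  by rewrite normcM normc_opp !intC lp cp mul1r.
have [h|h] := root_P Pz; first by move: nu1; rewrite -h z1 ltxx.
by move: a12 nu1; rewrite -h z1 mulr1 => ->; rewrite ltxx.
Qed.

Let quadratic_factor (p r : {poly int}) : P = p * r -> size p = 3%N -> square_case lambda.
Proof.
move=> Pp sp.
have lp : `|lead_coef p| = 1 by apply: (@absz_unit _ (lead_coef r)); rewrite -lead_coefM -Pp.
have cp : `|p`_0| = 1 by apply: (@absz_unit _ r`_0); rewrite -coef0M -Pp.
have [s sE] := closed_field_poly_normal (toC p).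
have lC : lead_coef (toC p) = (lead_coef p)%:~R by rewrite lead_coef_map_inj //; exact: intr_inj.
have l0 : (lead_coef p)%:~R != 0 :> R[i] by rewrite intr_eq0 -normr_eq0 lp.
have : size s = 2%N.
  have := congr1 (fun q : {poly R[i]} => size q) sE.
  by rewrite size_toC sp size_scale ?lC // size_prod_XsubC => -[].
case: s sE => [|u [|v [|]]] //= sE _.
rewrite !big_cons big_nil mulr1 lC in sE.
have ll : (lead_coef p)%:~R * (lead_coef p)%:~R = 1 :> R[i].
  by rewrite -intrM -expr2 -real_normK ?num_real // lp expr1n.
have c0 : u * v = (lead_coef p * p`_0)%:~R.
  have := congr1 (fun q : {poly R[i]} => q.[0]) sE.
  rewrite horner_coef0 coef_map /= hornerZ hornerM !hornerE /= => c0E.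
  rewrite intrM c0E; transitivity ((lead_coef p)%:~R * (lead_coef p)%:~R * (u * v)).
    by rewrite ll mul1r.
  by ring.
have c1 : u + v = (- lead_coef p * p`_1)%:~R.
  have eval x : (toC p).[x] = (lead_coef p)%:~R * ((x - u) * (x - v)).
    by rewrite sE !hornerE.
  have coefs x : (toC p).[x] = (p`_0)%:~R + (p`_1)%:~R * x + (p`_2)%:~R * (x * x).
    rewrite horner_coef size_toC sp !big_ord_recl big_ord0 /= !coef_map /=.
    by rewrite expr0 mulr1 addr0 expr1 expr2 addrA.
  (* The middle coefficient is read off from the values at 1 and -1. *)
  have E : (p`_1)%:~R * 2 = - ((lead_coef p)%:~R * (u + v) * 2) :> R[i].
    transitivity ((toC p).[1] - (toC p).[-1]); first by rewrite !coefs; ring.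
    by rewrite !eval; ring.
  have two : (2 : R[i]) != 0 by rewrite pnatr_eq0.
  apply: (mulIf two); rewrite intrM rmorphN /= -mulrA E.
  transitivity ((lead_coef p)%:~R * (lead_coef p)%:~R * ((u + v) * 2)).
    by rewrite ll mul1r.
  by ring.
have ru : root (toC P) u.
  by rewrite Pp rmorphM /= rootM sE rootZ // rootM !root_XsubC eqxx.
have rv : root (toC P) v.
  by rewrite Pp rmorphM /= rootM sE rootZ // rootM !root_XsubC eqxx orbT.
have del1 : `|lead_coef p * p`_0| = 1 by rewrite normrM lp cp.
have [h|h] := root_P ru.
  by apply: (quadratic_square_case lam1 c1 c0 del1); rewrite h.
(* Here [u] has the modulus of [a2], so [v] is the large root and the two exchange roles. *)
rewrite addrC in c1; rewrite mulrC in c0.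
apply: (quadratic_square_case lam1 c1 c0 del1).
suff -> : normc v = normc a1 by [].
have n2 : normc a2 != 0 by apply/eqP => n2; move: a12; rewrite n2 mulr0; lra.
apply: (mulIf n2); rewrite a12 -h -normcM c0.
by rewrite -[(_ * _)%:~R](rmorph_int (real_complex R)) normc_real -intr_norm del1.
Qed.

(** A common root makes the gcd of [P] and [q] over the rationals nonconstant; by Gauss's lemma it
    gives a factor of [P] over the integers, of degree at most 3. *)
Lemma reducible_square_case (q : {poly int}) : q != 0 -> (size q <= 4)%N ->
  root (toC q) a1 || root (toC q) a2 -> square_case lambda.
Proof.
move=> q0 sq qa.
pose toQ := map_poly (intr : int -> rat).
have mapQ (p : {poly int}) : toC p = map_poly (ratr : rat -> R[i]) (toQ p).
  by rewrite -map_poly_comp; apply: eq_map_poly => c /=; rewrite ratr_int.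
have ncop : ~~ coprimep (toQ P) (toQ q).
  rewrite -(coprimep_map (ratr : {rmorphism rat -> R[i]})) -!mapQ.
  apply/negP => cop; move: qa; apply/negP; rewrite negb_or !rootE.
  by rewrite !(coprimep_root cop) // PE root_prod_XsubC !inE eqxx ?orbT.
have Qq0 : toQ q != 0 by rewrite -size_poly_eq0 size_rat_int_poly size_poly_eq0.
have [p1 [c c0 dE] [r Pr]] := dvdpP_rat_int (dvdp_gcdl (toQ P) (toQ q)).
have sp1 : size p1 = size (gcdp (toQ P) (toQ q)).
  by rewrite dE size_scale // size_rat_int_poly.
have sp4 : (size p1 <= 4)%N.
  by rewrite sp1; apply: leq_trans (dvdp_leq Qq0 (dvdp_gcdr _ _)) _; rewrite size_rat_int_poly.
have p10 : p1 != 0.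
  by apply: contraTneq (oner_neq0 int) => p10; rewrite -lead_P Pr p10 mul0r lead_coef0.
have r0 : r != 0 by apply: contraTneq (oner_neq0 int) => r0; rewrite -lead_P Pr r0 mulr0 lead_coef0.
(* Sizes exceed degrees by one, so degrees adding up to 4 give sizes adding up to 6. *)
have sPr : (size p1 + size r)%N = 6.
  by have := size_P; rewrite Pr size_mul //; case: (_ + _)%N => //= n ->.
have sp0 : (0 < size p1)%N by rewrite lt0n size_poly_eq0.
have sp1' : size p1 != 1%N by rewrite sp1; exact: ncop.
have sp2 := linear_factor Pr.
have Pr' : P = r * p1 by rewrite mulrC.
have sr2 := linear_factor Pr'.
apply: (quadratic_factor Pr).
(* A cubic factor would leave a linear cofactor, so only degree 2 remains. *)
by move: sp4 sPr sp0 sp1' sp2 sr2; case: (size p1) => [|[|[|[|[|]]]]] //;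
  case: (size r) => [|[|[|[|[|]]]]].
Qed.

End Reducibility.

(** * Finiteness *)

Section NormalForm.
Context (R : realType) (d : 'rV[R[i]]_2).
Local Notation toC := (map_poly (intr : int -> R[i])).
Hypothesis dP : forall (q : {poly int}) i, q != 0 -> (size q <= 4)%N -> (toC q).[d 0 i] != 0.

Definition power_row (k : 'I_4) : C2 R := \row_i d 0 i ^+ k.

Let dg (l : C2 R) : 'M[Cplx R]_2 := diag_mx l.

(** For the vector of values of an integer polynomial at the entries of [d], its square is the norm
    computed in [lattice_norm_int]. *)
Definition coord_norm (z : C2 R) : R := normc (z 0 ord0) * normc (z 0 ord_max).

Let coord_norm_ge0 z : 0 <= coord_norm z.
Proof. by rewrite mulr_ge0 // normc_ge0. Qed.

Let mul_dgE (z l : C2 R) i : (z *m dg l) 0 i = z 0 i * l 0 i.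
Proof. by rewrite mul_mx_diag mxE. Qed.

Let coord_normM (z l : C2 R) : coord_norm (z *m dg l) = coord_norm z * coord_norm l.
Proof. by rewrite /coord_norm !mul_dgE !normcM mulrACA. Qed.

Let coord_norm_le z : coord_norm z <= vnorm z ^+ 2.
Proof. by apply: ler_pM; rewrite ?normc_ge0 // normc_le_vnorm. Qed.

Let coord_normMn (z : C2 R) n : coord_norm (z *+ n) = n%:R ^+ 2 * coord_norm z.
Proof.
have E i : normc ((z *+ n) 0 i) = n%:R * normc (z 0 i).
  have -> : (z *+ n) 0 i = (n%:R : R[i]) * z 0 i by rewrite mulmxnE mulr_natl.
  rewrite normcM -[n%:R in LHS](rmorph_nat (real_complex R)).
  by rewrite normc_real normr_nat.
by rewrite /coord_norm !E mulrACA expr2.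
Qed.

Let mulrz_entry (z : C2 R) (n : int) i : (z *~ n) 0 i = z 0 i *~ n.
Proof.
case: n => n; first exact: mulmxnE.
by rewrite NegzE !mulrNz mxE; congr (- _); exact: mulmxnE.
Qed.

Let comb_poly (c : 'I_4 -> int) : {poly int} := \poly_(k < 4) c (inord k).

Let comb_polyE (c : 'I_4 -> int) i :
  (\sum_k power_row k *~ c k) 0 i = (toC (comb_poly c)).[d 0 i].
Proof.
rewrite (@horner_coef_wide _ 4); last first.
  by rewrite size_map_inj_poly ?size_poly //; exact: intr_inj.
rewrite summxE; apply: eq_bigr => k _.
rewrite coef_map coef_poly ltn_ord inord_val /=.
by rewrite mulrz_entry mxE -mulrzl.
Qed.

Let comb_poly_neq0 c k : c k != 0 -> comb_poly c != 0.
Proof.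
apply: contra => /eqP c0; have := congr1 (fun q : {poly int} => q`_k) c0.
by rewrite coef_poly ltn_ord inord_val coef0 => ->.
Qed.

Let comb_mul (F : 'I_4 -> C2 R) (l : C2 R) (c : 'I_4 -> int) :
  \sum_k (F k *m dg l) *~ c k = (\sum_k F k *~ c k) *m dg l.
Proof.
rewrite mulmx_suml; apply: eq_bigr => k _; exact/esym/(raddfMz (mulmxr (dg l))).
Qed.

Let real_comb_mul (F : 'I_4 -> C2 R) (l : C2 R) t :
  real_comb (fun k => F k *m dg l) t = real_comb F t *m dg l.
Proof. by rewrite /real_comb mulmx_suml; apply: eq_bigr => k _; rewrite scalemxAl. Qed.

Section OneLattice.
Context (L : set (C2 R)) (b : 'I_4 -> C2 R).
Hypotheses (fL : full_lattice L b) (LD : forall z, L z -> L (z *m (diag_mx d : 'M[Cplx R]_2))).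

Let sL : subgroup L := full_lattice_subgroup fL.

Let L_power l k : L l -> L (power_row k *m dg l).
Proof.
move=> Ll; case: k => k k4; elim: k k4 => [|k IH] k4.
  suff -> : power_row (Ordinal k4) *m dg l = l by [].
  by apply/rowP => i; rewrite mul_dgE mxE expr0 mul1r.
suff -> : power_row (Ordinal k4) *m dg l =
    power_row (Ordinal (ltnW k4)) *m dg l *m (diag_mx d : 'M[Cplx R]_2) by exact/LD/IH.
apply/rowP => i; rewrite (mul_mx_diag (_ *m dg l) (d : C2 R)) mxE !mul_dgE !mxE /= exprSr.
by rewrite mulrAC.
Qed.

(** An integer relation between the four vectors is an integer polynomial of degree at most 3
    vanishing at some entry of [d], excluded by [dP]; discreteness then passes from Z-free to a real
    basis. *)
Let power_span l : L l -> l != 0 ->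
  forall v, exists t, v = real_comb (fun k => power_row k *m dg l) t.
Proof.
move=> Ll l0; have [_ _ _ dL] := fL; apply: Rfree_span.
apply: (Zfree_Rfree sL dL (fun k => L_power k Ll)) => c; rewrite comb_mul => c0 k.
apply/eqP; apply: contraNT l0 => ck; apply/eqP/rowP => i.
have := congr1 (fun w : C2 R => w 0 i) c0; rewrite mul_dgE comb_polyE !mxE => /eqP.
rewrite mulf_eq0 (negPf (dP i (comb_poly_neq0 ck) (size_poly _ _))) /=.
by move=> /eqP.
Qed.

Let coord_neq0 l i : L l -> l != 0 -> l 0 i != 0.
Proof.
(* If a coordinate of [l] were 0, every vector of the span would share it, but (1, 1) is in the
   span. *)
move=> Ll l0; have [t tE] := power_span Ll l0 (const_mx 1).
have := congr1 (fun w : C2 R => w 0 i) tE; rewrite real_comb_mul mul_dgE mxE.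
by apply: contra_eq_neq => ->; rewrite mulr0 oner_neq0.
Qed.

Let coord_norm_gt0 l : L l -> l != 0 -> 0 < coord_norm l.
Proof. by move=> Ll l0; rewrite mulr_gt0 // normc_gt0 coord_neq0. Qed.

Let comb_norm_ge1 (c : 'I_4 -> int) : \sum_k power_row k *~ c k != 0 ->
  1 <= coord_norm (\sum_k power_row k *~ c k).
Proof.
move=> c0; have q0 : comb_poly c != 0.
  apply: contraNneq c0 => q0; apply/eqP/rowP => i.
  by rewrite comb_polyE q0 rmorph0 horner0 mxE.
have [m mE] := lattice_norm_int (comb_poly c) fL LD.
rewrite /coord_norm !comb_polyE.
have n0 : 0 < normc (toC (comb_poly c)).[d 0 ord0] * normc (toC (comb_poly c)).[d 0 ord_max].
  by rewrite mulr_gt0 // normc_gt0 dP // size_poly.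
rewrite -(@ler_pXn2r _ 2) ?nnegrE ?(ltW n0) ?ler01 // expr1n mE ler1n lt0n.
by rewrite -(eqr_nat R) -mE sqrf_eq0 gt_eqF.
Qed.

(** Division with remainder in the style of Hurwitz: after multiplication by some [m <= T ^ 4], [x]
    is an element of the order times [l] up to a remainder whose coefficients are below [1 / T]. *)
Let approximation l T x : L l -> l != 0 -> L x -> (0 < T)%N ->
  exists (m : nat) (c : 'I_4 -> int) (t : 'I_4 -> R), [/\ (0 < m <= T ^ 4)%N,
    forall k, `|t k| < T%:R^-1,
    x *+ m - (\sum_k power_row k *~ c k) *m dg l = real_comb power_row t *m dg l &
    L (x *+ m - (\sum_k power_row k *~ c k) *m dg l)].
Proof.
move=> Ll l0 Lx T0; have [t xE] := power_span Ll l0 x.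
have [m [c [mT mc]]] := simultaneous_approximation t T0.
exists m, c, (fun k => m%:R * t k - (c k)%:~R); split => //.
  rewrite -comb_mul int_combE -real_comb_mul real_combB real_combZ -xE.
  by rewrite -scaler_nat; congr (_ *: _ - _); rewrite rmorph_nat.
apply: sL.2; first exact: subgroupMn.
by rewrite -comb_mul; apply: subgroup_sum => // k; apply: subgroupMz => //; exact: L_power.
Qed.

(** Here [T] depends on the lattice: it is so large that the remainder is shorter than all nonzero
    lattice vectors. Then x m is a multiple of [l] by a nonzero element of the order, of norm at
    least 1. This makes the infimum of the norms positive. *)
Let coord_norm_bound : exists2 e : R, 0 < e & forall x, L x -> x != 0 -> e <= coord_norm x.
Proof.
have [b0|[l Ll l0]] : (forall l, L l -> l = 0) \/ exists2 l, L l & l != 0.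
  have [h|h] := pselect (exists2 l, L l & l != 0); [by right|left=> l Ll].
  by apply/eqP; apply: contrapT => /negP l0; apply: h; exists l.
  by exists 1 => // x Lx; rewrite (b0 x Lx) eqxx.
have [_ _ _ [e e0 eL]] := fL.
have [T [T0 TP]] := vnorm_real_comb_small (fun k => power_row k *m dg l) e0.
have T40 : 0 < ((T ^ 4)%:R : R) by rewrite ltr0n expn_gt0 T0.
exists (coord_norm l / (T ^ 4)%:R ^+ 2); first by rewrite divr_gt0 ?exprn_gt0 ?coord_norm_gt0.
move=> x Lx x0; have [m [c [t [/andP[m0 mT] tT xE xL]]]] := approximation Ll l0 Lx T0.
have small : vnorm (x *+ m - (\sum_k power_row k *~ c k) *m dg l) < e.
  by rewrite xE -real_comb_mul; exact: TP.
have /eqP := eL _ xL small; rewrite subr_eq0 => /eqP xm.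
rewrite ler_pdivrMr ?exprn_gt0 // mulrC.
apply: (@le_trans _ _ (coord_norm (x *+ m))).
  rewrite xm coord_normM ler_peMl // comb_norm_ge1 //.
  apply: contraNneq x0 => c0; move: xm; rewrite c0 mul0mx => /eqP.
  by rewrite -scaler_nat scaler_eq0 pnatr_eq0 -leqn0 leqNgt m0.
rewrite coord_normMn; apply: ler_wpM2r => //.
by rewrite ler_pXn2r ?nnegrE ?ler0n // ler_nat.
Qed.

Lemma near_minimal_vector : exists l, [/\ L l, l != 0 &
  forall x, L x -> x != 0 -> coord_norm l < 2 * coord_norm x].
Proof.
have [e e0 eP] := coord_norm_bound.
have [l0 Ll0 l00] : exists2 l, L l & l != 0.
  have [bL bfree _ _] := fL; exists (b ord0).
    apply/bL; exists (fun j => (j == ord0)%:R).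
    by rewrite (bigD1 ord0) //= mulr1z big1 ?addr0 // => j /negPf ->; rewrite mulr0z.
  apply/eqP => b0; have comb0 : real_comb b (fun j => (j == ord0)%:R) = 0.
    rewrite /real_comb big1 // => j _.
    by case: eqVneq => [->|_]; [rewrite b0 scaler0|rewrite scale0r].
  by have /eqP := bfree _ comb0 ord0; rewrite eqxx oner_eq0.
pose S := [set coord_norm x | x in [set x | L x /\ x != 0]].
have hS : has_inf S.
  split; first by exists (coord_norm l0); exists l0.
  by exists 0 => _ [x _ <-]; exact: coord_norm_ge0.
have infS : e <= inf S.
  by apply: lb_le_inf; [exact: hS.1|move=> _ [x [Lx x0] <-]; exact: eP].
(* A value below inf + e is below 2 inf, because e is at most the infimum. *)
have [_ [l [Ll l_neq0] <-] lS] := inf_adherent (lt_le_trans e0 infS) hS.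
exists l; split=> // x Lx x0.
have : inf S <= coord_norm x by apply: ge_inf; [exact: hS.2|exists x].
by move: lS; lra.
Qed.

(** In contrast with [coord_norm_bound], [T] depends on [d] alone: the remainder vanishes because
    its norm is too small against the near-minimal [l], whatever the lattice. *)
Lemma lattice_multiple T : (0 < T)%N ->
  (forall t, (forall k, `|t k| < T%:R^-1) -> vnorm (real_comb power_row t) < 2^-1) ->
  exists l, [/\ dg l \in unitmx, forall k, L (power_row k *m dg l) &
  forall x, L x -> exists c : 'I_4 -> int,
    x *+ (T ^ 4)`! = (\sum_k power_row k *~ c k) *m dg l].
Proof.
move=> T0 TP; have [l [Ll l0 lmin]] := near_minimal_vector.
exists l; split=> [|k|x Lx]; [|exact: L_power|].
  rewrite unitmxE unitfE det_diag prodf_seq_neq0; apply/allP => i _ /=.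
  exact: coord_neq0.
have [m [c [t [/andP[m0 mT] tT xE xL]]]] := approximation Ll l0 Lx T0.
have [|x0] := eqVneq (x *+ m - (\sum_k power_row k *~ c k) *m dg l) 0; last first.
  have := lmin _ xL x0; rewrite xE coord_normM => lt_l.
  have ln := coord_norm_gt0 Ll l0; have := TP t tT; have := vnorm_ge0 (real_comb power_row t).
  have := coord_norm_le (real_comb power_row t).
  move: (vnorm _) => y; move: (coord_norm (real_comb _ _)) lt_l => u lt_l uy y0 y1; exfalso.
  (* The remainder has norm at most a quarter of that of [l]; near-minimality asks for more than
     half. *)
  have : u <= 2^-1 * 2^-1.
    by apply: le_trans uy _; rewrite expr2; apply: ler_pM => //; exact: ltW.
  have : 1 < 2 * u by rewrite -(ltr_pM2r ln) mul1r -mulrA.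
  lra.
move=> /eqP; rewrite subr_eq0 => /eqP xm.
(* The multiplier [m] varies with [x], but being at most [T ^ 4] it divides the factorial, which
   serves all [x] at once. *)
have /dvdnP[n nE] : (m %| (T ^ 4)`!)%N by apply: dvdn_fact; rewrite m0.
exists (fun k => c k * n%:Z); rewrite nE mulnC mulrnA xm.
have -> : \sum_k power_row k *~ (c k * n%:Z) = (\sum_k power_row k *~ c k) *+ n.
  by rewrite -sumrMnl; apply: eq_bigr => k _; rewrite mulrzA pmulrn.
exact/esym/(raddfMn (mulmxr (dg l))).
Qed.

End OneLattice.

Definition between (H : nat) (L : set (C2 R)) := [/\ subgroup L,
  forall k, L (power_row k) &
  forall x, L x -> exists c : 'I_4 -> int, x *+ H = \sum_k power_row k *~ c k].

Lemma lattice_normal_form : exists2 H : nat, (0 < H)%N & forall L b,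
  full_lattice L b -> (forall z, L z -> L (z *m (diag_mx d : 'M[Cplx R]_2))) ->
  exists2 g : 'M[Cplx R]_2, g \in unitmx & between H [set z | L (z *m g)].
Proof.
have half : 0 < (2^-1 : R) by rewrite invr_gt0.
have [T [T0 TP]] := vnorm_real_comb_small power_row half.
exists (T ^ 4)`! => [|L b fL LD]; first exact: fact_gt0.
have [l [ul Lk Lx]] := lattice_multiple fL LD T0 TP.
have sL := full_lattice_subgroup fL.
exists (dg l) => //; split => //= [|x /Lx[c cE]].
  split=> [|x y xL yL] /=; first by rewrite mul0mx; exact: sL.1.
  by rewrite mulmxBl; exact: sL.2.
exists c; apply: (can_inj (mulmxK ul)); rewrite -cE.
exact: (raddfMn (mulmxr (dg l))).
Qed.

(** With O spanned by the power rows, this records L / O inside (1/H) O / O by residues of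
    coefficients modulo [H], as an element of a finite type. *)
Definition lattice_code (H : nat) (L : set (C2 R)) : {set {ffun 'I_4 -> 'I_H}} :=
  [set c : {ffun 'I_4 -> 'I_H} |
    `[< exists2 x, L x & x *+ H = \sum_k power_row k *~ (c k : nat)%:Z >]].

Lemma lattice_code_sub (H : nat) (L L' : set (C2 R)) : (0 < H)%N -> between H L ->
  between H L' -> lattice_code H L = lattice_code H L' -> L `<=` L'.
Proof.
move=> H0 [sL Lk LH] [sL' Lk' LH'] LL' x Lx; have [c cE] := LH x Lx.
have H0' : H%:Z != 0 by rewrite eqz_nat -lt0n.
(* Division of the coefficients by [H]: the quotients give a vector of O, common to both lattices,
   and the remainders are read in the code. *)
have modH k : (absz (c k %% H)%Z < H)%N.
  by rewrite -ltz_nat gez0_abs ?modz_ge0 // ltz_pmod // ltz_nat.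
pose c' := [ffun k : 'I_4 => Ordinal (modH k)].
pose y : C2 R := \sum_k power_row k *~ (c k %/ H)%Z.
have yL : L y by apply: subgroup_sum => // k; exact: subgroupMz.
have yL' : L' y by apply: subgroup_sum => // k; exact: subgroupMz.
have digit k : (c' k : nat)%:Z = c k - (c k %/ H)%Z * H%:Z.
  by rewrite ffunE /= gez0_abs // modz_ge0.
have cE' : (x - y) *+ H = \sum_k power_row k *~ (c' k : nat)%:Z.
  rewrite mulrnBl cE /y -sumrMnl -sumrB; apply: eq_bigr => k _.
  by rewrite digit mulrzBr mulrzA pmulrn.
have : c' \in lattice_code H L.
  by rewrite inE; apply/asboolP; exists (x - y) => //; exact: sL.2.
rewrite LL' inE => /asboolP[z L'z zE].
have -> : x = (x - y) + y by rewrite subrK.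
apply: subgroupD => //; suff -> : x - y = z by [].
apply/eqP; rewrite -subr_eq0; have : ((x - y) - z) *+ H == 0.
  by rewrite mulrnBl cE' zE subrr.
by rewrite -scaler_nat scaler_eq0 pnatr_eq0 -leqn0 leqNgt H0.
Qed.

End NormalForm.

(** * Finiteness of eigenvalue pairs and of isomorphism classes *)

Section Finiteness.
Context (R : realType).
Local Notation toC := (map_poly (intr : int -> R[i])).

(** The code is a relation, since an isomorphism class has many representatives and normal forms; it
    is enough that a shared code forces equality. *)
Lemma finite_by_code (T : Type) (K : finType) (C : set T) (code : T -> K -> Prop) :
  (forall c, C c -> exists k, code c k) ->
  (forall c c' k, C c -> C c' -> code c k -> code c' k -> c = c') -> finite_set C.
Proof.
move=> Ccode codeI.
(* [None] is the default outside [C], where [K] may offer no value. *)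
have /choice[h hP] : forall c, exists k : option K, C c -> exists2 k0, k = Some k0 & code c k0.
  move=> c; have [Cc|nC] := pselect (C c); last by exists None.
  by have [k ck] := Ccode c Cc; exists (Some k) => _; exists k.
have hinj : {in C &, injective h}.
  move=> c c'; rewrite !inE => Cc Cc' hcc'.
  have [k hk ck] := hP c Cc; have [k' hk' ck'] := hP c' Cc'.
  apply: (codeI c c' k) => //.
  by move: hcc'; rewrite hk hk' => -[->].
rewrite -(eq_finite_set (inj_card_eq hinj)).
exact: finite_finset.
Qed.

Lemma coef_prod_XsubC_le (s : seq R[i]) k :
  normc (\prod_(x <- s) ('X - x%:P))`_k <= \prod_(x <- s) (1 + normc x).
Proof.
elim: s k => [|x s IH] k.
  by rewrite !big_nil coef1; case: k => [|k]; rewrite ?normc1 ?normc0.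
rewrite !big_cons mulrBl coefB coefXM coefCM mulrDl mul1r.
apply: le_trans (ler_normcB _ _) _; apply: lerD.
  case: ifP => _ //; rewrite normc0 prodr_ge0 // => y _.
  by rewrite addr_ge0 ?normc_ge0.
by rewrite normcM; apply: ler_wpM2l; [exact: normc_ge0|exact: IH].
Qed.

Lemma finite_roots (p : {poly R[i]}) : p != 0 -> finite_set [set z | root p z].
Proof.
move=> p0; have [s sE] := closed_field_poly_normal p.
apply: (sub_finite_set (B := [set` s])) => [z /=|]; last exact: finite_seq.
by rewrite sE rootZ ?lead_coef_eq0 // root_prod_XsubC.
Qed.

Definition salem_pair (lambda : R) (d : 'rV[R[i]]_2) := [/\
  normc (d 0 ord0) ^+ 2 = lambda, normc (d 0 ord0) * normc (d 0 ord_max) = 1 &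
  exists P : {poly int}, toC P =
    \prod_(x <- conj_roots (d 0 ord0) (d 0 ord_max)) ('X - x%:P)].

Lemma finite_salem_pairs (lambda : R) : 1 < lambda -> finite_set (salem_pair lambda).
Proof.
move=> lam1; pose N := (Num.trunc ((1 + lambda) ^+ 4)).+1.
(* Coefficients lie strictly between [- N] and [N]; shifting them by [N] encodes them as
   ordinals. *)
pose poly_of (c : {ffun 'I_5 -> 'I_(N + N).+1}) : {poly int} :=
  \poly_(k < 5) ((c (inord k) : nat)%:Z - N%:Z).
pose roots := \bigcup_(c in [set c | toC (poly_of c) != 0]) [set z | root (toC (poly_of c)) z].
have froots : finite_set roots.
  apply: bigcup_finite => [|c /= c0]; last exact: finite_roots.
  exact: finite_finset.
pose row_of (p : R[i] * R[i]) : 'rV[R[i]]_2 := \row_i (if i == ord0 then p.1 else p.2).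
apply: (sub_finite_set (B := row_of @` (roots `*` roots))); last first.
  by apply: finite_image; exact: finite_setX.
move=> d [dlam d12 [P PE]].
have n0 : 0 < normc (d 0 ord0).
  by rewrite lt_def normc_ge0 andbT -(sqrf_eq0 (normc _)) dlam gt_eqF //; lra.
have n1 : 1 < normc (d 0 ord0).
  by rewrite -(@ltr_pXn2r _ 2) ?nnegrE ?(ltW n0) // expr1n dlam.
have n_le : normc (d 0 ord0) <= lambda.
  by rewrite -dlam expr2 ler_peMl // ltW.
have n2_le : normc (d 0 ord_max) <= lambda.
  have : normc (d 0 ord_max) <= 1 by rewrite -d12 ler_peMl ?normc_ge0 // ltW.
  lra.
have size_toC (p : {poly int}) : size (toC p) = size p.
  by apply: size_map_inj_poly => //; exact: intr_inj.
have sP : size P = 5%N by rewrite -size_toC PE size_prod_XsubC.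
have P_le k : `|P`_k| < N%:Z.
  have : normc (toC P)`_k <= (1 + lambda) ^+ 4.
    rewrite PE; apply: le_trans (coef_prod_XsubC_le _ _) _.
    have := normc_ge0 (d 0 ord0); have := normc_ge0 (d 0 ord_max) => h2 h1.
    rewrite /conj_roots !big_cons big_nil mulr1 !normc_conj.
    have -> : (1 + lambda) ^+ 4 =
        (1 + lambda) * ((1 + lambda) * ((1 + lambda) * (1 + lambda))) by ring.
    by do 3?[apply: ler_pM; rewrite ?mulr_ge0 ?addr_ge0 ?lerD2l //].
  rewrite coef_map /= -[_%:~R](rmorph_int (real_complex R)) normc_real -intr_norm => h.
  rewrite -(ltr_int R); apply: le_lt_trans h _; exact: truncnS_gt.
have c_lt (k : 'I_5) : (absz (P`_k + N%:Z)%R < (N + N).+1)%N.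
  have := P_le k; rewrite ltr_norml => /andP[h1 h2].
  rewrite -ltz_nat gez0_abs; last by rewrite -lerBlDr sub0r ltW.
  apply: (@lt_trans _ _ (N + N)%N%:Z); last by rewrite ltz_nat.
  by rewrite PoszD ltrD2r.
pose c := [ffun k : 'I_5 => Ordinal (c_lt k)].
have cP : poly_of c = P.
  apply/polyP => k; rewrite coef_poly; case: ifP => [k5|/negbT]; last first.
    by rewrite -leqNgt => k5; rewrite nth_default // sP.
  have := P_le k; rewrite ltr_norml => /andP[h1 h2].
  by rewrite ffunE /= inordK // gez0_abs ?addrK // -lerBlDr sub0r ltW.
have P0 : toC P != 0 by rewrite -size_poly_eq0 size_toC sP.
have root_in z : z \in conj_roots (d 0 ord0) (d 0 ord_max) -> roots z.
  by move=> zd; exists c; rewrite /= cP // PE root_prod_XsubC.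
exists (d 0 ord0, d 0 ord_max).
  by split; apply: root_in; rewrite !inE eqxx ?orbT.
apply/rowP => i; rewrite mxE /=; case: eqVneq => [->//|i0].
by congr (d 0 _); apply/val_inj; case: i i0 => [[|[|]]].
Qed.

Lemma salem_pair_horner_neq0 (lambda : R) d : 1 < lambda -> salem_pair lambda d ->
  ~ square_case lambda -> forall (q : {poly int}) i, q != 0 -> (size q <= 4)%N ->
  (toC q).[d 0 i] != 0.
Proof.
move=> lam1 [dlam d12 [P PE]] nsq q i q0 sq; apply/negP => qi; apply: nsq.
apply: (reducible_square_case lam1 dlam d12 PE q0 sq).
by move: i qi; apply: ord2P => qi; apply/orP; [left|right].
Qed.

(** The rows of [g] are eigenvectors, so [[set z | lattice X (z *m g)]] is the lattice in
    eigencoordinates, where the automorphism acts by [diag_mx d]. *)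
Definition normalized (d : 'rV[R[i]]_2) (X : torus2 R) := exists (g : 'M[Cplx R]_2) b,
  [/\ g \in unitmx, full_lattice [set z | lattice X (z *m g)] b &
  forall z, lattice X (z *m g) -> lattice X (z *m (diag_mx d : 'M[Cplx R]_2) *m g)].

Lemma entropy_normalized (lambda : R) X : 1 < lambda -> admits_entropy (ln lambda)%:E X ->
  exists2 d, salem_pair lambda d & normalized d X.
Proof.
move=> lam1 [f [af ef]]; have [g [d [ug XD dlam d12]]] := entropy_eigenvalues lam1 af ef.
have [b fX] := torus_full_lattice X.
have ug' : invmx (g : 'M[Cplx R]_2) \in unitmx by rewrite unitmx_inv.
have fL := full_lattice_map ug' fX; rewrite invmxK in fL.
have LD z : lattice X (z *m (g : 'M[Cplx R]_2)) ->
    lattice X (z *m (diag_mx d : 'M[Cplx R]_2) *m (g : 'M[Cplx R]_2)).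
  by move=> /XD; rewrite !mulmxA mulmxK.
exists d; last by exists (g : 'M[Cplx R]_2), (fun i => b i *m invmx (g : 'M[Cplx R]_2)).
by split=> //; exact: lattice_char_poly fL LD.
Qed.

Lemma finite_normalized_classes (lambda : R) d : 1 < lambda -> salem_pair lambda d ->
  ~ square_case lambda -> finite_set [set isomorphism_class X | X in normalized d].
Proof.
move=> lam1 dlam nsq; have dP := salem_pair_horner_neq0 lam1 dlam nsq.
have [H H0 HP] := lattice_normal_form dP.
apply: (@finite_by_code _ _ _ (fun C (k : {set {ffun 'I_4 -> 'I_H}}) => exists X (g : 'M[Cplx R]_2),
  [/\ C = isomorphism_class X, g \in unitmx, between d H [set z | lattice X (z *m g)] &
  lattice_code d H [set z | lattice X (z *m g)] = k])).
  move=> _ [X [g [b [ug fL LD]]] <-]; have [g' ug' bet] := HP _ _ fL LD.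
  have gE : [set z | lattice X (z *m (g' *m g))] = [set z | [set z | lattice X (z *m g)] (z *m g')].
    by apply/seteqP; split=> z /=; rewrite mulmxA.
  exists (lattice_code d H [set z | lattice X (z *m (g' *m g))]), X, (g' *m g).
  by split=> //; [rewrite unitmx_mul ug' ug|rewrite gE].
move=> _ _ k _ _ [X [g [-> ug bX kX]]] [Y [h [-> uh bY kY]]].
have kXY : lattice_code d H [set z | lattice X (z *m g)] =
    lattice_code d H [set z | lattice Y (z *m h)] by rewrite kX kY.
have XY := lattice_code_sub H0 bX bY kXY.
have YX := lattice_code_sub H0 bY bX (esym kXY).
(* Equal codes mean equal normalised lattices, so composing one normalisation with the inverse of
   the other maps one lattice onto the other. *)
apply: isomorphism_class_eq; apply/isomorphicP; exists (invmx g *m h).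
  by rewrite unitmx_mul unitmx_inv ug uh.
move=> z; rewrite mulmxA; split=> [Xz|Yz]; first by apply: XY => /=; rewrite mulmxKV.
by rewrite -[z](mulmxKV ug); exact: YX.
Qed.

End Finiteness.

Theorem theorem1p2 (R : realType) (lambda : R)
    (lambda_salem : salem_number lambda)
    (lambda_entropy : exists X : torus2 R, admits_entropy (ln lambda)%:E X) :
  (exists n : int, lambda + lambda^-1 + 2 = n%:~R ^+ 2 \/
                   lambda + lambda^-1 - 2 = n%:~R ^+ 2) \/
  finite_set [set isomorphism_class X | X in admits_entropy (ln lambda)%:E].
Proof.
have [lam1 _] := lambda_salem.
have [sq|nsq] := pselect (square_case lambda); [by left|right].
apply: (@sub_finite_set _ _ (\bigcup_(d in salem_pair lambda)
    [set isomorphism_class X | X in normalized d])).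
  move=> _ [X eX <-]; have [d dlam dX] := entropy_normalized lam1 eX.
  by exists d => //; exists X.
apply: bigcup_finite; first exact: finite_salem_pairs.
by move=> d dlam; exact: finite_normalized_classes lam1 dlam nsq.
Qed.
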